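(* Let $T\in\mathcal{T}_{\mathrm{BV}}$ have no regular invariant graph (i.e. no $p,q$-invariant open tube for any $p,q\in\mathbb{N}$), and suppose $T$ is not minimal. Let $M\subseteq\mathbb{T}^2$ be a minimal set of $T$. Then each connected component of $M$ is contained in a single fibre $\pi_1^{-1}(\theta)=\{\theta\}\times\mathbb{T}^1$.
   Context: $\mathbb{T}^1=\mathbb{R}/\mathbb{Z}$, $\mathbb{T}^2=\mathbb{T}^1\times\mathbb{T}^1$, $\pi_1$ the projection to the first coordinate, $\omega\in[0,1)$ irrational. $\mathcal{T}_{\mathrm{BV}}$: maps $T(\theta,x)=(\theta+\omega,T_\theta(x))$ on $\mathbb{T}^2$, homotopic to the identity, with fibre maps orientation-preserving $C^1$ circle diffeomorphisms, $DT_\theta(x)$ continuous in $(\theta,x)$, and $V(T):=\int_{\mathbb{T}^1}V_\theta\,d\theta<\infty$, $V_\theta$ the total variation of $\log DT_\theta$ over the circle. A minimal set is a nonempty closed $T$-invariant set containing no proper nonempty closed $T$-invariant subset; $T$ is minimal if $\mathbb{T}^2$ is a minimal set. An open $T$-invariant set $U$ is a $1,q$-invariant open tube if each fibre $U_\theta=\{x:(\theta,x)\in U\}$ consists of $q$ disjoint nonempty open intervals and $U$ is connected; if $U^1$ is a $1,q$-invariant open tube for $T^p$ and $U^i:=T^{i-1}(U^1)$, $i=1,\dots,p$, are pairwise disjoint, $\bigcup_iU^i$ is a $p,q$-invariant open tube. A regular invariant graph is the boundary line of such a tube, so having no regular invariant graph means there is no $p,q$-invariant open tube. (Such $T$ is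 topologically transitive.) *)

(* Defs.v *)
From HB Require Import structures.
From mathcomp Require Import all_boot all_order all_algebra.
From mathcomp Require Import all_classical all_reals all_analysis.
Set Implicit Arguments. Unset Strict Implicit. Unset Printing Implicit Defensive.
Import Order.TTheory GRing.Theory Num.Theory.
Import numFieldNormedType.Exports.
Local Open Scope classical_set_scope.
Local Open Scope ring_scope.

(* The torus T^2 = R^2 / Z^2 is represented through its universal cover R * R.
   A point z : R * R stands for its class mod Z^2; the topology of T^2 is
   encoded by the (pseudo)metric [tdist] below, which is the standard max-metric
   of T^2 pulled back to R * R.  Open / closed sets for this pseudometric are
   automatically Z^2-saturated, i.e. they are exactly lifts of open / closed
   subsets of T^2. *)

Section Torus.
Variable R : realType.

Definition fracR (t : R) : R := t - (Num.floor t)%:~R.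
Definition cdist (t : R) : R := Num.min (fracR t) (1 - fracR t).

Definition tdist (z w : R * R) : R :=
  Num.max (cdist (z.1 - w.1)) (cdist (z.2 - w.2)).

Definition topen (U : set (R * R)) : Prop :=
  forall z, U z -> exists2 e : R, 0 < e & forall w, tdist z w < e -> U w.

Definition tclosed (A : set (R * R)) : Prop := topen (~` A).

Definition tconnected (A : set (R * R)) : Prop :=
  forall U V : set (R * R), topen U -> topen V ->
    A `<=` U `|` V -> A `&` U `&` V = set0 ->
    A `&` U = set0 \/ A `&` V = set0.

Definition tcomponent (A : set (R * R)) (z : R * R) : set (R * R) :=
  [set w | exists C : set (R * R), [/\ tconnected C, C `<=` A, C z & C w]].

Definition tfibre (theta : R) : set (R * R) :=
  [set w | exists k : int, w.1 = theta + k%:~R].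

(* the skewT product T(theta,x) = (theta + omega, T_theta(x)), given through
   the lift F of the fibre maps: F theta is the lift of T_theta *)
Definition skewT (omega : R) (F : R -> R -> R) (z : R * R) : R * R :=
  (z.1 + omega, F z.1 z.2).

(* A is invariant under the (bijective) map S : S(A) = A, i.e. S^{-1}(A) = A *)
Definition invariant (S : R * R -> R * R) (A : set (R * R)) : Prop :=
  forall z, A z <-> A (S z).

Definition minimal_set (S : R * R -> R * R) (M : set (R * R)) : Prop :=
  [/\ M !=set0, tclosed M, invariant S M &
      forall B : set (R * R), B !=set0 -> tclosed B -> invariant S B ->
        B `<=` M -> M `<=` B].

Definition minimal_map (S : R * R -> R * R) : Prop := minimal_set S setT.

(* the fibre U_theta (viewed as a 1-periodic subset of R, i.e. a subset of
   T^1) consists of q pairwise disjoint nonempty open intervals (arcs) of T^1: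
   the i-th arc is the projection of (a i, b i), with a i < b i <= a i + 1 *)
Definition fibre_q_intervals (U : set (R * R)) (theta : R) (q : nat) : Prop :=
  exists a b : nat -> R,
    [/\ forall i, (i < q)%N -> a i < b i <= a i + 1,
        forall i j, (i < q)%N -> (j < q)%N -> i <> j ->
          forall (k : int) (x : R),
            ~ ((a i < x < b i) /\ (a j + k%:~R < x < b j + k%:~R)) &
        forall x, U (theta, x) <->
          exists i, (i < q)%N /\ exists k : int, a i + k%:~R < x < b i + k%:~R].

Definition tube1 (S : R * R -> R * R) (q : nat) (U : set (R * R)) : Prop :=
  [/\ topen U, invariant S U, tconnected U &
      forall theta, fibre_q_intervals U theta q].

Definition tube (S : R * R -> R * R) (p q : nat) (U1 : set (R * R)) : Prop :=
  tube1 (iter p S) q U1 /\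
  forall i j, (i < p)%N -> (j < p)%N -> i <> j ->
    (iter i S @` U1) `&` (iter j S @` U1) = set0.

Definition no_regular_invariant_graph (S : R * R -> R * R) : Prop :=
  forall p q : nat, (0 < p)%N -> (0 < q)%N -> forall U1, ~ tube S p q U1.


Definition Vtheta (F : R -> R -> R) (theta : R) : \bar R :=
  total_variation 0 1 (fun x => ln (derive1 (F theta) x)).

(* The class T_BV, stated on the lift F of the fibre maps:
   - T continuous (F jointly continuous);
   - T homotopic to the identity: F theta (x+1) = F theta x + 1 (degree one
     fibre maps) and F (theta+1) = F theta (no winding in the x-direction);
   - fibre maps orientation preserving C^1 diffeomorphisms: derivable with
     positive derivative, derivative DT_theta(x) continuous in (theta, x);
   - V(T) = int_{T^1} V_theta dtheta < oo. *)
Definition in_T_BV (F : R -> R -> R) : Prop :=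
  [/\ continuous (fun z : R * R => F z.1 z.2),
      forall theta x, F theta (x + 1) = F theta x + 1,
      forall theta x, F (theta + 1) x = F theta x &
      forall theta x, derivable (F theta) x 1] /\
  [/\
      forall theta x, 0 < derive1 (F theta) x,
      continuous (fun z : R * R => derive1 (F z.1) z.2) &
      (\int[@lebesgue_measure R]_(theta in `[0%R, 1%R]) Vtheta F theta < +oo)%E].

End Torus.

(* Main.v *)
Require Import Defs.
From HB Require Import structures.
From mathcomp Require Import all_boot all_order all_algebra.
From mathcomp Require Import all_classical all_reals all_analysis.
From mathcomp Require Import zify ring lra.
Set Implicit Arguments. Unset Strict Implicit. Unset Printing Implicit Defensive.
Import Order.TTheory GRing.Theory Num.Theory.
Import numFieldNormedType.Exports.
Local Open Scope classical_set_scope.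
Local Open Scope ring_scope.

(** The group Z^3 acts on the universal cover by lifted iterates and deck
    translations. Suppose that a box is disjoint from all its iterates. Its
    translates over a common base arc are linearly ordered in the fibres, and
    the elements of Z^3 that move it up generate a proper cone, whence a
    functional (n, k, m) |-> n rho + k kappa + m that is nonnegative on them. If
    its kernel contains elements with arbitrarily small base shift, then it has
    rank two, and the images of the box under the elements where the functional
    is nonnegative bound an invariant tube. Otherwise, at
    closest return times n, the intervals spanned by the j-th and the (j-n)-th
    images of the box are, for j < n, disjoint modulo 1 in each fibre, and a
    Denjoy distortion estimate, integrated over the base, contradicts
    V(T) < oo. So every box returns to itself.

    If a component C of M meets two fibres, a return of a small box outside M
    is interpolated to a continuous graph that avoids M and is invariant under
    some g in Z^3. A second return g', independent of g, gives a translate that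
    meets the graph up to an arc outside M. A chain of such translates that
    climbs by a full turn would separate C, so the translates by multiples of
    g' stay bounded, and again they bound an invariant tube. *)

(** Irrationality prevents a fibre from returning to itself, so the one-dimensional Denjoy argument
    cannot be run inside a fibre. Images of the box are therefore compared in a common fibre
    although they start over different points of the base arc. A weight supported on that arc
    selects the relevant images, and invariance of the integral under rotation brings all of them
    back to the arc.

    Closest returns are measured by the functional and not by the rotation, because the functional
    governs the vertical order of the translates: if a difference exceeds the closest value, all
    comparisons between the two pairs of images have the same sign.

    The dichotomy on the kernel has its origin in tubes. Two independent kernel elements make the
    functional proportional to an integer-valued one. Its levels are discrete, and between the
    images of consecutive levels there is room for an open strip, which projects to a tube.

    Non-minimality enters by contradiction: a component that meets two fibres forces M to be the
    whole torus. *)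

Section Basics.
Variable R : realType.
Implicit Types (t x : R) (U : set (R * R)).

(** Openness in the plane. Strips and regions above graphs are not saturated under Z^2, so [topen]
    does not apply to them. *)
Definition eopen U := forall z, U z ->
  exists2 e : R, 0 < e & forall w, `|w.1 - z.1| < e -> `|w.2 - z.2| < e -> U w.

Definition cont1 (f : R -> R) := forall x e, 0 < e ->
  exists2 d : R, 0 < d & forall y, `|y - x| < d -> `|f y - f x| < e.

Lemma cdist_le t (k : int) : cdist t <= `|t - k%:~R|.
Proof.
rewrite /cdist /fracR.
have := floor_le t; have := floorD1_gt t; rewrite intrD => h1 h2.
have [kf|kf] := leP k (Num.floor t).
  have kf' : k%:~R <= (Num.floor t)%:~R :> R by rewrite ler_int.
  by rewrite ge_min; apply/orP; left; rewrite ger0_norm; lra.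
have kf' : (Num.floor t + 1)%:~R <= k%:~R :> R by rewrite ler_int; lia.
rewrite intrD in kf'; rewrite ge_min; apply/orP; right.
by rewrite ler0_norm; lra.
Qed.

Lemma cdist_ltP t e : cdist t < e -> exists k : int, `|t - k%:~R| < e.
Proof.
rewrite /cdist /fracR.
have := floor_le t; have := floorD1_gt t; rewrite intrD => h1 h2.
rewrite gt_min => /orP[h|h].
  by exists (Num.floor t); rewrite ger0_norm; lra.
by exists (Num.floor t + 1); rewrite intrD ler0_norm; lra.
Qed.

Lemma topen_eopen U : topen U -> eopen U.
Proof.
move=> oU z /oU[e e0 h]; exists e => // w w1 w2; apply: h.
rewrite /tdist gt_max; apply/andP; split.
  by apply: le_lt_trans (cdist_le _ 0) _; rewrite subr0 distrC.
by apply: le_lt_trans (cdist_le _ 0) _; rewrite subr0 distrC.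
Qed.

Lemma topen_shift U z (k m : int) :
  topen U -> U z -> U (z.1 + k%:~R, z.2 + m%:~R).
Proof.
move=> oU /oU[e e0]; apply; rewrite /tdist gt_max /=; apply/andP; split.
  apply: le_lt_trans (cdist_le _ (- k)) _.
  by rewrite mulrNz opprK opprD addrA subrr sub0r addNr normr0.
apply: le_lt_trans (cdist_le _ (- m)) _.
by rewrite mulrNz opprK opprD addrA subrr sub0r addNr normr0.
Qed.

Lemma eopen_topen U : eopen U ->
  (forall z (k m : int), U z -> U (z.1 + k%:~R, z.2 + m%:~R)) -> topen U.
Proof.
move=> oU sU z /oU[e e0 h]; exists e => // w.
rewrite /tdist gt_max => /andP[/cdist_ltP[k hk] /cdist_ltP[m hm]].
have /sU : U (w.1 + k%:~R, w.2 + m%:~R).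
  by apply: h => /=; move: hk hm; rewrite !ltr_norml; lra.
move=> /(_ (- k) (- m)); rewrite /= !mulrNz !addrK; by case: w {hk hm}.
Qed.

(** * Connectedness of segments and intermediate values *)

Lemma segment_dichotomy (a b : R) (P Q : R -> Prop) : a <= b -> P a -> Q b ->
  (forall x, a <= x <= b -> P x \/ Q x) ->
  (forall x, a <= x <= b -> P x -> exists2 e : R, 0 < e &
     forall y, `|y - x| < e -> a <= y <= b -> P y) ->
  (forall x, a <= x <= b -> Q x -> exists2 e : R, 0 < e &
     forall y, `|y - x| < e -> a <= y <= b -> Q y) ->
  exists x, [/\ a <= x <= b, P x & Q x].
Proof.
move=> ab Pa Qb PQ oP oQ.
pose S := [set x | a <= x <= b /\ forall y, a <= y <= x -> P y].
have Sa : S a by split; [rewrite lexx|move=> y ya; have -> : y = a by lra].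
have ubS : has_ubound S by exists b => x [/andP[]].
have supS : has_sup S by split; [exists a|].
have ac : a <= sup S by apply: ub_le_sup.
have cb : sup S <= b by apply: ge_sup; [exists a|move=> x [/andP[]]].
(* [c] is the end of the longest initial segment on which [P] holds. Openness of whichever predicate
   holds at [c] reaches across it. *)
set c := sup S in ac cb *.
have cI : a <= c <= b by rewrite ac.
have below y : a <= y < c -> P y.
  move=> /andP[ay yc].
  have /(sup_adherent) : 0 < c - y by lra.
  move=> /(_ _ supS)[x [_ h]]; rewrite -/c opprB addrC subrK => yx.
  by apply: h; lra.
have [Pc|Qc] := PQ _ cI.
  have [e e0 h] := oP _ cI Pc.
  have [cltb|] := ltP c b; last first.
    by move=> bc; exists b; split; rewrite ?lexx ?ab//; have -> : b = c by lra.
  pose d := Num.min b (c + e / 2).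
  have dc : c < d by rewrite /d lt_min cltb /=; lra.
  have db : d <= b by rewrite /d ge_min lexx.
  have de : d <= c + e / 2 by rewrite /d ge_min lexx orbT.
  have : S d.
    split; first by lra.
    move=> y yd; have [yc|cy] := ltP y c; first by apply: below; lra.
    by apply: h; [rewrite ger0_norm; lra|lra].
  by move=> /(ub_le_sup ubS); rewrite -/c; lra.
have [e e0 h] := oQ _ cI Qc.
have [ec|] := ltP a c; last first.
  by move=> ca; exists a; split; rewrite ?lexx ?ab//; have -> : a = c by lra.
pose d := Num.max a (c - e / 2).
have dc : d < c by rewrite /d gt_max ec /=; lra.
have da : a <= d by rewrite /d le_max lexx.
have de : c - e / 2 <= d by rewrite /d le_max lexx orbT.
exists d; split; [lra|apply: below; lra|].
by apply: h; [rewrite ler0_norm; lra|lra].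
Qed.

Lemma segment_dichotomy_within (a b : R) (P Q : R -> Prop) : P a -> Q b ->
  (forall x, Num.min a b <= x <= Num.max a b -> P x \/ Q x) ->
  (forall x, P x -> exists2 e : R, 0 < e & forall y, `|y - x| < e -> P y) ->
  (forall x, Q x -> exists2 e : R, 0 < e & forall y, `|y - x| < e -> Q y) ->
  exists x, [/\ Num.min a b <= x <= Num.max a b, P x & Q x].
Proof.
move=> Pa Qb; case: (leP a b) => [ab|/ltW ba] PQ oP oQ.
  by apply: segment_dichotomy => // x _ h; [case: (oP x h)|case: (oQ x h)] => e e0 he;
    exists e => // y /he.
have [|||x [xI Qx Px]] := @segment_dichotomy b a Q P ba Qb Pa; last by exists x.
- by move=> x /PQ[]; [right|left].
- by move=> x _ /oQ[e e0 he]; exists e => // y /he.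
- by move=> x _ /oP[e e0 he]; exists e => // y /he.
Qed.

Lemma segment_dichotomy_sym (a b : R) (P Q : R -> Prop) : P a -> Q b ->
  (forall x, P x \/ Q x) ->
  (forall x, P x -> exists2 e : R, 0 < e & forall y, `|y - x| < e -> P y) ->
  (forall x, Q x -> exists2 e : R, 0 < e & forall y, `|y - x| < e -> Q y) ->
  exists x, P x /\ Q x.
Proof.
move=> Pa Qb PQ oP oQ.
have [|x [_ Px Qx]] := segment_dichotomy_within Pa Qb _ oP oQ; last by exists x.
by move=> x _; exact: PQ.
Qed.

Lemma cont1_zero f a b : cont1 f -> a <= b -> f a < 0 -> 0 < f b ->
  exists2 x, a <= x <= b & f x = 0.
Proof.
move=> cf ab fa fb; apply: contrapT => nz.
have [] := @segment_dichotomy a b (fun x => f x < 0) (fun x => 0 < f x) ab fa fb.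
- move=> x xab; case: (ltrgtP (f x) 0) => fx; [by left|by right|].
  by case: nz; exists x.
- move=> x _ fx; have [d d0 h] := cf x (- f x) ltac:(lra).
  by exists d => // y /h + _; rewrite ltr_norml; lra.
- move=> x _ fx; have [d d0 h] := cf x (f x) fx.
  by exists d => // y /h + _; rewrite ltr_norml; lra.
by move=> x [_]; lra.
Qed.

Lemma cont1_zero2 f a b : cont1 f -> f a < 0 -> 0 < f b ->
  exists2 x, Num.min a b <= x <= Num.max a b & f x = 0.
Proof.
move=> cf fa fb; have [ab|ba] := leP a b; first exact: cont1_zero.
have cNf : cont1 (fun x => - f x).
  move=> x e /(cf x)[d d0 h]; exists d => // y /h.
  by rewrite -opprD normrN.
have [||x xab fx] := cont1_zero cNf (ltW ba); rewrite ?oppr_lt0 ?oppr_gt0//.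
by exists x => //; move/eqP: fx; rewrite oppr_eq0 => /eqP.
Qed.

(** Pigeonhole: two of the [N.+2] fractional parts of [i * x], [i <= N.+1], fall into the same of
    [N.+1] bins, and [l] is the difference of their indices. *)
Lemma dirichlet x (N : nat) : exists (l : nat) (m : int),
  (0 < l <= N.+1)%N /\ `|l%:R * x - m%:~R| < (N.+1%:R)^-1.
Proof.
pose fr (i : nat) := i%:R * x - (Num.floor (i%:R * x))%:~R.
have fr0 i : 0 <= fr i by rewrite subr_ge0 floor_le.
have fr1 i : fr i < 1.
  by have := floorD1_gt (i%:R * x); rewrite intrD /fr; lra.
have N0 : 0 < N.+1%:R :> R by rewrite ltr0n.
pose bin i := `|Num.floor (N.+1%:R * fr i)|%N.
have binE i : (bin i)%:R = (Num.floor (N.+1%:R * fr i))%:~R :> R.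
  rewrite -[in RHS](@gez0_abs (Num.floor _)) ?floor_ge0//.
  by apply: mulr_ge0 => //; exact: ltW.
have binN i : (bin i < N.+1)%N.
  rewrite -(ltr_nat R) binE; apply: le_lt_trans (floor_le _) _.
  by rewrite gtr_pMr.
pose f (i : 'I_N.+2) : 'I_N.+1 := Ordinal (binN i).
have : ~~ injectiveb f.
  apply/negP => /injectiveP /leq_card; by rewrite !card_ord ltnn.
move=> /injectivePn [i [j ij fij]].
wlog lij : i j ij fij / (i < j)%N.
  move=> W; case: (ltngtP i j) => [|ji|ije]; first exact: W.
    by apply: (W j i) => //; rewrite eq_sym.
  by move/eqP: ij; case; exact/val_inj.
exists (j - i)%N, (Num.floor (j%:R * x) - Num.floor (i%:R * x)); split.
  by have := ltn_ord j; lia.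
have E : (bin i)%:R = (bin j)%:R :> R.
  by have /(congr1 val)/= -> := fij.
rewrite natrB ?(ltnW lij)// intrB.
have -> : (j%:R - i%:R) * x - ((Num.floor (j%:R * x))%:~R
   - (Num.floor (i%:R * x))%:~R) = fr j - fr i by rewrite /fr; ring.
rewrite -(ltr_pM2l N0) divff ?gt_eqF//.
rewrite -[X in X * _]gtr0_norm // -normrM mulrBr.
have := floor_le (N.+1%:R * fr i); have := floorD1_gt (N.+1%:R * fr i).
have := floor_le (N.+1%:R * fr j); have := floorD1_gt (N.+1%:R * fr j).
rewrite !intrD -!binE E ltr_norml; lra.
Qed.

(** * Irrational rotations *)

Section Rotation.
Variable omega : R.
Hypothesis irr : @irrational R omega.

Lemma rotation_free (n k : int) : n%:~R * omega + k%:~R = 0 -> n = 0.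
Proof.
move=> h; apply/eqP/negPn/negP => n0; apply: irr.
apply/rationalP; exists (- (Num.sg n) * k), `|n|%N.
have n0' : n%:~R != 0 :> R by rewrite intr_eq0.
have e : omega = - k%:~R / n%:~R.
  by apply: (mulIf n0'); rewrite mulfVK// mulrC; lra.
have -> : `|n|%N%:R = (Num.sg n)%:~R * n%:~R :> R.
  by rewrite -intrM -normrEsg -abszE.
have s0 : (Num.sg n)%:~R != 0 :> R by rewrite intr_eq0 sgr_eq0.
by rewrite e intrM mulrNz; field; rewrite s0 n0'.
Qed.

Lemma rotation_small e : 0 < e -> exists n k : int,
  0 < n /\ 0 < `|n%:~R * omega + k%:~R| < e.
Proof.
move=> e0.
have [N _ hN] : exists2 N : nat, True & (N.+1%:R)^-1 < e.
  exists (Num.truncn e^-1) => //.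
  rewrite invf_plt ?posrE// ?ltr0n//; exact: truncnS_gt.
have [l [m [/andP[l0 _] hl]]] := dirichlet omega N.
exists l%:Z, (- m); split; first by lia.
have -> : l%:Z%:~R * omega + (- m)%:~R = l%:R * omega - m%:~R.
  by rewrite mulrNz pmulrn.
rewrite normr_gt0 (lt_trans hl) // andbT; apply/eqP => h.
have : l%:Z = 0 by apply: (@rotation_free l%:Z (- m)); rewrite mulrNz -pmulrn.
lia.
Qed.

Lemma rotation_dense t e : 0 < e -> exists n k : int,
  `|n%:~R * omega + k%:~R - t| < e.
Proof.
move=> /rotation_small[n [k [_ /andP[s0 se]]]].
set s := n%:~R * omega + k%:~R in s0 se.
have s0' : s != 0 by rewrite -normr_gt0.
pose l := Num.floor (t / s).
exists (l * n), (l * k); rewrite !intrM.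
have -> : l%:~R * n%:~R * omega + l%:~R * k%:~R - t = - ((t / s - l%:~R) * s).
  by rewrite mulrBl divfK// opprB /s; ring.
rewrite normrN normrM; apply: le_lt_trans se; rewrite ger_pMl//.
have := floor_le (t / s); have := floorD1_gt (t / s).
by rewrite intrD -/l => h1 h2; rewrite ger0_norm; lra.
Qed.

End Rotation.
End Basics.

(* Elements (n, k, m) of Z^3 act on the universal cover by the n-th iterate of
   the lifted skew product followed by the deck translation (k, m). *)
Notation Z3 := (int * int * int)%type.

Section Zaction.
Variable R : realType.
Implicit Types (omega t x y : R) (h g : Z3) (z w : R * R).

Definition bshift omega h : R := h.1.1%:~R * omega + h.1.2%:~R.

Lemma bshiftE omega h : bshift omega h = h.1.1%:~R * omega + h.1.2%:~R.
Proof. by []. Qed.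

(** [A h t x] is the second coordinate of the image of [(t, x)]; the first is [t + bshift omega h].
    Tubes, the order of translates and invariant graphs are treated from these axioms; smoothness
    serves to construct the action and to bound the distortion. *)
Record zaction omega (A : Z3 -> R -> R -> R) : Prop := Zaction {
  zact0 : forall t x, A 0 t x = x;
  zactD : forall h g t x, A (h + g) t x = A h (t + bshift omega g) (A g t x);
  zact_incr : forall h t x y, x < y -> A h t x < A h t y;
  zact_deck : forall (k m : int) t x, A (0, k, m) t x = x + m%:~R;
  zact_cont : forall h t x e, 0 < e -> exists2 d : R, 0 < d &
    forall t' x', `|t' - t| < d -> `|x' - x| < d ->
      `|A h t' x' - A h t x| < e }.

Variables (omega : R) (A : Z3 -> R -> R -> R).
Hypothesis zA : zaction omega A.

Definition act h z : R * R := (z.1 + bshift omega h, A h z.1 z.2).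

Lemma bshiftD h g : bshift omega (h + g) = bshift omega h + bshift omega g.
Proof. by rewrite /bshift /= !intrD; ring. Qed.

Lemma bshiftN h : bshift omega (- h) = - bshift omega h.
Proof. by rewrite /bshift /= !mulrNz; ring. Qed.

Lemma bshift0 : bshift omega 0 = 0.
Proof. by rewrite /bshift /= mul0r addr0. Qed.

Lemma act0 z : act 0 z = z.
Proof. by case: z => t x; rewrite /act (zact0 zA) bshift0 addr0. Qed.

Lemma actD h g z : act (h + g) z = act h (act g z).
Proof. by rewrite /act (zactD zA) bshiftD /= (addrC (bshift omega h)) addrA. Qed.

Lemma actK h z : act (- h) (act h z) = z.
Proof. by rewrite -actD addNr act0. Qed.

Lemma actNK h z : act h (act (- h) z) = z.
Proof. by rewrite -actD subrr act0. Qed.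

Lemma zact_le h t : {mono A h t : x y / x <= y}.
Proof.
have mono : {homo A h t : x y / x < y} by move=> x y; exact: (zact_incr zA).
exact: (le_mono mono).
Qed.

Lemma zact_lt h t : {mono A h t : x y / x < y}.
Proof. exact: leW_mono (zact_le h t). Qed.

Lemma act_deck (k m : int) z : act (0, k, m) z = (z.1 + k%:~R, z.2 + m%:~R).
Proof. by rewrite /act (zact_deck zA) /bshift /= mul0r add0r. Qed.

(** Z^3 is commutative, so [h] commutes with vertical deck translations. *)
Lemma zact_vertical h (m : int) t x : A h t (x + m%:~R) = A h t x + m%:~R.
Proof.
have : act (h + (0, 0, m)) (t, x) = act ((0, 0, m) + h) (t, x) by rewrite addrC.
by rewrite !actD !act_deck /= addr0 => -[].
Qed.

Lemma act_cont h z e : 0 < e -> exists2 d : R, 0 < d &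
  forall w, `|w.1 - z.1| < d -> `|w.2 - z.2| < d ->
    `|(act h w).1 - (act h z).1| < e /\ `|(act h w).2 - (act h z).2| < e.
Proof.
move=> e0; have [d d0 hd] := zact_cont zA h z.1 z.2 e0.
exists (Num.min d e); first by rewrite lt_min d0.
move=> w; rewrite !lt_min => /andP[w1 w1'] /andP[w2 w2'] /=; split.
  by rewrite opprD addrACA subrr addr0.
exact: hd.
Qed.

Lemma act_eopen h (U : set (R * R)) : eopen U -> eopen (fun z => U (act h z)).
Proof.
move=> oU z /oU[e e0 he]; have [d d0 hd] := act_cont h z e0.
by exists d => // w w1 w2; have [? ?] := hd w w1 w2; apply: he.
Qed.

End Zaction.

Global Opaque bshift.

(** * Invariant tubes from bounded orbits *)

Section Tube.
Variables (R : realType) (omega : R) (A : Z3 -> R -> R -> R).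
Variable T : R * R -> R * R.
Hypothesis irr : @irrational R omega.
Hypothesis zA : zaction omega A.
Hypothesis iterT : forall p z, iter p T z = act omega A (p%:Z, 0, 0) z.

Variables (S : set (R * R)) (a b D : int).

(** The integer functional whose kernel will stabilise the strip that covers the tube. *)
Definition psi (h : Z3) : int := a * h.1.1 + b * h.1.2 + D * h.2.

Hypothesis D0 : 0 < D.
Hypothesis oS : eopen S.
Hypothesis S0 : S !=set0.
Hypothesis upS : forall t x y, S (t, x) -> x <= y -> S (t, y).
Hypothesis lbS : forall t0, exists (r B : R), 0 < r /\ forall h z, 0 <= psi h ->
  S z -> `|(act omega A h z).1 - t0| < r -> B <= (act omega A h z).2.

Local Notation act := (act omega A).

Lemma psiD h g : psi (h + g) = psi h + psi g.
Proof. by rewrite /psi /=; ring. Qed.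

Lemma psiN h : psi (- h) = - psi h.
Proof. by rewrite /psi /=; ring. Qed.

Lemma psi0 : psi 0 = 0.
Proof. by have := psiD 0 0; rewrite addr0; lia. Qed.

Lemma psi_deck m : psi (0, 0, m) = D * m.
Proof. by rewrite /psi /= !mulr0 !add0r. Qed.

(** The union of the images of [S] under all [h] of level at least [i]. These open sets are closed
    upwards and decrease with [i]. *)
Let O (i : int) : set (R * R) := [set z | exists2 h, i <= psi h & S (act (- h) z)].

Let O_open i : eopen (O i).
Proof.
move=> z [h ih] Sz.
have [e e0 he] := act_eopen zA (h := - h) oS Sz.
by exists e => // w w1 w2; exists h => //; exact: he.
Qed.

Let O_up i t x y : O i (t, x) -> x <= y -> O i (t, y).
Proof.
move=> [h ih Sz] xy; exists h => //; apply: upS Sz _.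
by rewrite /= (zact_le zA).
Qed.

Let O_mono i j z : i <= j -> O j z -> O i z.
Proof. by move=> ij [h jh Sz]; exists h => //; exact: le_trans jh. Qed.

Let O_act i h z : O i z -> O (i + psi h) (act h z).
Proof.
move=> [g ig Sz]; exists (h + g); first by rewrite psiD addrC lerD2l.
by rewrite opprD addrC (actD zA) (actK zA).
Qed.

(** The strip between consecutive levels: [O i] minus the closure of [O (i + 1)]. *)
Let P (i : int) : set (R * R) := [set z | O i z /\ exists2 e : R, 0 < e &
  forall w, `|w.1 - z.1| < e -> `|w.2 - z.2| < e -> ~ O (i + 1) w].

Let P_open i : eopen (P i).
Proof.
move=> z [/O_open[e e0 he] [d d0 hd]].
exists (Num.min e (d / 2)); first by rewrite lt_min e0; lra.
move=> w; rewrite !lt_min => /andP[w1 w1'] /andP[w2 w2']; split; first exact: he.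
exists (d / 2); first by lra.
move=> v v1 v2; apply: hd.
  by move: v1 w1'; rewrite !ltr_norml; lra.
by move: v2 w2'; rewrite !ltr_norml; lra.
Qed.

Let P_act i h z : psi h = 0 -> P i z -> P i (act h z).
Proof.
move=> h0 [Oz [e e0 he]]; split.
  by have := O_act h Oz; rewrite h0 addr0.
have [d d0 hd] := act_cont zA (- h) (act h z) e0.
exists d => // w w1 w2 /(O_act (- h)); rewrite psiN h0 oppr0 addr0.
by have [] := hd _ w1 w2; rewrite (actK zA); exact: he.
Qed.

(** If all strips were empty, each level would lie in the closure of the next, so points of
    arbitrarily high level would accumulate at a point of [S]. Translated down, they contradict
    [lbS]. *)
Let exP : exists i z, P i z.
Proof.
apply: contrapT => noP.
have [z0 Sz0] := S0.
have cl (j : nat) : forall e : R, 0 < e -> exists w,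
    [/\ `|w.1 - z0.1| < e, `|w.2 - z0.2| < e & O j w].
  elim: j => [|j IH] e e0.
    exists z0; rewrite !subrr normr0; split=> //.
    by exists 0; rewrite ?oppr0 ?(act0 zA)// psi0.
  have e2 : 0 < e / 2 by lra.
  have [w [w1 w2 Ow]] := IH _ e2.
  have : ~ P j w by move=> Pw; apply: noP; exists j%:Z, w.
  move=> nPw.
  have [v [v1 v2 Ov]] : exists v,
     [/\ `|v.1 - w.1| < e / 2, `|v.2 - w.2| < e / 2 & O (j%:Z + 1) v].
    apply: contrapT => nv; apply: nPw; split=> //; exists (e / 2) => // v v1 v2 Ov.
    by apply: nv; exists v.
  exists v; split.
  - by move: v1 w1; rewrite !ltr_norml; lra.
  - by move: v2 w2; rewrite !ltr_norml; lra.
  - by have -> : j.+1%:Z = j%:Z + 1 by lia.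
have [r [B [r0 hB]]] := lbS z0.1.
pose j := Num.truncn (`|z0.2 + 1 - B|).
have hj : z0.2 + 1 - B < j.+1%:R.
  by apply: le_lt_trans (ler_norm _) _; exact: truncnS_gt.
have m0 : 0 < Num.min r 1 by rewrite lt_min r0 ltr01.
(* A unit translation downwards costs [D] in [psi], so a point of level [D * j.+1] can be lowered by
   [j.+1] and keep a nonnegative level. *)
have [w []] := cl (`|D| * j.+1)%N _ m0.
rewrite !lt_min => /andP[w1 _] /andP[_ w2] [h hpsi Sw].
have e : act (h - (0, 0, j.+1%:Z)) (act (- h) w) = (w.1, w.2 - j.+1%:R).
  rewrite addrC (actD zA) (actNK zA) -[- _]/(- 0, - 0, - j.+1%:Z) act_deck //=.
  by rewrite oppr0 addr0 mulrNz.
have := hB (h - (0, 0, j.+1%:Z)) _ _ Sw; rewrite e /= => /(_ _ w1).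
have D' : (`|D| * j.+1)%N%:Z = D * j.+1%:Z by rewrite PoszM gtz0_abs.
rewrite psiD psiN psi_deck -D' subr_ge0 => /(_ hpsi).
move: w2 hj; rewrite ltr_norml; lra.
Qed.

(** An element with [1 <= psi h] maps [P i] into [O (i + 1)], which [P i] avoids. This is applied to
    [h] and [- h]. *)
Let disjP i h z : P i z -> P i (act h z) -> psi h = 0.
Proof.
have main g w : P i w -> P i (act g w) -> psi g < 1.
  move=> [Ow _] [_ [e e0 he]]; rewrite ltNge; apply/negP => g1.
  apply: (he (act g w)); rewrite ?subrr ?normr0//.
  by apply: O_mono (O_act g Ow); rewrite lerD2l.
move=> Pz Phz; have h1 := main _ _ Pz Phz.
have := main (- h) (act h z) Phz; rewrite (actK zA) psiN => /(_ Pz); lia.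
Qed.

Let convP i t x y z : P i (t, x) -> P i (t, z) -> x <= y <= z -> P i (t, y).
Proof.
move=> [Ox _] [_ [e e0 he]] /andP[xy yz]; split; first exact: O_up Ox xy.
exists e => // -[w1 w2] /= h1 h2 Ow.
apply: (he (w1, w2 + (z - y))) => //=.
  by move: h2; rewrite !ltr_norml; lra.
by apply: O_up Ow _; lra.
Qed.

Let diamP i t x y : P i (t, x) -> P i (t, y) -> y < x + 1.
Proof.
move=> [Ox _] [_ [e e0 he]]; rewrite ltNge; apply/negP => xy.
apply: (he (t, y)); rewrite ?subrr ?normr0//.
apply: O_up xy.
have := O_act (0, 0, 1) Ox; rewrite act_deck //= addr0.
by apply: O_mono; rewrite lerD2l /psi /= !mulr0 !add0r mulr1; lia.
Qed.

(** The kernel of [psi] contains elements with base shift [D * (n * omega + k)] for all [n] and [k].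
    These shifts are dense, and the open strip is invariant under the kernel. *)
Let fullP i : P i !=set0 -> forall t, exists x, P i (t, x).
Proof.
move=> [z0 Pz0] t; have [e e0 he] := P_open Pz0.
have Dr : 0 < D%:~R :> R by rewrite ltr0z.
have [n [k hnk]] := rotation_dense irr ((t - z0.1) / D%:~R) (divr_gt0 e0 Dr).
pose h : Z3 := (D * n, D * k, - (a * n + b * k)).
have h0 : psi h = 0 by rewrite /psi /=; ring.
have sh : bshift omega h = D%:~R * (n%:~R * omega + k%:~R).
  by rewrite bshiftE /= !intrM; ring.
have : P i (t - bshift omega h, z0.2).
  apply: he => /=; last by rewrite subrr normr0.
  rewrite sh -normrN.
  have -> : - (t - D%:~R * (n%:~R * omega + k%:~R) - z0.1) =
    D%:~R * (n%:~R * omega + k%:~R - (t - z0.1) / D%:~R).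
    by field; rewrite gt_eqF.
  by rewrite normrM gtr0_norm// mulrC -ltr_pdivlMr.
move=> /(P_act h0); rewrite [act _ _]surjective_pairing /= subrK.
by move=> ?; eexists; eassumption.
Qed.

(** [U1] is the union of the deck translates of one strip. Elements outside the kernel displace the
    strip from itself. Hence the least positive [n] occurring in the kernel is the number [p] of
    tubes, and the least positive [k] with some [(0, k, m)] in the kernel is the number [q] of arcs
    per fibre. *)
Lemma tube_of_bounded : exists (p q : nat) (U1 : set (R * R)),
  [/\ (0 < p)%N, (0 < q)%N & tube T p q U1].
Proof.
have [i exPi] := exP.
have full := fullP exPi.
have gapb t : exists lh : R * R, lh.1 < lh.2 <= lh.1 + 1 /\
    forall x, P i (t, x) <-> lh.1 < x < lh.2.
  pose E := [set x | P i (t, x)].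
  have E0 : E !=set0 by have [x Px] := full t; exists x.
  have ubE : has_ubound E.
    by have [x Px] := E0; exists (x + 1) => y Py; apply/ltW/(diamP Px).
  have lbE : has_lbound E.
    exists (sup E - 1) => x Px.
    rewrite lerBlDr; apply: ge_sup => // y Py.
    by apply/ltW/(diamP Px).
  have op x : E x -> inf E < x < sup E.
    move=> Px; have [e e0 he] := P_open Px.
    have Em : E (x - e / 2).
      by apply: he => /=; rewrite ?subrr ?normr0// ler0_norm; lra.
    have Ep : E (x + e / 2).
      by apply: he => /=; rewrite ?subrr ?normr0// ger0_norm; lra.
    have := ge_inf lbE Em; have := ub_le_sup ubE Ep; lra.
  exists (inf E, sup E) => /=; split.
    have [x Ex] := E0; have := op _ Ex => xE; apply/andP; split; first by lra.
    apply: ge_sup => // y Ey; rewrite -lerBlDr; apply: lb_le_inf => // z Ez.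
    by rewrite lerBlDr; apply/ltW/(diamP Ez).
  move=> x; split; first exact: op.
  move=> /andP[ix xs].
  have [y Ey yx] := inf_lt E0 ix.
  have [z Ez xz] := sup_gt E0 xs.
  by apply: convP Ey Ez _; rewrite !ltW.
have [lh lhP] := choice gapb.
have expp : exists n : nat, (0 < n)%N && `[< exists k m : int, psi (n%:Z, k, m) = 0 >].
  exists `|D|%N; apply/andP; split; first by lia.
  by apply/asboolP; exists 0, (- a); rewrite /psi /= gtz0_abs//; ring.
have exqq : exists k : nat, (0 < k)%N && `[< exists m : int, psi (0, k%:Z, m) = 0 >].
  exists `|D|%N; apply/andP; split; first by lia.
  by apply/asboolP; exists (- b); rewrite /psi /= gtz0_abs//; ring.
case: (ex_minnP expp) => p /andP[p0 /asboolP[k1 [m1 pker]]] pmin.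
case: (ex_minnP exqq) => q /andP[q0 /asboolP[mq qker]] qmin.
pose U1 := [set z : R * R | exists k m : int, P i (act (0, k, m) z)].
have oU1 : topen U1.
  apply: eopen_topen.
    move=> z [k [m Pz]]; have [e e0 he] := act_eopen zA (h := (0, k, m)) (@P_open i) Pz.
    by exists e => // w w1 w2; exists k, m; exact: he.
  move=> z k m [k' [m' Pz]]; exists (k' - k), (m' - m).
  rewrite -(act_deck zA) -(actD zA).
  by rewrite [_ + _ : Z3](_ : _ = (0, k', m'))//; congr (_, _, _); rewrite ?subrK.
exists p, q, U1; split=> //; split; last first.
  have main (i' j' : nat) u v : (j' < p)%N -> (i' < j')%N -> U1 u -> U1 v ->
      iter i' T u = iter j' T v -> False.
    move=> jp ij [k [m Pu]] [k' [m' Pv]]; rewrite !iterT => e.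
    have eu : u = act (- (i'%:Z, 0, 0)) (act (j'%:Z, 0, 0) v).
      by rewrite -e (actK zA).
    have eu' : act (0, k, m) u =
        act ((0, k, m) - (i'%:Z, 0, 0) + (j'%:Z, 0, 0) - (0, k', m')) (act (0, k', m') v).
      by rewrite -(actD zA) subrK !(actD zA) -eu.
    move: Pu; rewrite eu' => /(disjP Pv) ker.
    have : (p <= j' - i')%N.
      apply: pmin; apply/andP; split; first by lia.
      apply/asboolP; exists (k - k'), (m - m'); rewrite -ker /psi /=.
      by rewrite (_ : (j' - i')%N%:Z = j'%:Z - i'%:Z); [ring|lia].
    by lia.
  move=> i' j' ip jp ij; apply/seteqP; split=> // w [[u Uu eu] [v Uv ev]].
  case: (ltngtP i' j') => h; last by [].
  - by apply: (main i' j' u v) => //; rewrite eu.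
  - by apply: (main j' i' v u) => //; rewrite eu.
split=> //.
- move=> z; rewrite iterT; split=> -[k [m Pz]].
    exists (k + k1), (m + m1).
    have := P_act pker Pz; rewrite -!(actD zA).
    by congr (P i (act (_, _, _) _)) => /=; ring.
  exists (k - k1), (m - m1).
  have kN : psi (- (p%:Z, k1, m1)) = 0 by rewrite psiN pker oppr0.
  have := P_act kN Pz; rewrite -!(actD zA).
  by congr (P i (act (_, _, _) _)) => /=; ring.
(* Sets open in the torus are saturated, so a separation of [U1] gives one of the strip. The strip
   has interval fibres over the whole line: connectedness of the base yields a fibre meeting both
   sets, and connectedness of that fibre a common point. *)
- move=> U V oU oV sub dis; apply: contrapT => /not_orP[].
  move=> /eqP/set0P[u [Uu uU]] /eqP/set0P[v [Uv vV]].
  have fib t x : P i (t, x) -> U (t, x) \/ V (t, x).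
    by move=> Px; apply: sub; exists 0, 0; rewrite (act0 zA).
  have PU1 z : P i z -> U1 z by move=> Pz; exists 0, 0; rewrite (act0 zA).
  have norm W w : topen W -> U1 w -> W w -> exists w', P i w' /\ W w'.
    move=> oW [k [m Pw]] Ww; exists (act (0, k, m) w); split=> //.
    by rewrite (act_deck zA); exact: topen_shift.
  have [u' [Pu' Uu']] := norm U u oU Uu uU.
  have [v' [Pv' Vv']] := norm V v oV Uv vV.
  have opn W t x : topen W -> P i (t, x) -> W (t, x) -> exists2 e : R, 0 < e &
      forall t' x', `|t' - t| < e -> `|x' - x| < e -> P i (t', x') /\ W (t', x').
    move=> oW Px Wx; have [e e0 he] := P_open Px.
    have [d d0 hd] := topen_eopen oW Wx.
    exists (Num.min e d); first by rewrite lt_min e0.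
    move=> t' x'; rewrite !lt_min => /andP[? ?] /andP[? ?].
    by split; [exact: he|exact: hd].
  have [|||||t [[x Px Ux] [y Py Vy]]] := @segment_dichotomy_sym R u'.1 v'.1
      (fun t => exists2 x, P i (t, x) & U (t, x))
      (fun t => exists2 x, P i (t, x) & V (t, x)).
  - by exists u'.2; case: u' Pu' Uu'.
  - by exists v'.2; case: v' Pv' Vv'.
  - by move=> t; have [x Px] := full t; case: (fib _ _ Px); [left|right]; exists x.
  - move=> t [x Px Ux]; have [e e0 he] := opn U t x oU Px Ux; exists e => // s st.
    by have [] := he s x st; rewrite ?subrr ?normr0//; exists x.
  - move=> t [x Px Ux]; have [e e0 he] := opn V t x oV Px Ux; exists e => // s st.
    by have [] := he s x st; rewrite ?subrr ?normr0//; exists x.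
  have seg r : Num.min x y <= r <= Num.max x y -> P i (t, r).
    case: (leP x y) => xy rI; first exact: convP Px Py rI.
    exact: convP Py Px rI.
  have [|||r [rI Ur Vr]] := @segment_dichotomy_within R x y
      (fun r => U (t, r)) (fun r => V (t, r)) Ux Vy.
  - by move=> r /seg /fib.
  - move=> r Ur; have [e e0 he] := topen_eopen oU Ur; exists e => // s st.
    by apply: he => //=; rewrite subrr normr0.
  - move=> r Ur; have [e e0 he] := topen_eopen oV Ur; exists e => // s st.
    by apply: he => //=; rewrite subrr normr0.
  have : (U1 `&` U `&` V) (t, r) by split; [split|] => //; apply/PU1/seg.
  by rewrite dis.
(* The arcs over [t] are the fibres of the strip over [t], [t + 1], up to [t + q - 1]; other deck
   shifts reduce to these modulo the kernel element [(0, q, mq)]. *)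
- move=> t; exists (fun i => (lh (t + i%:R)).1), (fun i => (lh (t + i%:R)).2); split.
  + by move=> j _; have [] := lhP (t + j%:R).
  + move=> i' j' iq jq ij k x [hi hj].
    have Pi : P i (t + i'%:R, x) by apply/(lhP (t + i'%:R)).2.
    have Pj : P i (t + j'%:R, x - k%:~R) by apply/(lhP (t + j'%:R)).2; lra.
    have main (i1 j1 : nat) y y' (l : int) : (i1 < j1)%N -> (j1 < q)%N ->
       P i (t + i1%:R, y) -> P i (t + j1%:R, y') -> y' = y + l%:~R -> False.
      move=> ij1 jq1 P1 P2 e.
      have := @disjP i (0, (j1 - i1)%N%:Z, l) _ P1; rewrite act_deck //=.
      rewrite -e -addrA -pmulrn -natrD subnKC ?(ltnW ij1)// => /(_ P2) ker.
      have : (q <= j1 - i1)%N.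
        by apply: qmin; apply/andP; split; [lia|apply/asboolP; exists l].
      by lia.
    case: (ltngtP i' j') => h; last by [].
      by apply: (main _ _ _ _ (- k) h jq Pi Pj); rewrite mulrNz.
    by apply: (main _ _ _ _ k h iq Pj Pi); rewrite subrK.
  + move=> x; split.
      move=> [k [m]]; rewrite act_deck //= => Pz.
      pose l := (k %/ q%:Z)%Z; pose j := `|(k %% q%:Z)%Z|%N.
      have jE : j%:Z = (k %% q%:Z)%Z by rewrite /j gez0_abs// modz_ge0//; lia.
      have jq : (j < q)%N.
        have := ltz_pmod k (d := q%:Z) ltac:(lia); rewrite -jE; lia.
      exists j; split => //; exists (l * mq - m).
      have ker : psi (0, - (l * q%:Z), - (l * mq)) = 0.
        transitivity (- l * psi (0, q%:Z, mq)); last by rewrite qker mulr0.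
        by rewrite /psi /=; ring.
      have := P_act ker Pz; rewrite act_deck //= -!addrA -!intrD.
      have -> : k - l * q = j%:Z by have := divz_eq k q%:Z; rewrite -/l -jE; lia.
      rewrite -pmulrn => /(lhP (t + j%:R)).2; rewrite !intrD !mulrNz; lra.
    move=> [j [jq [k hx]]]; exists j%:Z, (- k); rewrite act_deck //= -pmulrn.
    by apply/(lhP (t + j%:R)).2; rewrite mulrNz; lra.
Qed.

End Tube.

(** * The order on the translates of a wandering box *)

Section State.
Variables (R : realType) (C : Z3 -> Prop).
Hypothesis C0 : C 0.
Hypothesis CD : forall g h, C g -> C h -> C (g + h).
Hypothesis Cdeck : forall m : int, C (0, 0, m) -> 0 <= m.
Hypothesis Cunit : forall h, exists m : int, C (h + (0, 0, m)).

Let CM (l : nat) n k m : C (n, k, m) -> C (l%:Z * n, l%:Z * k, l%:Z * m).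
Proof.
move=> Ch; elim: l => [|l IH]; first by rewrite !mul0r.
by rewrite intS !mulrDl !mul1r; exact: (CD Ch IH).
Qed.

Let CMz (l n k m : int) : 0 <= l -> C (n, k, m) -> C (l * n, l * k, l * m).
Proof. by case: l => // l _; exact: CM. Qed.

(** One step of a Hahn-Banach extension, with [c] the value on the new coordinate [L]. Elements with
    [0 < L] bound [c] from below, those with [L < 0] from above. The bounds are compatible by the
    third hypothesis, which concerns positive combinations on which [L] vanishes. *)
Let extension (L : Z3 -> int) (v : Z3 -> R) (Q : Z3 -> Prop) :
  (exists2 h, Q h & 0 < L h) -> (exists2 h, Q h & L h < 0) ->
  (forall g h, Q g -> Q h -> 0 < L g -> L h < 0 ->
     0 <= (- L h)%:~R * v g + (L g)%:~R * v h) ->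
  (forall h, Q h -> L h = 0 -> 0 <= v h) ->
  exists c : R, forall h, Q h -> 0 <= (L h)%:~R * c + v h.
Proof.
move=> [p Qp Lp] [q Qq Lq] key zero.
pose E : set R := [set c | exists h, [/\ Q h, 0 < L h & c = - v h / (L h)%:~R]].
have ub h : Q h -> L h < 0 -> ubound E (v h / (- L h)%:~R).
  move=> Qh Lh _ [g [Qg Lg ->]]; have := key _ _ Qg Qh Lg Lh.
  have Lh' : 0 < (- L h)%:~R :> R by rewrite ltr0z; lia.
  have Lg' : 0 < (L g)%:~R :> R by rewrite ltr0z.
  by rewrite ler_pdivrMr// mulrAC ler_pdivlMr//; lra.
have E0 : E !=set0 by exists (- v p / (L p)%:~R), p.
have hub : has_ubound E by eexists; exact: ub Qq Lq.
exists (sup E) => h Qh; case: (ltrgtP (L h) 0) => Lh.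
- have := ge_sup E0 (ub _ Qh Lh).
  have Lh' : 0 < (- L h)%:~R :> R by rewrite ltr0z; lia.
  by rewrite ler_pdivlMr// mulrNz; lra.
- have Lh' : 0 < (L h)%:~R :> R by rewrite ltr0z.
  have : E (- v h / (L h)%:~R) by exists h.
  by move=> /(ub_le_sup hub); rewrite ler_pdivrMr//; lra.
- by rewrite Lh mul0r add0r; exact: zero.
Qed.

(** The functional is extended from the vertical axis to the plane [k = 0], then to Z^3. [Cunit]
    provides elements of the cone on both sides of the subspace already treated. *)
Lemma cone_functional : exists rho kappa : R, forall h,
  C h -> 0 <= h.1.1%:~R * rho + h.1.2%:~R * kappa + h.2%:~R.
Proof.
have cunit n k : exists m, C (n, k, m).
  by have [m Cm] := Cunit (n, k, 0); exists (0 + m); move: Cm;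
     rewrite -[_ + _]/(n + 0, k + 0, 0 + m) !addr0.
have [rho rhoP] : exists rho : R, forall h, (C h /\ h.1.2 = 0) ->
    0 <= h.1.1%:~R * rho + h.2%:~R.
  apply: (@extension (fun h => h.1.1) (fun h => h.2%:~R)).
  - by have [m Cm] := cunit 1 0; exists (1, 0, m).
  - by have [m Cm] := cunit (-1) 0; exists (-1, 0, m).
  - move=> [[n k] m] [[n' k'] m'] /= [Cg k0] [Ch k0'] n0 n0'; subst k k'.
    have := CD (CMz (l := - n') ltac:(lia) Cg) (CMz (l := n) ltac:(lia) Ch).
    rewrite -[X in C X]/(- n' * n + n * n', - n' * 0 + n * 0, - n' * m + n * m').
    rewrite !mulr0 addr0 (_ : - n' * n + n * n' = 0); last by ring.
    by move=> /Cdeck; rewrite -!intrM -intrD ler0z.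
  - move=> [[n k] m] /= [Ch k0] n0; move: Ch; rewrite n0 k0 => /Cdeck.
    by rewrite ler0z.
have [kappa kappaP] : exists kappa : R, forall h, C h ->
    0 <= h.1.2%:~R * kappa + (h.1.1%:~R * rho + h.2%:~R).
  apply: (@extension (fun h => h.1.2) (fun h => h.1.1%:~R * rho + h.2%:~R)).
  - by have [m Cm] := cunit 0 1; exists (0, 1, m).
  - by have [m Cm] := cunit 0 (-1); exists (0, -1, m).
  - move=> [[n k] m] [[n' k'] m'] /= Cg Ch k0 k0'.
    have := CD (CMz (l := - k') ltac:(lia) Cg) (CMz (l := k) ltac:(lia) Ch).
    rewrite -[X in C X]/(- k' * n + k * n', - k' * k + k * k', - k' * m + k * m').
    move=> Cs; have := rhoP _ (conj Cs _); rewrite /= => /(_ ltac:(ring)).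
    by rewrite !intrD !intrM; lra.
  - by move=> h Ch k0; apply: rhoP.
by exists rho, kappa => h /kappaP; lra.
Qed.

End State.

(** * Elements that move a wandering box up or down *)

Section LocalOrder.
Variables (R : realType) (omega : R) (A : Z3 -> R -> R -> R).
Hypothesis irr : @irrational R omega.
Hypothesis zA : zaction omega A.
Variables (a0 r x0 w : R).
Hypotheses (r0 : 0 < r) (r4 : 4 * r <= 1) (w0 : 0 < w).
Hypothesis wandering : forall (h : Z3) t x, h.1.1 != 0 ->
  `|t - a0| < r -> `|x - x0| < w -> `|t + bshift omega h - a0| < r ->
  `|A h t x - x0| < w -> False.

Implicit Types g h u : Z3.

(** The base arc, of radius [r], meets its translate by [h], so there is a common arc over which the
    box and its image can be compared. *)
Definition is_local h := `|bshift omega h| < 2 * r.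

Definition moves_up h := is_local h /\ forall t, `|t - a0| < r ->
  `|t + bshift omega h - a0| < r -> x0 < A h t x0.

Definition moves_down h := is_local h /\ forall t, `|t - a0| < r ->
  `|t + bshift omega h - a0| < r -> A h t x0 < x0.

Lemma local_vertical h : is_local h -> h.1.1 = 0 -> h = (0, 0, h.2).
Proof.
rewrite /is_local bshiftE; case: h => [[n k] m] /= kr n0; move: kr; rewrite n0 mul0r add0r => kr.
have : `|k%:~R| < 1%:~R :> R by apply: lt_le_trans kr _; rewrite mulr1z; have := r4; lra.
by rewrite -intr_norm ltr_int => k1; have -> : k = 0 by lia.
Qed.

Lemma local_mid h : is_local h ->
  `|a0 - bshift omega h / 2 - a0| < r /\ 
  `|a0 - bshift omega h / 2 + bshift omega h - a0| < r.
Proof. by rewrite /is_local !ltr_norml; lra. Qed.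

Lemma zact_cont1 h x : cont1 (fun t => A h t x).
Proof.
move=> t e e0; have [d d0 hd] := zact_cont zA h t x e0.
by exists d => // y yt; apply: hd => //; rewrite subrr normr0.
Qed.

(** If [h] is not a deck translation, the image of the centre line cannot meet the centre line over
    the common arc, as this would be a return of the box. The arc is connected, so the order is
    constant on it. *)
Lemma local_trichotomy h : is_local h -> [\/ h = 0, moves_up h | moves_down h].
Proof.
move=> lh; have [h0|h0] := eqVneq h.1.1 0.
  have hE := local_vertical lh h0.
  case: (ltrgtP h.2 0) => hm.
  - apply: Or33; split=> // t _ _; rewrite hE (zact_deck zA) /=.
    have : h.2%:~R < 0 :> R by rewrite ltrz0. lra.
  - apply: Or32; split=> // t _ _; rewrite hE (zact_deck zA) /=.
    have : 0 < h.2%:~R :> R by rewrite ltr0z. lra.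
  - by apply: Or31; rewrite hE hm.
pose f t := A h t x0 - x0.
have cf : cont1 f.
  move=> t e e0; have [d d0 hd] := zact_cont1 h x0 t e0.
  by exists d => // y /hd; rewrite /f opprB addrA subrK.
have nz t : `|t - a0| < r -> `|t + bshift omega h - a0| < r -> f t <> 0.
  move=> t1 t2 ft; have := @wandering h t x0 h0 t1; rewrite subrr normr0 -/(f t) ft normr0.
  by move=> /(_ w0 t2 w0).
have [m1 m2] := local_mid lh; set t0 := a0 - _ in m1 m2.
have same t t' : `|t - a0| < r -> `|t + bshift omega h - a0| < r ->
    `|t' - a0| < r -> `|t' + bshift omega h - a0| < r -> f t < 0 -> 0 < f t' -> False.
  move=> t1 t2 t3 t4 ft ft'; have [c cI fc] := cont1_zero2 cf ft ft'.
  apply: (nz c) => //; move: cI t1 t2 t3 t4; case: (leP t t') => _;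
    rewrite !ltr_norml; lra.
case: (ltrgtP (f t0) 0) => ft0; last by have := nz _ m1 m2.
- apply: Or33; split=> // t t1 t2.
  rewrite ltNge le_eqVlt; apply/negP => /orP[/eqP e|lt].
    by apply: (nz t t1 t2); rewrite /f -e subrr.
  by apply: (same t0 t); rewrite // /f subr_gt0.
- apply: Or32; split=> // t t1 t2.
  rewrite ltNge le_eqVlt; apply/negP => /orP[/eqP e|lt].
    by apply: (nz t t1 t2); rewrite /f e subrr.
  by apply: (same t t0); rewrite // /f subr_lt0.
Qed.

Lemma pos_of h t : is_local h -> `|t - a0| < r -> `|t + bshift omega h - a0| < r ->
  x0 < A h t x0 -> moves_up h.
Proof.
move=> lh t1 t2 lt; case: (local_trichotomy lh) => // [h0|[_ /(_ t t1 t2)]].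
  by move: lt; rewrite h0 (zact0 zA) ltxx.
by move=> /(lt_trans lt); rewrite ltxx.
Qed.

Lemma pos_neq0 h : moves_up h -> h <> 0.
Proof.
move=> [_ /(_ a0)]; rewrite subrr normr0 => /(_ r0) + h0.
by rewrite h0 bshift0 addr0 subrr normr0 (zact0 zA) ltxx => /(_ r0).
Qed.

Lemma neg_pos h : moves_down h -> moves_up (- h).
Proof.
move=> [lh nh]; split; first by rewrite /is_local bshiftN normrN.
move=> t t1 t2; rewrite bshiftN in t2.
rewrite -(zact_lt zA h (t - bshift omega h)).
rewrite -[X in A h (_ - X)]opprK -bshiftN opprK.
have := zactD zA h (- h) t x0; rewrite subrr (zact0 zA) => <-.
by rewrite bshiftN; apply: nh; rewrite // subrK.
Qed.

Lemma pos_deck (m : int) : 0 < m -> moves_up (0, 0, m).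
Proof.
move=> m0; apply: (@pos_of _ a0); rewrite /is_local ?bshiftE /= ?mul0r ?addr0
  ?subrr ?normr0//; first by have := r0; lra.
by rewrite (zact_deck zA) ltrDl ltr0z.
Qed.

(** Helly's theorem on the line for three arcs of equal radius: the midpoint of the extreme centres
    works. It allows two moves to be composed over one base point. *)
Lemma common_point (s1 s2 : R) : `|s1| < 2 * r -> `|s2| < 2 * r ->
  `|s2 - s1| < 2 * r ->
  exists t, [/\ `|t - a0| < r, `|t + s1 - a0| < r & `|t + s2 - a0| < r].
Proof.
move=> h1 h2 h3.
exists (a0 - (Num.min 0 (Num.min s1 s2) + Num.max 0 (Num.max s1 s2)) / 2).
move: h1 h2 h3; case: (leP s1 s2) => h12; case: (leP 0 _) => ?; case: (leP 0 _) => ?;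
  rewrite !ltr_norml => ? ? ?; split; lra.
Qed.

Lemma posD g h : moves_up g -> moves_up h -> is_local (g + h) -> moves_up (g + h).
Proof.
move=> [lg pg] [lh ph] lgh.
have [||| t [t1 t2 t3]] := @common_point (bshift omega g) (bshift omega (g + h)) => //.
  by rewrite bshiftD addrAC subrr add0r.
apply: (pos_of lgh t1 t3); rewrite addrC (zactD zA).
apply: lt_le_trans (ph _ t2 _) _.
  by rewrite -[t + _ + _]addrA -bshiftD.
by rewrite (zact_le zA) ltW// pg.
Qed.

Lemma bshift_sum_ge0 (l : seq Z3) : (forall x, x \in l -> 0 < bshift omega x) ->
  0 <= bshift omega (\sum_(x <- l) x).
Proof.
elim: l => [|x l IH] hl; first by rewrite big_nil bshift0.
rewrite big_cons bshiftD addr_ge0 ?IH// => [|y yl].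
  by apply/ltW/hl; rewrite mem_head.
by apply: hl; rewrite inE yl orbT.
Qed.

Lemma bshift_sum_le0 (l : seq Z3) : (forall x, x \in l -> bshift omega x < 0) ->
  bshift omega (\sum_(x <- l) x) <= 0.
Proof.
elim: l => [|x l IH] hl; first by rewrite big_nil bshift0.
rewrite big_cons bshiftD -oppr_ge0 opprD addr_ge0 ?oppr_ge0 ?IH// => [|y yl].
  by apply/ltW/hl; rewrite mem_head.
by apply: hl; rewrite inE yl orbT.
Qed.

(* The summands can be reordered so that all partial sums stay local: the next
   summand is chosen to have a bshift of sign opposite to the current one. *)
Lemma pos_sum (l : seq Z3) u : (forall x, x \in l -> moves_up x) -> l <> [::] ->
  is_local u -> u = 0 \/ moves_up u -> is_local (u + \sum_(x <- l) x) ->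
  moves_up (u + \sum_(x <- l) x).
Proof.
move en : (size l) => n; elim: n l u en => [[]//|n IH] l u en pl l0 lu pu lul.
have [x xl lux] : exists2 x, x \in l & is_local (u + x).
  have hd : exists2 y, y \in l & True.
    by case: l l0 {en pl lul} => // y l _; exists y; rewrite ?mem_head.
  have [su|su] := leP 0 (bshift omega u).
    have [[x [xl sx]]|no] := pselect (exists x, x \in l /\ bshift omega x <= 0).
      exists x => //; have [lx _] := pl x xl; move: lu lx.
      by rewrite /is_local bshiftD !ltr_norml; lra.
    have sp y : y \in l -> 0 < bshift omega y.
      by move=> yl; rewrite ltNge; apply/negP => sy; apply: no; exists y.
    have [x xl _] := hd; exists x => //.
    move: lul lu; rewrite (perm_big _ (perm_to_rem xl)) big_cons.
    rewrite /is_local !bshiftD !ltr_norml.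
    have : 0 <= bshift omega (\sum_(y <- rem x l) y).
      by apply: bshift_sum_ge0 => y /mem_rem /sp.
    by have := sp x xl; lra.
  have [[x [xl sx]]|no] := pselect (exists x, x \in l /\ 0 <= bshift omega x).
    exists x => //; have [lx _] := pl x xl; move: lu lx.
    by rewrite /is_local bshiftD !ltr_norml; lra.
  have sp y : y \in l -> bshift omega y < 0.
    by move=> yl; rewrite ltNge; apply/negP => sy; apply: no; exists y.
  have [x xl _] := hd; exists x => //.
  move: lul lu; rewrite (perm_big _ (perm_to_rem xl)) big_cons.
  rewrite /is_local !bshiftD !ltr_norml.
  have : bshift omega (\sum_(y <- rem x l) y) <= 0.
    by apply: bshift_sum_le0 => y /mem_rem /sp.
  by have := sp x xl; lra.
have pux : moves_up (u + x).
  case: pu => [u0|pu]; first by rewrite u0 add0r; exact: pl.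
  by apply: posD => //; exact: pl.
move: lul; rewrite (perm_big _ (perm_to_rem xl)) big_cons addrA.
have [->|rl0] := eqVneq (rem x l) [::]; first by rewrite big_nil addr0.
move=> lul; apply: IH => //; last by right.
- by rewrite size_rem// en.
- by move=> y /mem_rem /pl.
- exact/eqP.
Qed.

(** The cone is the set of sums of elements that move up. If it contained a negative vertical
    translation, adding the inverse translation would give the sum 0, which would move up by
    [pos_sum]. *)
Lemma local_functional : exists rho kappa : R, forall h, moves_up h ->
  0 <= h.1.1%:~R * rho + h.1.2%:~R * kappa + h.2%:~R.
Proof.
pose C h := exists2 l : seq Z3, (forall x, x \in l -> moves_up x) &
  h = \sum_(x <- l) x.
have C0 : C 0 by exists [::]; rewrite ?big_nil.
have Cpos h : moves_up h -> C h.
  by move=> ph; exists [:: h]; rewrite ?big_seq1// => x; rewrite inE => /eqP ->.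
have CD g h : C g -> C h -> C (g + h).
  move=> [l pl ->] [l' pl' ->]; exists (l ++ l'); last by rewrite big_cat.
  by move=> x; rewrite mem_cat => /orP[/pl|/pl'].
have CM h n : C h -> C (h *+ n).
  by move=> Ch; elim: n => [|n IH]; rewrite ?mulr0n// mulrS; exact: CD.
have lz : is_local 0 by rewrite /is_local bshift0 normr0; have := r0; lra.
have Cdeck (m : int) : C (0, 0, m) -> 0 <= m.
  move=> [l pl lm]; rewrite leNgt; apply/negP => m0.
  have : moves_up (0 + \sum_(x <- (0, 0, - m) :: l) x).
    apply: pos_sum => //; last 2 first.
    - by left.
    - by rewrite big_cons -lm -[_ + (0, 0, m)]/(0 + 0, 0 + 0, - m + m)
        addNr !addr0.
    by move=> x; rewrite inE => /orP[/eqP ->|/pl//]; apply: pos_deck; lia.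
  rewrite big_cons -lm -[_ + (0, 0, m)]/(0 + 0, 0 + 0, - m + m) addNr !addr0.
  by move=> /pos_neq0; apply.
have Clocal h : is_local h -> exists m : int, C (h + (0, 0, m)).
  move=> lh; have [m1 m2] := local_mid lh; set t := a0 - _ in m1 m2.
  exists (Num.floor (x0 - A h t x0) + 1).
  apply: Cpos; apply: (@pos_of _ t) => //.
  - by rewrite /is_local bshiftD [bshift _ (0, 0, _)]bshiftE /= mul0r !addr0.
  - by rewrite bshiftD [bshift _ (0, 0, _)]bshiftE /= mul0r !addr0.
  rewrite addrC (zactD zA) (zact_deck zA) -ltrBlDl; exact: floorD1_gt.
have [u [lu su]] : exists u, is_local u /\ 0 < bshift omega u.
  have [n [k [_ /andP[s0 sr]]]] := rotation_small irr (mulr_gt0 (@ltr0Sn R 1) r0).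
  have sE : n%:~R * omega + k%:~R = bshift omega (n, k, 0) by rewrite bshiftE.
  rewrite sE in s0 sr; have [sp|sn] := leP 0 (bshift omega (n, k, 0)).
    by exists (n, k, 0); split=> //; rewrite -(ger0_norm sp).
  exists (- (n, k, 0)); rewrite /is_local bshiftN normrN; split=> //.
  by rewrite oppr_gt0.
(* [h] is the sum of copies of [u] or [- u] and a remainder, all local. Each summand moves up after
   a vertical translation. *)
have Cunit h : exists m : int, C (h + (0, 0, m)).
  pose l := Num.floor (bshift omega h / bshift omega u).
  have deckD (m m' : int) : (0, 0, m) + (0, 0, m') = (0, 0, m + m') :> Z3 by [].
  have decomp v (n : nat) : is_local v -> is_local (h - v *+ n) ->
      exists m, C (h + (0, 0, m)).
    move=> lv lhv; have [m Cm] := Clocal _ lv; have [m' Cm'] := Clocal _ lhv.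
    have := CD _ _ (CM _ n Cm) Cm'.
    have -> : (v + (0, 0, m)) *+ n + (h - v *+ n + (0, 0, m')) =
              h + ((0, 0, m) *+ n + (0, 0, m')).
      by rewrite mulrnDl addrACA [v *+ n + _]addrC subrK.
    have -> : (0, 0, m) *+ n = (0, 0, m *+ n) :> Z3.
      by elim: n {lhv Cm'} => [//|n IH]; rewrite !mulrS IH.
    by rewrite deckD => ?; eexists; eassumption.
  have sM n : bshift omega (u *+ n) = n%:R * bshift omega u.
    elim: n => [|n IH]; first by rewrite mulr0n bshift0 mul0r.
    by rewrite mulrS bshiftD IH -natr1; ring.
  have f1 := floor_le (bshift omega h / bshift omega u).
  have f2 := floorD1_gt (bshift omega h / bshift omega u).
  rewrite -/l intrD in f1 f2.
  have e : bshift omega h = bshift omega h / bshift omega u * bshift omega u.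
    by rewrite divfK// gt_eqF.
  have lu' := lu; rewrite /is_local gtr0_norm// in lu'.
  have loc : `|bshift omega h - l%:~R * bshift omega u| < 2 * r.
    by rewrite e -mulrBl normrM (gtr0_norm su) ger0_norm; [nra|lra].
  case: (lerP 0 l) => l0.
    apply: (decomp u `|l|%N) => //; rewrite /is_local bshiftD bshiftN sM.
    by rewrite pmulrn gez0_abs.
  apply: (decomp (- u) `|l|%N).
    by rewrite /is_local bshiftN normrN.
  rewrite /is_local bshiftD bshiftN mulNrn bshiftN sM opprK pmulrn ltz0_abs// mulrNz.
  by move: loc; congr (`|_| < _); ring.
have [rho [kappa P]] := cone_functional R C0 CD Cdeck Cunit.
by exists rho, kappa => h /Cpos /P.
Qed.

End LocalOrder.

(** * Integration over the circle *)

Section Integral01.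
Variable R : realType.
Implicit Types (f g : R -> R) (c x : R).
Notation mu := (@lebesgue_measure R).

Lemma antiderivative f (N : R) : continuous f ->
  exists G : R -> R, forall x, `|x| < N -> is_derive x 1 G (f x).
Proof.
move=> cf.
have intf : mu.-integrable `[- N, N] (EFin \o f).
  apply: continuous_compact_integrable; first exact: segment_compact.
  exact: continuous_subspaceT.
exists (fun x => (\int[mu]_(t in [set` `[- N, x]]) f t)%R).
move=> x; rewrite ltr_norml => /andP[Nx xN].
have [dG <-] := @continuous_FTC1_closed R f (- N) x N xN intf Nx (cf x).
by rewrite derive1E; exact: derivableP.
Qed.

Definition I01 f := (\int[mu]_(x in `[0, 1]) f x)%R.

Lemma continuous_translate f c : continuous f -> continuous (fun x => f (x + c)).
Proof.
move=> cf x; apply: (@continuous_comp _ _ _ (fun x => x + c) f); last exact: cf.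
by apply: continuousD; [exact: cvg_id|exact: cst_continuous].
Qed.

Lemma I01_shift_antiderivative f G (N c : R) : continuous f ->
  (forall x, `|x| < N -> is_derive x 1 G (f x)) -> `|c| + 2 <= N ->
  I01 (fun x => f (x + c)) = G (1 + c) - G c.
Proof.
move=> cf dG cN.
(* Derivability on a neighbourhood of [[0, 1]] gives the continuity of the primitive at both end
   points. *)
have dGc x : -1/2 < x < 2 -> is_derive x 1 (fun x => G (x + c)) (f (x + c)).
  move=> xI.
  have h : is_derive (x + c) 1 G (f (x + c)).
    by apply: dG; rewrite ltr_norml; have := ler_norm c; have := ler_norm (- c);
       rewrite normrN; lra.
  have h2 : is_derive x 1 (fun x : R => x + c) (1 + 0).
    by apply: is_deriveD.
  have := @is_derive1_comp R G (fun x => x + c) x _ _ h h2.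
  by rewrite addr0 mulr1.
have cGc x : -1/2 < x < 2 -> {for x, continuous (fun x => G (x + c))}.
  move=> /dGc [dx _]; apply: differentiable_continuous.
  exact/derivable1_diffP.
rewrite /I01 /Rintegral (@continuous_FTC2 R (fun x => f (x + c)) (fun x => G (x + c))) //.
- by rewrite add0r.
- apply: continuous_subspaceT; exact: continuous_translate.
- split.
  + move=> x; rewrite in_itv /= => /andP[x0 x1].
    by have [] := dGc x ltac:(lra).
  + by apply: cvg_at_right_filter; apply: cGc; lra.
  + by apply: cvg_at_left_filter; apply: cGc; lra.
- move=> x; rewrite in_itv /= => /andP[x0 x1].
  by have [_ <-] := dGc x ltac:(lra); rewrite derive1E.
Qed.

(** The integral over [[x, x + 1]] is [G (x + 1) - G x], whose derivative [f (x + 1) - f x]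
    vanishes. *)
Lemma I01_shift f c : continuous f -> (forall x, f (x + 1) = f x) ->
  I01 (fun x => f (x + c)) = I01 f.
Proof.
move=> cf pf; pose N := `|c| + 5.
have [G dG] := antiderivative N cf.
have c0 := normr_ge0 c.
have K x : `|x| <= `|c| -> I01 (fun t => f (t + x)) = G (x + 1) - G x.
  move=> xc; rewrite [x + 1]addrC; apply: (I01_shift_antiderivative cf dG).
  by rewrite /N; lra.
have -> : I01 f = I01 (fun t => f (t + 0)).
  by congr (I01 _); apply/funext => t; rewrite addr0.
rewrite !K ?normr0//.
pose H x := G (x + 1) - G x.
have dH x : `|x| < `|c| + 1 -> is_derive x 1 H 0.
  move=> xc.
  have h1 : is_derive (x + 1) 1 G (f (x + 1)).
    apply: dG; apply: le_lt_trans (ler_normD _ _) _.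
    by rewrite normr1 /N; lra.
  have h2 : is_derive x 1 (fun x : R => x + 1) (1 + 0) by apply: is_deriveD.
  have h3 := @is_derive1_comp R G (fun x => x + 1) x _ _ h1 h2.
  have h4 : is_derive x 1 G (f x) by apply: dG; rewrite /N; lra.
  have := is_deriveB h3 h4.
  by rewrite pf addr0 mulr1 subrr.
have cH x : `|x| < `|c| + 1 -> {for x, continuous H}.
  move=> /dH [dx _]; apply: differentiable_continuous; exact/derivable1_diffP.
rewrite -/(H c) -/(H 0).
have mvt a b : `|a| <= `|c| -> `|b| <= `|c| -> a < b -> H b = H a.
  move=> ac bc ab; apply/eqP; rewrite -subr_eq0.
  have in_ab x : a <= x <= b -> `|x| < `|c| + 1.
    move=> xab; move: ac bc; rewrite !ler_norml ltr_norml; lra.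
  have dab x : x \in `]a, b[ -> is_derive x 1 H 0.
    by rewrite in_itv /= => /andP[ax xb]; apply/dH/in_ab; lra.
  have cab : {within `[a, b], continuous H}.
    apply: continuous_in_subspaceT => x /set_mem /= xab.
    by apply/cH/in_ab; move: xab; rewrite in_itv.
  by have [z _ ->] := MVT ab dab cab; rewrite mul0r.
case: (ltrgtP c 0) => [c0'|c0'|->//].
  by apply/esym/mvt; rewrite ?normr0.
by apply/mvt; rewrite ?normr0.
Qed.

Let int01 f : continuous f -> mu.-integrable `[0, 1] (EFin \o f).
Proof.
move=> cf; apply: continuous_compact_integrable; first exact: segment_compact.
exact: continuous_subspaceT.
Qed.

Lemma I01D f g : continuous f -> continuous g ->
  I01 (fun x => f x + g x) = I01 f + I01 g.
Proof. by move=> cf cg; apply: RintegralD => //; exact: int01. Qed.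

Lemma I01Z f c : continuous f -> I01 (fun x => c * f x) = c * I01 f.
Proof. by move=> cf; apply: RintegralZl => //; exact: int01. Qed.

Lemma I01_cst c : I01 (fun=> c) = c.
Proof.
have e : lebesgue_measure (`[0, 1]%classic : set R) = 1%:E.
  by rewrite lebesgue_measure_itv /= lte_fin ltr01 oppr0 adde0.
rewrite /I01 Rintegral_cst //; transitivity (c * fine (1%:E : \bar R)).
  by congr (_ * fine _); exact: e.
by rewrite mulr1.
Qed.

Lemma le_I01 f g : continuous f -> continuous g -> (forall x, f x <= g x) ->
  I01 f <= I01 g.
Proof. by move=> cf cg fg; apply: le_Rintegral => //; exact: int01. Qed.

Lemma continuous_sum_seq (I : Type) (s : seq I) (f : I -> R -> R) :
  (forall i, continuous (f i)) -> continuous (fun x => \sum_(i <- s) f i x).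
Proof.
move=> cf; elim: s => [|i l IH] x.
  by under eq_fun do rewrite big_nil; exact: cst_continuous.
by under eq_fun do rewrite big_cons; apply: continuousD; [exact: cf|exact: IH].
Qed.

Lemma I01_sum (I : Type) (s : seq I) (f : I -> R -> R) :
  (forall i, continuous (f i)) ->
  I01 (fun x => \sum_(i <- s) f i x) = \sum_(i <- s) I01 (f i).
Proof.
move=> cf; have cs l := @continuous_sum_seq I l f cf.
elim: s => [|i s IH].
  by under eq_fun do rewrite big_nil; rewrite I01_cst big_nil.
under eq_fun do rewrite big_cons.
by rewrite I01D // IH big_cons.
Qed.

(* The integral of a nonnegative function is the supremum over the simple
   functions below it, hence monotone also for non-measurable V. *)
Lemma I01_le_integral f (V : R -> \bar R) : continuous f -> (forall x, 0 <= f x) ->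
  (forall x, (0 <= V x)%E) -> (forall x, ((f x)%:E <= V x)%E) ->
  ((I01 f)%:E <= \int[mu]_(x in `[0%R, 1%R]) V x)%E.
Proof.
move=> cf f0 V0 fV; rewrite /I01 /Rintegral fineK; last first.
  exact: integrable_fin_num (int01 cf).
rewrite [leRHS]integral_mkcond [leLHS]integral_mkcond.
have V1 x : (0 <= (V \_ `[0%R, 1%R]) x)%E by rewrite /patch; case: ifP.
have g0 x : (0 <= ((fun x => (f x)%:E) \_ `[0%R, 1%R]) x)%E.
  by rewrite /patch; case: ifP => // _; rewrite lee_fin.
rewrite ge0_integralTE // ge0_integralTE //.
apply: ereal_sup_le => _ [h hh <-]; exists h => // x.
apply: le_trans (hh x) _.
by rewrite /patch; case: ifP.
Qed.

End Integral01.

(** * Packing and variation on the circle *)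

Section Packing.
(** [mu] will be the total variation over an interval, and the length of an interval. *)
Variables (R : realType) (mu : R -> R -> \bar R).
Hypothesis mu0 : forall a b, a <= b -> (0 <= mu a b)%E.
Hypothesis muD : forall a b c, a <= b -> b <= c ->
  (mu a c = mu a b + mu b c)%E.
Hypothesis muS : forall a b, mu (a + 1) (b + 1) = mu a b.

Let muZ (k : int) a b : mu (a + k%:~R) (b + k%:~R) = mu a b.
Proof.
have nat_shift (n : nat) c d : mu (c + n%:R) (d + n%:R) = mu c d.
  elim: n => [|n IH]; first by rewrite !addr0.
  by rewrite -natr1 !addrA muS.
case: k => n; first by rewrite -pmulrn.
by rewrite NegzE mulrNz -pmulrn -(nat_shift n.+1) !subrK.
Qed.

(** Induction by removing the interval with the largest right end: all others end before it
    starts. *)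
Lemma packing_interval (s : seq nat) (lo hi : nat -> R) (c e : R) : uniq s ->
  c <= e -> (forall i, i \in s -> c <= lo i /\ lo i < hi i /\ hi i <= e) ->
  (forall i j, i \in s -> j \in s -> i != j -> hi i <= lo j \/ hi j <= lo i) ->
  (\sum_(i <- s) mu (lo i) (hi i) <= mu c e)%E.
Proof.
move en : (size s) => n; elim: n s e en => [|n IH] s e en us ce sI dis.
  by rewrite (size0nil en) big_nil; exact: mu0.
have [i0 i0s maxi] : exists2 i0, i0 \in s & forall j, j \in s -> hi j <= hi i0.
  have : s != [::] by rewrite -size_eq0 en.
  elim: s {en us sI dis} => // x [|y s] IHs _.
    by exists x => [|j]; rewrite ?mem_head// inE => /eqP ->.
  have [i is_ ih] := IHs isT; have [xi|ix] := leP (hi x) (hi i).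
    exists i => [|j]; rewrite inE ?is_ ?orbT// => /orP[/eqP ->//|/ih//].
  exists x => [|j]; rewrite ?mem_head// inE => /orP[/eqP ->//|/ih/le_trans]; apply.
  exact: ltW.
have [c0 [l0 h0]] := sI _ i0s.
rewrite (perm_big _ (perm_to_rem i0s)) big_cons /=.
rewrite (muD c0) ?(ltW (lt_le_trans l0 h0))// addeC; apply: leeD.
  apply: IH => //; first by rewrite size_rem// en.
  - exact: rem_uniq.
  - move=> j; rewrite mem_rem_uniq// !inE => /andP[ji js].
    have [cj [lj hj]] := sI _ js; split=> //; split=> //.
    case: (dis _ _ js i0s ji) => // h.
    by have := le_lt_trans h lj; rewrite ltNge maxi.
  - by move=> i j /mem_rem is_ /mem_rem js; exact: dis.
by rewrite (muD (ltW l0) h0) leeDl// mu0.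
Qed.

(* The intervals are disjoint modulo 1; translated next to one of them, they
   fit into a fundamental domain. *)
Lemma packing_circle (s : seq nat) (lo hi : nat -> R) : uniq s ->
  (forall i, i \in s -> lo i < hi i) ->
  (forall i j (m : int), i \in s -> j \in s -> (i != j) || (m != 0) ->
     hi i <= lo j + m%:~R \/ hi j + m%:~R <= lo i) ->
  (\sum_(i <- s) mu (lo i) (hi i) <= mu 0 1)%E.
Proof.
case: s => [|i0 s]; first by move=> _ _ _; rewrite big_nil; exact: mu0.
set s' := i0 :: s => us lh dis; have i0s : i0 \in s' by rewrite mem_head.
set c := lo i0.
have -> : mu 0 1 = mu c (c + 1).
  have f1 := floor_le c; have f2 := floorD1_gt c; rewrite intrD in f2.
  have {1}-> : c = (c - (Num.floor c)%:~R) + (Num.floor c)%:~R by rewrite subrK.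
  have -> : c + 1 = (c - (Num.floor c)%:~R + 1) + (Num.floor c)%:~R.
    by rewrite addrAC subrK.
  rewrite muZ; set d := c - _.
  have [d0 d1] : 0 <= d /\ d <= 1 by rewrite /d; lra.
  have d2 : 1 <= d + 1 by lra.
  rewrite (muD d0 d1) (muD d1 d2).
  by rewrite addeC -[X in (_ = _ + mu X _)%E]add0r muS.
pose m j := Num.floor (lo j - c).
have m1 j : (m j)%:~R <= lo j - c < (m j)%:~R + 1.
  by rewrite floor_le /=; have := floorD1_gt (lo j - c); rewrite intrD.
rewrite (eq_bigr (fun i => mu (lo i - (m i)%:~R) (hi i - (m i)%:~R))); last first.
  by move=> i _; rewrite -mulrNz muZ.
apply: packing_interval => //; first by rewrite lerDl.
  move=> j js; have := m1 j; have := lh _ js => l1 l2.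
  split; first by lra.
  split; first by lra.
  have [] := @dis j i0 (m j + 1) js i0s.
  - case: eqVneq => //= ->; rewrite /m subrr floor0; lia.
  - by rewrite intrD -/c; lra.
  - by have := lh _ i0s; rewrite intrD -/c; lra.
move=> i j is_ js ij; have [||] := @dis i j (m i - m j) is_ js; rewrite ?ij//.
  by rewrite intrB; left; lra.
by rewrite intrB; right; lra.
Qed.

End Packing.

Section PeriodicVariation.
Variable R : realType.

Lemma total_variation_translate (f : R -> R) a b c :
  total_variation (a + c) (b + c) f = total_variation a b (fun x => f (x + c)).
Proof.
have key (f' : R -> R) a' b' c' s : itv_partition a' b' s ->
    itv_partition (a' + c') (b' + c') [seq x + c' | x <- s] /\
    variation (a' + c') (b' + c') f' [seq x + c' | x <- s] =
      variation a' b' (fun x => f' (x + c')) s.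
  move=> [ps ls]; split.
    split; first by apply: (@homo_path _ _ (fun x => x + c')) ps => x y xy; rewrite ltrD2r.
    by rewrite (last_map (fun x => x + c')) (eqP ls).
  rewrite /variation size_map; apply: eq_big_nat => i /andP[_ is_].
  have e k : (k <= size s)%N ->
      nth (b' + c') (a' + c' :: [seq x + c' | x <- s]) k = nth b' (a' :: s) k + c'.
    by case: k => // k ks /=; rewrite (nth_map b').
  by rewrite /comp !e// ltnW.
rewrite /total_variation; congr ereal_sup.
apply/seteqP; split=> _ [_ [s ps <-] <-]; last first.
  have [p' e] := key f a b c s ps.
  by exists (variation (a + c) (b + c) f [seq x + c | x <- s]);
    [exists [seq x + c | x <- s]|rewrite e].
have [] := key (fun x => f (x + c)) _ _ (- c) s ps; rewrite !addrK => p' e.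
exists (variation a b (fun x => f (x + c)) [seq x - c | x <- s]).
  by exists [seq x - c | x <- s].
rewrite e; congr (_%:E); congr (variation _ _ _ _).
by apply/funext => x; rewrite subrK.
Qed.

Lemma total_variation_packing (f : R -> R) (s : seq nat) (lo hi : nat -> R) :
  (forall x, f (x + 1) = f x) -> uniq s ->
  (forall i, i \in s -> lo i < hi i) ->
  (forall i j (m : int), i \in s -> j \in s -> (i != j) || (m != 0) ->
     hi i <= lo j + m%:~R \/ hi j + m%:~R <= lo i) ->
  (\sum_(i <- s) total_variation (lo i) (hi i) f <= total_variation 0 1 f)%E.
Proof.
move=> pf; apply: (@packing_circle R (fun a b => total_variation a b f)).
- by move=> a b; exact: total_variation_ge0.
- by move=> a b c ab bc; exact: total_variationD.
- move=> a b; rewrite total_variation_translate; congr total_variation.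
  exact/funext.
Qed.

Lemma length_packing (s : seq nat) (lo hi : nat -> R) : uniq s ->
  (forall i, i \in s -> lo i < hi i) ->
  (forall i j (m : int), i \in s -> j \in s -> (i != j) || (m != 0) ->
     hi i <= lo j + m%:~R \/ hi j + m%:~R <= lo i) ->
  \sum_(i <- s) (hi i - lo i) <= 1.
Proof.
move=> us lh dis; rewrite -lee_fin -sumEFin -[leRHS]/(1%:E) -[X in (_ <= X%:E)%E]subr0.
apply: (@packing_circle R (fun a b => (b - a)%:E)) => //.
- by move=> a b ab; rewrite lee_fin subr_ge0.
- by move=> a b c _ _; rewrite -EFinD; congr EFin; ring.
- by move=> a b; congr EFin; ring.
Qed.

End PeriodicVariation.

(** * The action of lifted iterates *)

Section SkewAction.
Variables (R : realType) (omega : R) (F : R -> R -> R).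
Hypothesis TBV : in_T_BV F.

Let cF : continuous (fun z : R * R => F z.1 z.2) := let: conj (And4 h _ _ _) _ := TBV in h.
Let Fx1 t x : F t (x + 1) = F t x + 1. Proof. by case: TBV => -[]. Qed.
Let Ft1 t x : F (t + 1) x = F t x. Proof. by case: TBV => -[]. Qed.
Let dF t x : derivable (F t) x 1. Proof. by case: TBV => -[]. Qed.
Let F'0 t x : 0 < derive1 (F t) x. Proof. by case: TBV => _ []. Qed.

Lemma fibre_MVT t x y : x < y -> exists2 c, x < c < y &
  F t y - F t x = derive1 (F t) c * (y - x).
Proof.
move=> xy.
have dF' c : c \in `]x, y[ -> is_derive c 1 (F t) (derive1 (F t) c).
  by move=> _; rewrite derive1E; exact: derivableP.
have cFt : {within `[x, y], continuous (F t)}.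
  apply: continuous_subspaceT => c; apply: differentiable_continuous.
  exact/derivable1_diffP.
by have [c cI ->] := MVT xy dF' cFt; exists c.
Qed.

Let F_incr t x y : x < y -> F t x < F t y.
Proof.
by move=> xy; have [c _ e] := fibre_MVT t xy; rewrite -subr_gt0 e mulr_gt0// subr_gt0.
Qed.

Let F_lt t : {mono F t : x y / x < y}.
Proof. by apply: leW_mono; apply: le_mono => x y; exact: F_incr. Qed.

Let F_inj t : injective (F t).
Proof.
move=> x y e; case: (ltrgtP x y) => // /(F_incr t); by rewrite e ltxx.
Qed.

Let Fxk t x (k : int) : F t (x + k%:~R) = F t x + k%:~R.
Proof.
have nat_shift (n : nat) y : F t (y + n%:R) = F t y + n%:R.
  elim: n => [|n IH]; first by rewrite !addr0.
  by rewrite -natr1 !addrA Fx1 IH.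
case: k => n; first by rewrite -pmulrn.
by rewrite NegzE mulrNz -pmulrn -{2}(subrK n.+1%:R x) nat_shift addrK.
Qed.

Let Ftk t x (k : int) : F (t + k%:~R) x = F t x.
Proof.
have nat_shift (n : nat) s : F (s + n%:R) x = F s x.
  elim: n => [|n IH]; first by rewrite addr0.
  by rewrite -natr1 addrA Ft1 IH.
case: k => n; first by rewrite -pmulrn.
by rewrite NegzE mulrNz -pmulrn -(nat_shift n.+1) subrK.
Qed.

Let F_cont t x e : 0 < e -> exists2 d : R, 0 < d & forall t' x',
  `|t' - t| < d -> `|x' - x| < d -> `|F t' x' - F t x| < e.
Proof.
move=> e0; have /cvgrPdist_lt/(_ e e0) := @cF (t, x).
rewrite near_nbhs /= => -[[U V] /= [/nbhs_ballP[d1 /= d10 h1] /nbhs_ballP[d2 /= d20 h2]] UV].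
exists (Num.min d1 d2); first by rewrite lt_min d10.
move=> t' x'; rewrite !lt_min => /andP[t1 _] /andP[_ x2].
rewrite distrC; apply: (UV (t', x')); split=> /=.
  by apply: h1; rewrite /ball /= distrC.
by apply: h2; rewrite /ball /= distrC.
Qed.

Let F_surj t y : exists x, F t x = y.
Proof.
pose f x := F t x - y.
have cf : cont1 f.
  move=> x e e0; have [d d0 hd] := F_cont t x e0.
  exists d => // x' xx'; rewrite /f opprB addrA subrK.
  by apply: hd; rewrite ?subrr ?normr0.
pose k := Num.floor (y - F t 0).
have k1 := floor_le (y - F t 0); have k2 := floorD1_gt (y - F t 0).
rewrite intrD -/k in k1 k2.
have [||x _ fx] := @cont1_zero2 _ f (0 + (k - 1)%:~R) (0 + (k + 1)%:~R) cf.
- by rewrite /f Fxk intrB; lra.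
- by rewrite /f Fxk intrD; lra.
by exists x; apply/eqP; rewrite -subr_eq0; apply/eqP.
Qed.

(** The inverse fibre map; the default [0] is never taken, by [F_surj]. *)
Let G t y := xget 0 [set x | F t x = y].

Let FG t y : F t (G t y) = y.
Proof. by have [x hx] := F_surj t y; rewrite /G; case: xgetP => // /(_ x). Qed.

Let GF t x : G t (F t x) = x.
Proof. by apply: (F_inj (t := t)); rewrite FG. Qed.

(** Continuity of [F] at the two heights [x - e] and [x + e] suffices: by monotonicity they trap
    [G t' y']. *)
Let G_cont t y e : 0 < e -> exists2 d : R, 0 < d & forall t' y',
  `|t' - t| < d -> `|y' - y| < d -> `|G t' y' - G t y| < e.
Proof.
move=> e0; set x := G t y.
have yE : F t x = y by exact: FG.
have up : y < F t (x + e) by rewrite -{1}yE; apply: F_incr; lra.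
have dn : F t (x - e) < y by rewrite -{1}yE; apply: F_incr; lra.
have [d1 d10 h1] := F_cont t (x + e) (e := (F t (x + e) - y) / 2) ltac:(lra).
have [d2 d20 h2] := F_cont t (x - e) (e := (y - F t (x - e)) / 2) ltac:(lra).
exists (Num.min (Num.min d1 d2) (Num.min ((F t (x + e) - y) / 2) ((y - F t (x - e)) / 2))).
  by rewrite !lt_min d10 d20 /=; lra.
move=> t' y'; rewrite !lt_min => /andP[/andP[t1 t2] _] /andP[_ /andP[y1 y2]].
have := h1 t' (x + e) t1; rewrite subrr normr0 => /(_ d10) g1.
have := h2 t' (x - e) t2; rewrite subrr normr0 => /(_ d20) g2.
move: y1 y2 g1 g2; rewrite !ltr_norml => y1 y2 g1 g2.
have lo : x - e < G t' y' by rewrite -(F_lt t') FG; lra.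
have hi : G t' y' < x + e by rewrite -(F_lt t') FG; lra.
by rewrite -/x; lra.
Qed.

Let S (z : R * R) := (z.1 + omega, F z.1 z.2).
Let S' (z : R * R) := (z.1 - omega, G (z.1 - omega) z.2).

Let SS' z : S (S' z) = z.
Proof. by case: z => t x; rewrite /S /S' /= FG subrK. Qed.

Let S'S z : S' (S z) = z.
Proof. by case: z => t x; rewrite /S /S' /= addrK GF. Qed.

Let Tz (n : int) z := if 0 <= n then iter (absz n) S z else iter (absz n) S' z.

Let TzS n z : Tz (n + 1) z = S (Tz n z).
Proof.
rewrite /Tz; case: (lerP 0 n) => n0.
  have e1 : 0 <= n + 1 by lia.
  have e2 : absz (n + 1)%R = (absz n).+1 by lia.
  by rewrite e1 e2.
have [->|n1] := eqVneq n (-1); first by rewrite /= SS'.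
have e1 : (0 <= n + 1) = false by lia.
have e2 : absz n = (absz (n + 1)%R).+1 by lia.
by rewrite e1 e2 /= SS'.
Qed.

Let TzB n z : Tz (n - 1) z = S' (Tz n z).
Proof. by rewrite -{2}(subrK 1 n) TzS S'S. Qed.

Let TzD n m z : Tz (n + m) z = Tz n (Tz m z).
Proof.
elim/int_rect: n => [|n IH|n IH]; first by rewrite add0r.
  by rewrite -addn1 PoszD -addrA [1 + m]addrC addrA !TzS IH.
by rewrite -addn1 PoszD opprD -addrA [- 1 + m]addrC addrA !TzB IH.
Qed.

Let Tz1 n z : (Tz n z).1 = z.1 + n%:~R * omega.
Proof.
elim/int_rect: n => [|n IH|n IH]; first by rewrite mul0r addr0.
  by rewrite -addn1 PoszD TzS /= IH intrD mulrDl mul1r addrA.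
by rewrite -addn1 PoszD opprD TzB /= IH intrD mulrDl mulN1r addrA.
Qed.

Let S_deck z (k m : int) : S (z.1 + k%:~R, z.2 + m%:~R) =
  ((S z).1 + k%:~R, (S z).2 + m%:~R).
Proof. by rewrite /S /= Fxk Ftk addrAC. Qed.

Let S'_deck z (k m : int) : S' (z.1 + k%:~R, z.2 + m%:~R) =
  ((S' z).1 + k%:~R, (S' z).2 + m%:~R).
Proof. by rewrite -[RHS]S'S S_deck SS'. Qed.

Let Tz_deck n z (k m : int) : Tz n (z.1 + k%:~R, z.2 + m%:~R) =
  ((Tz n z).1 + k%:~R, (Tz n z).2 + m%:~R).
Proof.
elim/int_rect: n => [|n IH|n IH]; first by [].
  by rewrite -addn1 PoszD !TzS IH S_deck.
by rewrite -addn1 PoszD opprD !TzB IH S'_deck.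
Qed.

Let cont2 (f : R * R -> R * R) := forall z e, 0 < e -> exists2 d : R, 0 < d &
  forall w, `|w.1 - z.1| < d -> `|w.2 - z.2| < d ->
    `|(f w).1 - (f z).1| < e /\ `|(f w).2 - (f z).2| < e.

Let Tz_cont n : cont2 (Tz n).
Proof.
have cS : cont2 S.
  move=> z e e0; have [d d0 hd] := F_cont z.1 z.2 e0.
  exists (Num.min d e); first by rewrite lt_min d0.
  move=> w; rewrite !lt_min => /andP[w1 w1'] /andP[w2 w2'] /=; split.
    by rewrite opprD addrACA subrr addr0.
  exact: hd.
have cS' : cont2 S'.
  move=> z e e0; have [d d0 hd] := G_cont (z.1 - omega) z.2 e0.
  exists (Num.min d e); first by rewrite lt_min d0.
  have sh (w : R * R) : w.1 - omega - (z.1 - omega) = w.1 - z.1.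
    by rewrite opprB addrA subrK.
  move=> w; rewrite !lt_min => /andP[w1 w1'] /andP[w2 w2'] /=; split.
    by rewrite sh.
  by apply: hd; rewrite ?sh.
have comp f g : cont2 f -> cont2 g -> cont2 (fun z => f (g z)).
  move=> cf cg z e e0; have [d d0 hd] := cf (g z) e e0.
  have [d' d'0 hd'] := cg z d d0; exists d' => // w w1 w2.
  by have [? ?] := hd' w w1 w2; exact: hd.
elim/int_rect: n => [|n IH|n IH].
- by move=> z e e0; exists e.
- exact: comp _ _ cS IH.
- move=> z e e0; have [d d0 hd] := comp _ _ cS' IH z e e0; exists d; first by [].
  by move=> w w1 w2; rewrite -addn1 PoszD opprD !TzB; exact: hd.
Qed.

Let Tz_incr n t x y : x < y -> (Tz n (t, x)).2 < (Tz n (t, y)).2.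
Proof.
have E m s u : Tz m (s, u) = (s + m%:~R * omega, (Tz m (s, u)).2).
  by rewrite [LHS]surjective_pairing Tz1.
move=> xy; elim/int_rect: n => [|n IH|n IH]; first by [].
  by rewrite -addn1 PoszD !TzS E [in ltRHS]E; exact: F_incr.
rewrite -addn1 PoszD opprD !TzB E [in ltRHS]E /S' /=.
by rewrite -(F_lt (t + (- n%:Z)%:~R * omega - omega)) !FG.
Qed.

(** The base translation [h.1.2] leaves second coordinates unchanged; it appears in [bshift]. *)
Definition skew_action (h : Z3) t x := (Tz h.1.1 (t, x)).2 + h.2%:~R.

Lemma skew_zaction : zaction omega skew_action.
Proof.
split.
- by move=> t x; rewrite /skew_action /= addr0.
- move=> h g t x; rewrite /skew_action bshiftE /= TzD.
  rewrite [Tz g.1.1 (t, x)]surjective_pairing Tz1 /=.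
  have := Tz_deck h.1.1 (t + g.1.1%:~R * omega, (Tz g.1.1 (t, x)).2) g.1.2 g.2.
  by rewrite /= !addrA => ->; rewrite /= intrD addrAC addrA.
- by move=> h t x y xy; rewrite ltrD2r Tz_incr.
- by move=> k m t x.
- move=> h t x e e0; have [d d0 hd] := Tz_cont h.1.1 (t, x) e0.
  exists d => // t' x' tt' xx'; have [_] := hd (t', x') tt' xx'.
  by rewrite /skew_action opprD addrACA subrr addr0.
Qed.

Lemma iter_skewT p z : iter p (skewT omega F) z = act omega skew_action (p%:Z, 0, 0) z.
Proof.
rewrite /act /skew_action bshiftE /= !addr0 -Tz1 -[(z.1, z.2)]surjective_pairing.
by rewrite -surjective_pairing.
Qed.

Lemma skew_action1 t x : skew_action (1, 0, 0) t x = F t x.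
Proof. by rewrite /skew_action /= addr0. Qed.

End SkewAction.

(** * Tent functions on the circle *)

Section Bump.
Variable R : realType.
Implicit Types t s : R.

Lemma cdist_attained t : exists k : int, cdist t = `|t - k%:~R|.
Proof.
have h1 := floor_le t; have h2 := floorD1_gt t; rewrite intrD in h2.
rewrite /cdist /fracR; case: leP => h.
  by exists (Num.floor t); rewrite ger0_norm; lra.
by exists (Num.floor t + 1); rewrite intrD ler0_norm; lra.
Qed.

Lemma cdist_lipschitz t s : cdist t <= cdist s + `|t - s|.
Proof.
have [k ->] := cdist_attained s; apply: le_trans (cdist_le t k) _.
have -> : t - k%:~R = (s - k%:~R) + (t - s) by ring.
exact: ler_normD.
Qed.

Lemma cdist_periodic t : cdist (t + 1) = cdist t.
Proof.
have key s (l : int) : cdist (s + l%:~R) <= cdist s.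
  have [k ->] := cdist_attained s; apply: le_trans (cdist_le _ (k + l)) _.
  by rewrite intrD opprD addrACA subrr addr0.
by apply/eqP; rewrite eq_le (key t 1) -{1}(addrK 1 t) (key (t + 1) (-1)).
Qed.

(** A continuous periodic weight that replaces the indicator of the base arc, so that the weighted
    integrands stay continuous. *)
Definition bump (a e : R) t : R := Num.max 0 (e - cdist (t - a)).

Lemma bump_ge0 a e t : 0 <= bump a e t.
Proof. by rewrite /bump le_max lexx. Qed.

Lemma bump_le a e t : 0 <= e -> bump a e t <= e.
Proof.
by move=> e0; rewrite /bump ge_max e0 gerBl /=; have [k ->] := cdist_attained (t - a); exact: normr_ge0.
Qed.

Lemma bump_periodic a e t : bump a e (t + 1) = bump a e t.
Proof. by rewrite /bump (addrAC t) cdist_periodic. Qed.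

Lemma cont1_continuous (f : R -> R) : cont1 f -> continuous f.
Proof.
move=> cf t; apply/cvgrPdist_lt => e e0; have [d d0 hd] := cf t e e0.
apply/nbhs_ballP; exists d => // s; rewrite /ball /= => st.
by rewrite distrC; apply: hd; rewrite distrC.
Qed.

Lemma bump_continuous a e : continuous (bump a e).
Proof.
apply: cont1_continuous => t d d0; exists d => // s st.
have h1 := cdist_lipschitz (t - a) (s - a); have h2 := cdist_lipschitz (s - a) (t - a).
have e1 : t - a - (s - a) = t - s by ring.
have e2 : s - a - (t - a) = s - t by ring.
rewrite e1 distrC in h1; rewrite e2 in h2.
apply: le_lt_trans st; rewrite /bump.
by case: (leP 0 (e - cdist (t - a))) => ?; case: (leP 0 (e - cdist (s - a))) => ?;
  rewrite ler_norml; lra.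
Qed.

Lemma bump_neq0 a e t : bump a e t != 0 ->
  exists k : int, `|t + k%:~R - a| < e.
Proof.
move=> b0; have : cdist (t - a) < e.
  rewrite ltNge; apply/negP => h; move: b0; rewrite /bump max_l ?eqxx//; lra.
by move=> /cdist_ltP[k hk]; exists (- k); rewrite mulrNz addrAC.
Qed.

(* Finitely many translates of the bump cover the circle. *)
Lemma bump_I01 a e : 0 < e -> 0 < I01 (bump a e).
Proof.
move=> e0.
pose N := (Num.truncn (2 / e)).+1.
have N0 : 0 < N%:R :> R by rewrite ltr0n.
have Ne : N%:R^-1 <= e / 2.
  have h : 2 / e < N%:R by exact: truncnS_gt.
  rewrite -[e / 2]invrK lef_pV2 ?posrE// ?invr_gt0 ?divr_gt0//.
  by rewrite invf_div ltW.
have cover t : e / 2 <= \sum_(i <- iota 0 N) bump a e (t + i%:R / N%:R).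
  pose f := fracR (a - t).
  have f0 : 0 <= f < 1.
    rewrite /f /fracR; have := floor_le (a - t); have := floorD1_gt (a - t).
    by rewrite intrD; lra.
  have Nf0 : 0 <= N%:R * f by apply: mulr_ge0; [exact: ltW|lra].
  pose i := Num.truncn (N%:R * f).
  have i1 : i%:R <= N%:R * f by rewrite truncn_le.
  have i2 : N%:R * f < i.+1%:R by exact: truncnS_gt.
  have iN : (i < N)%N.
    by rewrite -(ltr_nat R); apply: le_lt_trans i1 _; rewrite gtr_pMr//; lra.
  rewrite (bigD1_seq i) ?iota_uniq ?mem_iota//=.
  have : e / 2 <= bump a e (t + i%:R / N%:R).
    rewrite /bump le_max; apply/orP; right.
    suff : cdist (t + i%:R / N%:R - a) <= N%:R^-1 by lra.
    apply: le_trans (cdist_le _ (- Num.floor (a - t))) _.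
    have -> : t + i%:R / N%:R - a - (- Num.floor (a - t))%:~R = i%:R / N%:R - f.
      by rewrite /f /fracR mulrNz; ring.
    have -> : i%:R / N%:R - f = - ((N%:R * f - i%:R) / N%:R).
      by rewrite mulrBl [N%:R * f]mulrC mulfK ?gt_eqF//; ring.
    rewrite normrN normrM [X in _ * X]gtr0_norm ?invr_gt0// ger_pMl ?invr_gt0//.
    by rewrite -natr1 in i2; rewrite ger0_norm; lra.
  have : 0 <= \sum_(j <- iota 0 N | j != i) bump a e (t + j%:R / N%:R).
    by apply: sumr_ge0 => j _; exact: bump_ge0.
  lra.
have cb := @bump_continuous a e.
have ct i : continuous (fun t => bump a e (t + i%:R / N%:R)).
  exact: continuous_translate.
have csum : continuous (fun t => \sum_(i <- iota 0 N) bump a e (t + i%:R / N%:R)).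
  exact: continuous_sum_seq.
have := le_I01 (@cst_continuous _ _ (e / 2)) csum cover.
rewrite I01_cst I01_sum// (eq_bigr (fun=> I01 (bump a e))); last first.
  by move=> i _; apply: I01_shift => // t; exact: bump_periodic.
rewrite big_const_seq count_predT size_iota iter_addr_0 -mulr_natl => h.
by rewrite -(pmulr_rgt0 _ N0); lra.
Qed.

End Bump.

Lemma int_norm_lt1 (m : int) : `|m| < 1 -> m = 0.
Proof. lia. Qed.

Lemma int_eq_succ (N : nat) (m : int) : N%:Z < m -> m <= N.+1%:Z -> m = N.+1%:Z.
Proof. lia. Qed.

Lemma int_norm_ge1 (m : int) : m != 0 -> 1 <= `|m|.
Proof. lia. Qed.

Lemma int_pos_mul (l : nat) (n : int) : (0 < l)%N -> 0 < n -> 0 < l%:Z * n.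
Proof. nia. Qed.

Lemma int_range_sub (i j n : nat) : (i < j)%N -> (j < n)%N ->
  0 < j%:Z - i%:Z < n%:Z.
Proof. lia. Qed.

Lemma absz_between (m : int) (n : nat) : 0 < m < n%:Z -> (n <= absz m)%N -> False.
Proof. lia. Qed.

(** * The Denjoy argument *)

Section Denjoy.
Variables (R : realType) (omega : R) (F : R -> R -> R).
Hypothesis irr : @irrational R omega.
Hypothesis TBV : in_T_BV F.
Let A := skew_action omega F.
Let zA : zaction omega A := skew_zaction omega TBV.
Variables (a0 r x0 w : R).
Hypotheses (r0 : 0 < r) (r4 : 4 * r <= 1) (w0 : 0 < w) (w2 : 2 * w <= 1).
Hypothesis wandering : forall (h : Z3) t x, h.1.1 != 0 ->
  `|t - a0| < r -> `|x - x0| < w -> `|t + bshift omega h - a0| < r ->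
  `|A h t x - x0| < w -> False.
Variables rho kappa : R.

Definition height (h : Z3) : R := h.1.1%:~R * rho + h.1.2%:~R * kappa + h.2%:~R.

Hypothesis height_ge0 : forall h, moves_up omega A a0 r x0 h -> 0 <= height h.

Lemma heightD g h : height (g + h) = height g + height h.
Proof. by rewrite /height /= !intrD; ring. Qed.

Lemma heightN h : height (- h) = - height h.
Proof. by rewrite /height /= !mulrNz; ring. Qed.

Lemma height_pos h : is_local omega r h -> 0 < height h -> moves_up omega A a0 r x0 h.
Proof.
move=> lh vh; have [h0|//|nh] := local_trichotomy zA r0 r4 w0 wandering lh.
  by move: vh; rewrite h0 /height /= !mul0r !addr0 ltxx.
by have := height_ge0 (neg_pos zA nh); rewrite heightN oppr_ge0 leNgt vh.
Qed.

(** The order of the centre lines extends to the whole box. If [h' - h] moved the centre up but left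
    the lower edge below the upper edge of the box, a point of the lower half would return to the
    box. A vertical translation moves by at least [1 >= 2 * w]. *)
Lemma pos_separated (h h' : Z3) t t' :
  `|t - a0| < r -> `|t' - a0| < r ->
  t + bshift omega h = t' + bshift omega h' -> moves_up omega A a0 r x0 (h' - h) ->
  A h t (x0 + w) <= A h' t' (x0 - w).
Proof.
move=> ta t'a e [_ pd]; set d := h' - h.
have et : t' + bshift omega d = t by rewrite /d bshiftD bshiftN addrA -e addrK.
have -> : A h' t' (x0 - w) = A h t (A d t' (x0 - w)).
  by rewrite -{1}et -(zactD zA) /d [h + _]addrC subrK.
rewrite (zact_le zA) leNgt; apply/negP => lt.
have q0 := pd t' t'a; rewrite -/d et in q0; have {}q0 := q0 ta.
have [d0|d0] := eqVneq d.1.1 0.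
  have ld : is_local omega r d.
    by move: ta t'a; rewrite /is_local -et !ltr_norml; lra.
  move: lt q0; rewrite (local_vertical r0 r4 w0 ld d0) !(zact_deck zA) => lt q0.
  have : 0 < d.2%:~R :> R by lra.
  rewrite ltr0z => d2; have : 1%:~R <= d.2%:~R :> R by rewrite ler_int -gtz0_ge1.
  by have := w2; rewrite mulr1z; lra.
set p := A d t' (x0 - w) in lt; set q := A d t' x0 in q0.
have pq : p < q by rewrite (zact_lt zA); have := w0; lra.
(* A value in the overlap of the image [(p, q)] of the lower half with the box. *)
pose v := (Num.max p (x0 - w) + Num.min q (x0 + w)) / 2.
have [v1 v2 v3 v4] : [/\ p < v, v < q, x0 - w < v & v < x0 + w].
  have w0' := w0; rewrite /v; case: (leP p (x0 - w)) => ?;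
  case: (leP q (x0 + w)) => ?; split; lra.
pose f x := A d t' x - v.
have cf : cont1 f.
  move=> x e' e0; have [dd dd0 hd] := zact_cont zA d t' x e0.
  exists dd => // x' xx'; rewrite /f opprB addrA subrK; apply: hd => //.
  by rewrite subrr normr0.
have w0' := w0.
have [|||x xI fx] := @cont1_zero R f (x0 - w) x0 cf; rewrite ?/f -/p -/q.
- by lra.
- by lra.
- by lra.
have xv : A d t' x = v by apply/eqP; rewrite -subr_eq0; apply/eqP.
have xlo : x0 - w < x by rewrite -(zact_lt zA d t') xv.
apply: (@wandering d t' x) => //.
- by rewrite ltr_norml; lra.
- by rewrite et.
- by rewrite xv ltr_norml; lra.
Qed.

Definition image_length (i : int) t := A (i, 0, 0) t (x0 + w) - A (i, 0, 0) t (x0 - w).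

Lemma len_gt0 i t : 0 < image_length i t.
Proof. by rewrite subr_gt0 (zact_lt zA); have := w0; lra. Qed.

Lemma len_le1 i t : image_length i t <= 1.
Proof.
rewrite /image_length lerBlDl addrC -(zact_vertical zA _ 1) (zact_le zA) mulr1z.
by have := w2; lra.
Qed.

Lemma zact_hor (i k : int) t x : A (i, - k, 0) (t + k%:~R) x = A (i, 0, 0) t x.
Proof.
have -> : (i, 0, 0) = (i, - k, 0) + (0, k, 0) :> Z3.
  by rewrite -[RHS]/(i + 0, - k + k, 0 + 0) addNr !addr0.
by rewrite (zactD zA) (zact_deck zA) bshiftE /= mul0r add0r addr0.
Qed.

Lemma zact_periodic i t x : A (i, 0, 0) (t + 1) x = A (i, 0, 0) t x.
Proof.
have := zact_hor i 1 t x => <-; rewrite mulr1z.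
have -> : (i, - 1, 0) = (0, - 1, 0) + (i, 0, 0) :> Z3.
  by rewrite -[RHS]/(0 + i, - 1 + 0, 0 + 0) !addr0 add0r.
by rewrite (zactD zA) (zact_deck zA) addr0.
Qed.

Lemma len_continuous i : continuous (image_length i).
Proof.
have c x : continuous (fun t => A (i, 0, 0) t x).
  exact: cont1_continuous (zact_cont1 zA (i, 0, 0) x).
move=> t; apply: (@continuousB R R R (fun t => A (i, 0, 0) t (x0 + w))
  (fun t => A (i, 0, 0) t (x0 - w)) t); exact: c.
Qed.

Lemma derive1_periodic t x : derive1 (F t) (x + 1) = derive1 (F t) x.
Proof.
have [[_ Fx1 _ dF] _] := TBV.
have h1 : is_derive (x + 1) 1 (F t) (derive1 (F t) (x + 1)).
  by rewrite derive1E; exact: derivableP.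
have h2 : is_derive x 1 (fun x : R => x + 1) (1 + 0) by apply: is_deriveD.
have h3 := @is_derive1_comp R (F t) (fun x => x + 1) x _ _ h1 h2.
have h4 : is_derive x 1 (F t) (derive1 (F t) x).
  by rewrite derive1E; exact: derivableP.
have h5 : is_derive x 1 (fun y : R => F t y + 1) (derive1 (F t) x + 0).
  by apply: is_deriveD.
have e : F t \o (fun x => x + 1) = (fun y => F t y + 1).
  by apply/funext => y /=; rewrite Fx1.
rewrite e in h3; case: h3 => _; case: h5 => _ ->.
by rewrite !addr0 mulr1.
Qed.

Definition logD t x := ln (derive1 (F t) x).

Lemma logD_int t x (k : int) : logD t (x + k%:~R) = logD t x.
Proof.
have nat_shift (n : nat) y : logD t (y + n%:R) = logD t y.
  elim: n => [|n IH]; first by rewrite addr0.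
  by rewrite -natr1 addrA {1}/logD derive1_periodic.
case: k => n; first by rewrite -pmulrn.
by rewrite NegzE mulrNz -pmulrn -(nat_shift n.+1) subrK.
Qed.

Lemma ln_len_step (i : int) t : exists2 c,
  A (i, 0, 0) t (x0 - w) < c < A (i, 0, 0) t (x0 + w) &
  ln (image_length (i + 1) t) - ln (image_length i t) = logD (t + i%:~R * omega) c.
Proof.
have xw : A (i, 0, 0) t (x0 - w) < A (i, 0, 0) t (x0 + w).
  by rewrite (zact_lt zA); have := w0; lra.
have [c cI e] := fibre_MVT TBV (t + i%:~R * omega) xw.
exists c => //.
have Ai x : A (i + 1, 0, 0) t x = F (t + i%:~R * omega) (A (i, 0, 0) t x).
  have -> : (i + 1, 0, 0) = (1, 0, 0) + (i, 0, 0) :> Z3.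
    by rewrite -[RHS]/(1 + i, 0 + 0, 0 + 0) !addr0 addrC.
  by rewrite (zactD zA) {1}/A skew_action1 bshiftE /= addr0.
have -> : image_length (i + 1) t = derive1 (F (t + i%:~R * omega)) c * image_length i t.
  by rewrite {1}/image_length !Ai e.
have [_ [F'0 _ _]] := TBV.
rewrite lnM ?posrE ?len_gt0// /logD; lra.
Qed.

Lemma zact_split (i k m : int) t x : A (i, k, m) t x = A (i, 0, 0) t x + m%:~R.
Proof.
have -> : (i, k, m) = (0, k, m) + (i, 0, 0) :> Z3.
  by rewrite -[RHS]/(0 + i, k + 0, m + 0) !addr0 add0r.
by rewrite (zactD zA) (zact_deck zA).
Qed.

Lemma zact_translate (i k : int) t x : A (i, 0, 0) (t + k%:~R) x = A (i, 0, 0) t x.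
Proof. by rewrite -[RHS](zact_hor i k) [RHS]zact_split addr0. Qed.

Variable r1 : R.
Hypotheses (r10 : 0 < r1) (r1r : 2 * r1 <= r).
Hypothesis noker : forall h, h.1.1 != 0 -> `|bshift omega h| < r1 -> height h != 0.

(** A base shift below [r1 / N.+1] stays below [r1] after multiplication by some [l <= N.+1].
    Dirichlet's theorem supplies such an [l] that brings the height close to an integer, which [- m]
    removes. *)
Lemma small_values e : 0 < e -> exists h : Z3,
  [/\ 0 < h.1.1, `|bshift omega h| < r1 & 0 < `|height h| < e].
Proof.
move=> e0; pose N := Num.truncn e^-1.
have Ne : (N.+1%:R)^-1 < e.
  rewrite invf_plt ?posrE// ?ltr0n//; exact: truncnS_gt.
have N0 : 0 < N.+1%:R :> R by rewrite ltr0n.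
have [n [k [n0 /andP[s0 s1]]]] := rotation_small irr (divr_gt0 r10 N0).
have [l [m [/andP[l0 lN] hl]]] := dirichlet (n%:~R * rho + k%:~R * kappa) N.
pose h : Z3 := (l%:Z * n, l%:Z * k, - m).
have lr : l%:Z%:~R = l%:R :> R by rewrite pmulrn.
have h0 : 0 < h.1.1 by exact: int_pos_mul.
have sh : `|bshift omega h| < r1.
  have -> : bshift omega h = l%:R * (n%:~R * omega + k%:~R).
    by rewrite bshiftE /= !intrM lr; ring.
  rewrite normrM ger0_norm//; apply: le_lt_trans (_ : N.+1%:R * `|n%:~R * omega + k%:~R| < r1).
    by rewrite ler_wpM2r// ler_nat.
  by rewrite mulrC -ltr_pdivlMr.
exists h; split=> //; rewrite normr_gt0 noker//=; last by rewrite gt_eqF.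
have -> : height h = l%:R * (n%:~R * rho + k%:~R * kappa) - m%:~R.
  by rewrite /height /= !intrM lr mulrNz; ring.
exact: lt_trans hl Ne.
Qed.

(** The two elements differ by a vertical translation, whose height is an integer of modulus less
    than 1. *)
Lemma same_time (h h' : Z3) : h.1.1 = h'.1.1 ->
  `|bshift omega h| < r1 -> `|bshift omega h'| < r1 ->
  `|height h| < 1 / 2 -> `|height h'| < 1 / 2 -> height h = height h'.
Proof.
move=> e s s' v v'; have r10' := r10; have r1r' := r1r; have r4' := r4.
have d0 : (h - h').1.1 = 0 by rewrite /= e subrr.
have ld : is_local omega r (h - h').
  by rewrite /is_local bshiftD bshiftN; move: s s'; rewrite !ltr_norml; lra.
have dE := local_vertical r0 r4 w0 ld d0.
have vd : height (h - h') = (h - h').2%:~R by rewrite dE /height /= !mul0r !add0r.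
have : `|(h - h').2%:~R| < 1%:~R :> R.
  by rewrite -vd heightD heightN mulr1z; move: v v'; rewrite !ltr_norml; lra.
rewrite -intr_norm ltr_int => d1.
have d2 := int_norm_lt1 d1.
by apply/eqP; rewrite -subr_eq0 -heightN -heightD vd d2.
Qed.

(** By [same_time] each time contributes at most one height of modulus below [1 / 2], and [noker]
    makes it nonzero. *)
Lemma early_values (N : nat) : exists2 e : R, 0 < e & forall h : Z3,
  0 < h.1.1 <= N%:Z -> `|bshift omega h| < r1 -> e <= `|height h|.
Proof.
elim: N => [|N [e e0 IH]]; first by exists 1 => // h /andP[h0 /(lt_le_trans h0)]; rewrite ltxx.
pose e1 := Num.min e (1 / 2).
have e10 : 0 < e1 by rewrite lt_min e0; lra.
have e1e : e1 <= e by rewrite ge_min lexx.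
have e12 : e1 <= 1 / 2 by rewrite ge_min lexx orbT.
have [[h [hN hs hv]]|no] := pselect (exists h : Z3,
    [/\ h.1.1 = N.+1%:Z, `|bshift omega h| < r1 & `|height h| < e1]).
  exists `|height h|.
    by rewrite normr_gt0 noker// hN.
  move=> h' /andP[h'0 h'N] s'.
  have [le|gt] := lerP h'.1.1 N%:Z; first by have := IH h'; rewrite h'0 le => /(_ isT s'); lra.
  rewrite leNgt; apply/negP => lt.
  have e' : h'.1.1 = h.1.1 by rewrite hN; exact: int_eq_succ.
  have := @same_time h' h e' s' hs; rewrite (lt_le_trans _ e12)// ?(lt_trans lt hv)//.
  rewrite (lt_le_trans hv e12) => /(_ isT isT) e2.
  by move: lt; rewrite e2 ltxx.
exists e1 => // h' /andP[h'0 h'N] s'.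
have [le|gt] := lerP h'.1.1 N%:Z; first by have := IH h'; rewrite h'0 le => /(_ isT s'); lra.
rewrite leNgt; apply/negP => lt; apply: no; exists h'; split=> //; exact: int_eq_succ.
Qed.

(** [n] is the first time with a height below the bound valid up to time [N]; hence it is later than
    [N], and all earlier heights are larger. *)
Lemma record_return (N : nat) : exists (n : nat) (k m : int),
  [/\ (N < n)%N, `|bshift omega (n%:Z, k, m)| < r1, 0 < `|height (n%:Z, k, m)| < 1 / 2 &
   forall h : Z3, 0 < h.1.1 < n%:Z -> `|bshift omega h| < r1 ->
     `|height (n%:Z, k, m)| < `|height h|].
Proof.
have [e e0 he] := early_values N.
pose e1 := Num.min e (1 / 2).
have e10 : 0 < e1 by rewrite lt_min e0; lra.
have e1e : e1 <= e by rewrite ge_min lexx.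
have e12 : e1 <= 1 / 2 by rewrite ge_min lexx orbT.
pose Q (n : nat) := `[< (0 < n)%N /\ exists k m : int,
  `|bshift omega (n%:Z, k, m)| < r1 /\ 0 < `|height (n%:Z, k, m)| < e1 >].
have exQ : exists n, Q n.
  have [[[n k] m] /= [n0 s v]] := small_values e10.
  exists (absz n); apply/asboolP; split; first by rewrite absz_gt0 gt_eqF.
  by exists k, m; rewrite gtz0_abs.
case: (ex_minnP exQ) => n /asboolP[n0 [k [m [s /andP[v0 v1]]]]] nmin.
exists n, k, m; split=> //.
- rewrite ltnNge; apply/negP => nN.
  have := he (n%:Z, k, m); rewrite /= ltz_nat n0 lez_nat nN => /(_ isT s); lra.
- by rewrite v0; lra.
- move=> h /andP[h0 hn] sh; apply: lt_le_trans v1 _; rewrite leNgt; apply/negP => vh.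
  have : (n <= absz h.1.1)%N.
    apply: nmin; apply/asboolP; split; first by rewrite absz_gt0 gt_eqF.
    exists h.1.2, h.2; rewrite gtz0_abs// -!surjective_pairing; split=> //.
    by rewrite vh andbT normr_gt0 noker// gt_eqF.
  by apply: absz_between; rewrite h0.
Qed.

(** With [d = h' - h], the four comparisons involve [d] twice, [d + g] and [d - g]. All have
    positive height once that of [d] exceeds the modulus of that of [g], and [2 * r1 <= r] keeps
    them local. *)
Lemma hull_separated (g h h' : Z3) t t' :
  `|bshift omega g| < r1 -> `|t - a0| < r1 / 2 -> `|t' - a0| < r1 / 2 ->
  t + bshift omega h = t' + bshift omega h' -> `|height g| < height (h' - h) ->
  Num.max (A h t (x0 + w)) (A (h - g) (t + bshift omega g) (x0 + w)) <=
  Num.min (A h' t' (x0 - w)) (A (h' - g) (t' + bshift omega g) (x0 - w)).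
Proof.
move=> sg ta t'a e; rewrite ltr_norml => /andP[v1 v2].
have r10' := r10; have r1r' := r1r.
have sd : bshift omega (h' - h) = t - t' by rewrite bshiftD bshiftN; lra.
have near_base s : `|s - a0| < r1 / 2 -> `|s - a0| < r /\ `|s + bshift omega g - a0| < r.
  by move=> sa; move: sa sg; rewrite !ltr_norml; lra.
have [t1 t2] := near_base t ta; have [t'1 t'2] := near_base t' t'a.
have base s f : s + bshift omega g + bshift omega (f - g) = s + bshift omega f.
  by rewrite bshiftD bshiftN; lra.
rewrite le_min !ge_max; apply/andP; split; apply/andP; split;
  apply: pos_separated; rewrite ?base//; apply: height_pos.
- by rewrite /is_local sd; move: ta t'a; rewrite !ltr_norml; lra.
- by lra.
- rewrite (_ : h' - (h - g) = (h' - h) + g); last by rewrite opprB addrA addrAC.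
  by rewrite /is_local bshiftD sd; move: ta t'a sg; rewrite !ltr_norml; lra.
- rewrite (_ : h' - (h - g) = (h' - h) + g); last by rewrite opprB addrA addrAC.
  by rewrite heightD; lra.
- rewrite (_ : h' - g - h = (h' - h) - g); last by rewrite addrAC.
  by rewrite /is_local !bshiftD bshiftN -bshiftN; move: sd ta t'a sg; rewrite !bshiftD !bshiftN !ltr_norml; lra.
- rewrite (_ : h' - g - h = (h' - h) - g); last by rewrite addrAC.
  by rewrite heightD heightN; lra.
- rewrite (_ : h' - g - (h - g) = h' - h); last by rewrite opprB addrA subrK.
  by rewrite /is_local sd; move: ta t'a; rewrite !ltr_norml; lra.
- rewrite (_ : h' - g - (h - g) = h' - h); last by rewrite opprB addrA subrK.
  by lra.
Qed.

Lemma variation_bound (f : R -> R) (a b x y : R) : a <= x <= b -> a <= y <= b ->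
  (`|f x - f y|%:E <= total_variation a b f)%E.
Proof.
wlog xy : x y / x <= y.
  move=> W xI yI; have [xy|/ltW yx] := leP x y; first exact: W.
  by rewrite distrC; exact: W.
move=> /andP[ax xb] /andP[ay yb]; rewrite distrC.
rewrite (total_variationD f ax xb) (total_variationD f xy yb).
apply: le_trans (total_variation_ge f xy) _.
apply: le_trans (leeDl _ (total_variation_ge0 f yb)) _.
by rewrite leeDr// total_variation_ge0.
Qed.

Let chi := bump a0 (r1 / 2).

Let chi_le1 t : chi t <= 1.
Proof.
have r10' := r10; have r1r' := r1r; have r4' := r4.
apply: le_trans (bump_le _ _ _) _; lra.
Qed.

(** Both steps start in the fibre over [t + j * omega], so this compares the logarithmic derivative
    of a single fibre map at two points. *)
Definition logstep (n j : nat) t : R :=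
  (ln (image_length (j%:Z - n%:Z + 1) (t + n%:R * omega)) -
   ln (image_length (j%:Z - n%:Z) (t + n%:R * omega))) -
  (ln (image_length (j%:Z + 1) t) - ln (image_length j%:Z t)).

Lemma bump_support (theta : R) : exists kk : nat -> int, forall j : nat,
  chi (theta - j%:R * omega) != 0 ->
  `|theta - j%:R * omega + (kk j)%:~R - a0| < r1 / 2.
Proof.
have : forall j : nat, exists k : int, chi (theta - j%:R * omega) != 0 ->
    `|theta - j%:R * omega + k%:~R - a0| < r1 / 2.
  move=> j; have [_|nz] := eqVneq (chi (theta - j%:R * omega)) 0.
    by exists 0.
  by have [k hk] := bump_neq0 nz; exists k.
by move=> /choice[f hf]; exists f.
Qed.

(** By the mean value theorem each [logstep] is a difference of values of [logD theta] on the hull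
    of two images of the box, so the variation on that hull bounds it. The closest return makes the
    hulls disjoint modulo 1. *)
Lemma variation_ge_logsteps (n : nat) (k m : int) (theta : R) :
  `|bshift omega (n%:Z, k, m)| < r1 -> 0 < `|height (n%:Z, k, m)| < 1 / 2 ->
  (forall h : Z3, 0 < h.1.1 < n%:Z -> `|bshift omega h| < r1 ->
     `|height (n%:Z, k, m)| < `|height h|) ->
  ((\sum_(j <- iota 0 n) chi (theta - j%:R * omega) *
     `|logstep n j (theta - j%:R * omega)|)%:E <= Vtheta F theta)%E.
Proof.
set g := (n%:Z, k, m) => sg /andP[vg0 vg1] record.
have [kk kkP] := bump_support theta.
pose T j : R := theta - j%:R * omega.
pose s := [seq j <- iota 0 n | chi (T j) != 0].
have sP j : j \in s -> `|T j + (kk j)%:~R - a0| < r1 / 2 /\ (j < n)%N.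
  by rewrite mem_filter mem_iota add0n => /andP[/kkP ? /andP[_ ?]].
(* The earlier image is lowered by [m], the vertical part of [g]: this is the lift to which
   [hull_separated] applies. *)
pose lo j := Num.min (A (j%:Z, 0, 0) (T j) (x0 - w))
  (A (j%:Z - n%:Z, 0, 0) (T j + n%:R * omega) (x0 - w) - m%:~R).
pose hi j := Num.max (A (j%:Z, 0, 0) (T j) (x0 + w))
  (A (j%:Z - n%:Z, 0, 0) (T j + n%:R * omega) (x0 + w) - m%:~R).
have xw : x0 - w < x0 + w by have := w0; lra.
have lohi j : lo j < hi j.
  by rewrite /lo /hi gt_min !lt_max (zact_lt zA) xw.
rewrite (bigID (fun j => chi (T j) != 0)) /= [X in _ + X]big1 ?addr0; last first.
  by move=> j /negPn/eqP; rewrite -/(T j) => ->; rewrite mul0r.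
rewrite -big_filter -/s -sumEFin.
apply: (@le_trans _ _ (\sum_(j <- s) total_variation (lo j) (hi j) (logD theta))%E).
  rewrite big_seq [leRHS]big_seq; apply: lee_sum => j js.
  rewrite -/(T j); have [c cI ec] := ln_len_step j%:Z (T j).
  have [c' cI' ec'] := ln_len_step (j%:Z - n%:Z) (T j + n%:R * omega).
  have e1 : T j + j%:Z%:~R * omega = theta by rewrite /T -pmulrn subrK.
  have e2 : T j + n%:R * omega + (j%:Z - n%:Z)%:~R * omega = theta.
    by rewrite /T intrB -!pmulrn; ring.
  have -> : logstep n j (T j) = logD theta (c' - m%:~R) - logD theta c.
    by rewrite /logstep ec ec' e1 e2 -mulrNz logD_int.
  apply: le_trans (variation_bound (logD theta) (x := c' - m%:~R) (y := c) _ _).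
  - rewrite lee_fin; apply: ler_piMl; [exact: normr_ge0|exact: chi_le1].
  - rewrite /lo /hi ge_min le_max.
    by apply/andP; split; apply/orP; right; lra.
  - rewrite /lo /hi ge_min le_max.
    by apply/andP; split; apply/orP; left; lra.
apply: total_variation_packing.
- by move=> x; rewrite -(logD_int theta x 1) mulr1z.
- exact/filter_uniq/iota_uniq.
- by move=> j _.
(* The lift of the [j]-th iterate that starts near [a0] and ends over [theta]. *)
pose hh (j : nat) (mu : int) : Z3 := (j%:Z, - kk j, mu).
have shh j mu : T j + (kk j)%:~R + bshift omega (hh j mu) = theta.
  by rewrite bshiftE /= mulrNz -pmulrn /T; ring.
have e1 j mu x : A (hh j mu) (T j + (kk j)%:~R) x = A (j%:Z, 0, 0) (T j) x + mu%:~R.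
  by rewrite zact_split zact_translate.
have e2 j mu x : A (hh j mu - g) (T j + (kk j)%:~R + bshift omega g) x =
    A (j%:Z - n%:Z, 0, 0) (T j + n%:R * omega) x - m%:~R + mu%:~R.
  rewrite -[hh j mu - g]/(j%:Z - n%:Z, - kk j - k, mu - m) zact_split bshiftE /=.
  have -> : T j + (kk j)%:~R + (n%:~R * omega + k%:~R) =
      T j + n%:R * omega + (kk j + k)%:~R.
    by rewrite intrD -pmulrn; ring.
  by rewrite zact_translate intrB; ring.
have main i j mi mj : i \in s -> j \in s -> `|height g| < height (hh j mj - hh i mi) ->
    hi i + mi%:~R <= lo j + mj%:~R.
  move=> is_ js vd; have [ti _] := sP _ is_; have [tj _] := sP _ js.
  have := hull_separated (g := g) (h := hh i mi) (h' := hh j mj) sg ti tj _ vd.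
  rewrite !shh !e1 !e2 => /(_ erefl).
  by rewrite /lo /hi addr_maxl addr_minl.
move=> i j mu is_ js ij.
(* For distinct indices the difference is a return at a time less than [n], so [record] applies. For
   equal indices it is a nonzero integer, whereas the height of [g] is below [1 / 2]. *)
have vd : `|height g| < `|height (hh j mu - hh i 0)|.
  have [ti iN] := sP _ is_; have [tj jN] := sP _ js.
  have [eij|nij] := eqVneq i j.
    move: ij; rewrite eij eqxx /= => mu0.
    have -> : height (hh j mu - hh j 0) = mu%:~R.
      by rewrite heightD heightN /height /=; ring.
    apply: lt_le_trans vg1 _; rewrite -intr_norm.
    have : 1%:~R <= `|mu|%:~R :> R by rewrite ler_int int_norm_ge1.
    by rewrite mulr1z; lra.
  have sd : `|bshift omega (hh j mu - hh i 0)| < r1.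
    have h1 := shh j mu; have h2 := shh i 0.
    rewrite bshiftD bshiftN; move: ti tj; rewrite !ltr_norml; lra.
  case: (ltngtP i j) nij => // lij _.
    by apply: record => //=; exact: int_range_sub.
  rewrite -[X in _ < X]normrN -heightN; apply: record; last by rewrite bshiftN normrN.
  by rewrite /= opprB; exact: int_range_sub.
have [v0|v0] := leP 0 (height (hh j mu - hh i 0)).
  left; rewrite -[hi i]addr0; apply: (main i j 0 mu is_ js).
  by rewrite -(ger0_norm v0).
right; rewrite -[lo i]addr0; apply: (main j i mu 0 js is_).
by rewrite -[hh i 0 - _]opprB heightN -(ltr0_norm v0).
Qed.

Lemma sum_len_le1 (N : nat) theta :
  \sum_(j <- iota 0 N) chi (theta - j%:R * omega) * image_length j%:Z (theta - j%:R * omega)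
    <= 1.
Proof.
have [kk kkP] := bump_support theta.
pose T j : R := theta - j%:R * omega.
pose s := [seq j <- iota 0 N | chi (T j) != 0].
have sP j : j \in s -> `|T j + (kk j)%:~R - a0| < r1 / 2.
  by rewrite mem_filter => /andP[/kkP].
have xw : x0 - w < x0 + w by have := w0; lra.
rewrite (bigID (fun j => chi (T j) != 0)) /= [X in _ + X]big1 ?addr0; last first.
  by move=> j /negPn/eqP; rewrite -/(T j) => ->; rewrite mul0r.
rewrite -big_filter -/s.
apply: (@le_trans _ _ (\sum_(j <- s) image_length j%:Z (T j))).
  apply: ler_sum => j _; apply: ler_piMl; [exact/ltW/len_gt0|exact: chi_le1].
apply: length_packing.
- exact/filter_uniq/iota_uniq.
- by move=> j _; rewrite (zact_lt zA).
pose hh (j : nat) (mu : int) : Z3 := (j%:Z, - kk j, mu).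
have shh j mu : T j + (kk j)%:~R + bshift omega (hh j mu) = theta.
  by rewrite bshiftE /= mulrNz -pmulrn /T; ring.
have e1 j mu x : A (hh j mu) (T j + (kk j)%:~R) x = A (j%:Z, 0, 0) (T j) x + mu%:~R.
  by rewrite zact_split zact_translate.
have r10' := r10; have r1r' := r1r.
have near_base j : j \in s -> `|T j + (kk j)%:~R - a0| < r.
  by move=> /sP; rewrite !ltr_norml; lra.
move=> i j mu is_ js ij.
have ld : is_local omega r (hh j mu - hh i 0).
  have h1 := shh j mu; have h2 := shh i 0.
  by rewrite /is_local bshiftD bshiftN; move: (sP _ is_) (sP _ js); rewrite !ltr_norml; lra.
have [d0|pd|/(neg_pos zA)] := local_trichotomy zA r0 r4 w0 wandering ld.
- move/eqP: d0; rewrite subr_eq0 => /eqP[eij _ mu0].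
  by move: ij; rewrite mu0 eij !eqxx.
- left; have := pos_separated (near_base _ is_) (near_base _ js) _ pd.
  by rewrite !shh !e1 addr0 => /(_ erefl).
- rewrite opprB => pd; right.
  have := pos_separated (near_base _ js) (near_base _ is_) _ pd.
  by rewrite !shh !e1 addr0 => /(_ erefl).
Qed.

Let chi_cont : continuous chi.
Proof. exact: bump_continuous. Qed.

Let chi_periodic t : chi (t + 1) = chi t.
Proof. exact: bump_periodic. Qed.

Let len_periodic i t : image_length i (t + 1) = image_length i t.
Proof. by rewrite /image_length !zact_periodic. Qed.

Let cM (f g : R -> R) : continuous f -> continuous g -> continuous (fun t => f t * g t).
Proof. by move=> cf cg t; apply: continuousM; [exact: cf|exact: cg]. Qed.

Let rotated_sum (f : nat -> R -> R) (n : nat) : (forall j, continuous (f j)) ->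
  (forall j t, f j (t + 1) = f j t) ->
  I01 (fun t => \sum_(j <- iota 0 n) f j (t - j%:R * omega)) =
  \sum_(j <- iota 0 n) I01 (f j).
Proof.
move=> cf pf; rewrite I01_sum; last by move=> j; exact: continuous_translate.
by apply: eq_bigr => j _; exact: I01_shift.
Qed.

Let chi_len_cont (j : nat) : continuous (fun t => chi t * image_length j%:Z t).
Proof. by apply: cM => //; exact: len_continuous. Qed.

(** By rotation invariance and [sum_len_le1], these nonnegative integrals have partial sums at most
    1. *)
Lemma average_len_small c : 0 < c -> exists N : nat, forall n : nat, (N <= n)%N ->
  I01 (fun t => chi t * image_length n%:Z t) < c.
Proof.
move=> c0; apply: contrapT => no.
pose a (n : nat) := I01 (fun t => chi t * image_length n%:Z t).
have a0' n : 0 <= a n.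
  rewrite -(I01_cst 0); apply: le_I01 => // [|t]; first exact: cst_continuous.
  by rewrite mulr_ge0 ?bump_ge0// ltW// len_gt0.
have sa N : \sum_(j <- iota 0 N) a j <= 1.
  rewrite -rotated_sum => [|//|j t]; last by rewrite chi_periodic len_periodic.
  rewrite -[leRHS](I01_cst 1); apply: le_I01.
  - by apply: continuous_sum_seq => j; exact: (@continuous_translate _ _ (- (j%:R * omega)) (@chi_len_cont j)).
  - exact: cst_continuous.
  - exact: sum_len_le1.
have big K : exists N, K%:R * c <= \sum_(j <- iota 0 N) a j.
  elim: K => [|K [N hN]]; first by exists 0%N; rewrite mul0r big_nil.
  have [n Nn cn] : exists2 n, (N <= n)%N & c <= a n.
    apply: contrapT => nn; apply: no; exists N => n Nn; rewrite ltNge; apply/negP => cn.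
    by apply: nn; exists n.
  exists (n + 1)%N; rewrite iotaD big_cat big_seq1 add0n -natr1 mulrDl mul1r.
  apply: lerD => //; apply: le_trans hN _.
  rewrite -(subnKC Nn) iotaD big_cat /= lerDl; exact: sumr_ge0.
have [N hN] := big (Num.truncn c^-1).+1.
have := le_trans hN (sa N).
have : c^-1 < (Num.truncn c^-1).+1%:R by exact: truncnS_gt.
by rewrite -(ltr_pM2r c0) mulVf ?gt_eqF//; lra.
Qed.

Let lnlen_cont i : continuous (fun t => ln (image_length i t)).
Proof.
move=> t; apply: (@continuous_comp _ _ _ (image_length i) (@ln R)); first exact: len_continuous.
by apply: continuous_ln; exact: len_gt0.
Qed.

Let logstep_cont n j : continuous (logstep n j).
Proof.
have cB (f g : R -> R) : continuous f -> continuous g -> continuous (fun t => f t - g t).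
  by move=> cf cg t; apply: continuousB; [exact: cf|exact: cg].
have ct i : continuous (fun t => ln (image_length i (t + n%:R * omega))).
  exact: (@continuous_translate _ _ (n%:R * omega) (@lnlen_cont i)).
by apply: (cB); apply: (cB).
Qed.

Lemma sum_logstep n t :
  \sum_(j <- iota 0 n) logstep n j t =
  2 * ln (2 * w) - ln (image_length (- n%:Z) (t + n%:R * omega)) - ln (image_length n%:Z t).
Proof.
pose a (j : nat) := ln (image_length (j%:Z - n%:Z) (t + n%:R * omega)) - ln (image_length j%:Z t).
have len0 s : image_length 0 s = 2 * w.
  by rewrite /image_length !(zact0 zA); ring.
transitivity (\sum_(0 <= j < n) (a j.+1 - a j)).
  rewrite /index_iota subn0; apply: eq_bigr => j _.
  have e : j.+1%:Z = j%:Z + 1 by rewrite -addn1 PoszD.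
  have e' : j%:Z + 1 - n%:Z = j%:Z - n%:Z + 1 by rewrite addrAC.
  by rewrite /a /logstep e e'; ring.
by rewrite telescope_sumr// /a subrr sub0r !len0; ring.
Qed.

(** Only the weighted average of the lengths is known to tend to 0. The concave logarithm is
    therefore bounded by its tangent at [c], [ln y <= ln c + y / c - 1], which can be integrated. *)
Lemma denjoy_contradiction : False.
Proof.
have chi0 : 0 < I01 chi by apply: bump_I01; have := r10; lra.
set K := I01 chi in chi0.
have [_ [_ _ Vfin]] := TBV.
have V0 t : (0 <= Vtheta F t)%E by exact: total_variation_ge0.
set V := (\int[_]_(_ in _) _)%E in Vfin.
have V0' : (0 <= V)%E by apply: integral_ge0 => t _.
have [v vE] : exists v : R, V = v%:E.
  by exists (fine V); rewrite fineK// ge0_fin_numE.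
(* Chosen so that [K * (2 * ln (2 * w) - ln c + 1) = v + 2 * K]: one [K] absorbs the length term,
   the other exceeds the bound [v]. *)
pose c := expR (2 * ln (2 * w) - v / K - 1).
have c0 : 0 < c by exact: expR_gt0.
have [N hN] := average_len_small (mulr_gt0 c0 chi0).
have [n [k [m [Nn sg vg record]]]] := record_return N.
pose f j t := chi t * `|logstep n j t|.
have cf j : continuous (f j).
  apply: cM => // t; apply: (@continuous_comp _ _ _ (logstep n j) Num.norm).
    exact: logstep_cont.
  exact: norm_continuous.
have pf j t : f j (t + 1) = f j t.
  by rewrite /f /logstep chi_periodic ![t + 1 + _]addrAC !len_periodic.
have f0 j t : 0 <= f j t by rewrite mulr_ge0 ?bump_ge0.
have upper : \sum_(j <- iota 0 n) I01 (f j) <= v.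
  rewrite -rotated_sum// -lee_fin -vE.
  apply: I01_le_integral => //.
  - by apply: continuous_sum_seq => j; exact: (@continuous_translate _ _ (- (j%:R * omega)) (cf j)).
  - by move=> t; exact: sumr_ge0.
  - by move=> t; have := variation_ge_logsteps t sg vg record.
have lower : K * (2 * ln (2 * w) - ln c + 1)
    - c^-1 * I01 (fun t => chi t * image_length n%:Z t) <= \sum_(j <- iota 0 n) I01 (f j).
  rewrite -I01_sum// mulrC -I01Z// -mulNr -I01Z// -I01D; last 2 first.
  - by apply: cM => //; exact: cst_continuous.
  - by apply: cM => //; exact: cst_continuous.
  apply: le_I01.
  - have cD (g h : R -> R) : continuous g -> continuous h -> continuous (fun t => g t + h t).
      by move=> cg ch t; apply: continuousD; [exact: cg|exact: ch].
    by apply: cD; apply: cM => //; exact: cst_continuous.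
  - exact: continuous_sum_seq.
  move=> t.
  apply: (@le_trans _ _ (chi t * \sum_(j <- iota 0 n) logstep n j t)); last first.
    rewrite mulr_sumr; apply: ler_sum => j _.
    by rewrite ler_wpM2l ?bump_ge0// ler_norm.
  rewrite sum_logstep.
  rewrite [leLHS](_ : _ = chi t * (2 * ln (2 * w) - ln c + 1 - c^-1 * image_length n%:Z t)); last by ring.
  rewrite ler_wpM2l ?bump_ge0//.
  have l1 : ln (image_length (- n%:Z) (t + n%:R * omega)) <= 0.
    by rewrite ln_le0// len_le1.
  have l2 : ln (image_length n%:Z t) <= ln c + (c^-1 * image_length n%:Z t - 1).
    have y0 := len_gt0 n%:Z t.
    have q0 : 0 < c^-1 * image_length n%:Z t by rewrite mulr_gt0// invr_gt0.
    have -> : ln (image_length n%:Z t) = ln c + ln (c^-1 * image_length n%:Z t).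
      by rewrite -lnM ?posrE// mulVKf// gt_eqF.
    rewrite lerD2l; have := le_ln1Dx (x := c^-1 * image_length n%:Z t - 1).
    by rewrite [1 + _]addrC subrK; apply; lra.
  lra.
have sm := hN n (ltnW Nn).
have : c^-1 * I01 (fun t => chi t * image_length n%:Z t) < K.
  by rewrite mulrC ltr_pdivrMr// mulrC.
have : K * (2 * ln (2 * w) - ln c + 1) = v + 2 * K.
  by rewrite /c expRK; field; rewrite gt_eqF.
lra.
Qed.

End Denjoy.

(** * Returns of boxes *)

Section BoxReturn.
Variables (R : realType) (omega : R) (F : R -> R -> R).
Hypothesis irr : @irrational R omega.
Hypothesis TBV : in_T_BV F.
Hypothesis no_tube : no_regular_invariant_graph (skewT omega F).
Let A := skew_action omega F.
Let zA : zaction omega A := skew_zaction omega TBV.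

Definition minor (g h : Z3) : int := g.1.1 * h.1.2 - g.1.2 * h.1.1.

Lemma bshift_neq0 (h : Z3) : h.1.1 != 0 -> bshift omega h != 0.
Proof.
move=> h0; apply/eqP; rewrite bshiftE => /(rotation_free irr) e.
by rewrite e eqxx in h0.
Qed.

(* Two vectors of Z^2 with zero minor have proportional shifts, the factor
   having denominator at most |g.1.1|. *)
Lemma minor_neq0 (g h : Z3) : g.1.1 != 0 -> h.1.1 != 0 ->
  `|bshift omega h| < `|bshift omega g| / `|g.1.1%:~R| -> minor g h != 0.
Proof.
move=> g0 h0 lt; apply/eqP => m0.
have g0' : 0 < `|g.1.1%:~R| :> R by rewrite normr_gt0 intr_eq0.
have e : bshift omega h * g.1.1%:~R = bshift omega g * h.1.1%:~R.
  have m0' : g.1.1%:~R * h.1.2%:~R - g.1.2%:~R * h.1.1%:~R = 0 :> R.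
    by rewrite -!intrM -intrB -/(minor g h) m0.
  by rewrite !bshiftE; lra.
have : `|bshift omega h| * `|g.1.1%:~R| < `|bshift omega g|.
  by rewrite -ltr_pdivlMr.
rewrite -normrM e normrM gtr_pMr ?normr_gt0 ?bshift_neq0// -intr_norm ltNge.
have h1 : 1 <= `|h.1.1| by exact: int_norm_ge1.
by rewrite -[1]/(1%:~R) ler_int h1.
Qed.

(* The functional is the determinant against two elements of its kernel. *)
Lemma no_bounded_kernel (g g' : Z3) (S : set (R * R)) : 0 < minor g g' ->
  eopen S -> S !=set0 -> (forall t x y, S (t, x) -> x <= y -> S (t, y)) ->
  ~ (forall t0, exists (r B : R), 0 < r /\
     forall h z, 0 <= psi (g.1.2 * g'.2 - g.2 * g'.1.2)
                          (g.2 * g'.1.1 - g.1.1 * g'.2) (minor g g') h ->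
       S z -> `|(act omega A h z).1 - t0| < r -> B <= (act omega A h z).2).
Proof.
move=> D0 oS S0 upS lbS.
have [p [q [U1 [p0 q0 tub]]]] :=
  tube_of_bounded irr zA (iter_skewT omega TBV) D0 oS S0 upS lbS.
exact: (no_tube p0 q0 tub).
Qed.

Section Wandering.
Variables (a0 r x0 w : R).
Hypotheses (r0 : 0 < r) (r4 : 4 * r <= 1) (w0 : 0 < w) (w2 : 2 * w <= 1).
Hypothesis wandering : forall (h : Z3) t x, h.1.1 != 0 ->
  `|t - a0| < r -> `|x - x0| < w -> `|t + bshift omega h - a0| < r ->
  `|A h t x - x0| < w -> False.
Variables rho kappa : R.
Hypothesis height_ge0 : forall h, moves_up omega A a0 r x0 h -> 0 <= height rho kappa h.

Let S : set (R * R) := [set z | `|z.1 - a0| < r /\ x0 < z.2].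

Let oS : eopen S.
Proof.
move=> z [z1 z2].
exists (Num.min (r - `|z.1 - a0|) (z.2 - x0)).
  by rewrite lt_min !subr_gt0 z1.
move=> v; rewrite !lt_min => /andP[v1 _] /andP[_ v2]; split.
  have -> : v.1 - a0 = (v.1 - z.1) + (z.1 - a0) by ring.
  by apply: le_lt_trans (ler_normD _ _) _; lra.
by move: v2; rewrite ltr_norml; lra.
Qed.

(** A fixed [g] carries the base arc close to [t0]. For every [h] of nonnegative height that lands
    near [t0], [h - g] raised by the constant [M] is local of positive height, so it moves up. The
    image of [S] then stays above the image of the centre line under [g], lowered by [M]. *)
Let lower_bound (t0 : R) : exists (e B : R), 0 < e /\
  forall h z, 0 <= height rho kappa h -> S z ->
    `|(act omega A h z).1 - t0| < e -> B <= (act omega A h z).2.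
Proof.
have r2 : 0 < r / 2 by have := r0; lra.
have [n [k hnk]] := rotation_dense irr (t0 - a0) r2.
pose g : Z3 := (n, k, 0).
have gE : bshift omega g = n%:~R * omega + k%:~R by rewrite bshiftE.
have [e e0 he] := zact_cont zA g (t0 - bshift omega g) x0 (@ltr01 R).
pose M := Num.floor (height rho kappa g) + 1.
have MP : height rho kappa g < M%:~R by exact: floorD1_gt.
exists (Num.min (r / 2) e), (A g (t0 - bshift omega g) x0 - 1 - M%:~R).
split; first by rewrite lt_min r2.
move=> h [t x] vh [/= ta x0x]; rewrite lt_min => /andP[h1 h2].
apply: ltW; apply: lt_trans (zact_incr zA h t x0x).
pose d := (0, 0, M) + (h - g) : Z3.
have sd : bshift omega d = bshift omega h - bshift omega g.
  by rewrite /d !bshiftD bshiftN bshiftE /= mul0r !add0r.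
have tg : `|t + bshift omega d - a0| < r.
  by move: h1 hnk; rewrite sd gE !ltr_norml; lra.
have ld : is_local omega r d.
  by rewrite /is_local; move: ta tg; rewrite !ltr_norml; lra.
have vd : 0 < height rho kappa d.
  have -> : height rho kappa d = M%:~R + height rho kappa h - height rho kappa g.
    by rewrite /d !heightD heightN /height /= !mul0r !add0r addrA.
  lra.
have [_ /(_ t ta tg) pd] := height_pos TBV r0 r4 w0 wandering height_ge0 ld vd.
have hE : h = (0, 0, - M) + (g + d).
  have -> : g + d = (0, 0, M) + h by rewrite /d addrCA [g + _]addrC subrK.
  rewrite addrA.
  by rewrite -[(0, 0, - M) + _]/(0 + 0, 0 + 0, - M + M) addNr !addr0 add0r.
rewrite hE (zactD zA) (zact_deck zA) (zactD zA) mulrNz.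
have e1 : t + bshift omega d = t + bshift omega h - bshift omega g.
  by rewrite sd addrA.
have g1 : A g (t + bshift omega d) x0 < A g (t + bshift omega d) (A d t x0).
  by rewrite (zact_lt zA).
have := he (t + bshift omega d) x0; rewrite subrr normr0 => /(_ _ e0) g2.
have : `|t + bshift omega d - (t0 - bshift omega g)| < e.
  by rewrite e1; move: h2; rewrite !ltr_norml; lra.
by move=> /g2; rewrite ltr_norml; lra.
Qed.

(* Either the functional has no small kernel and the Denjoy argument applies,
   or its kernel has rank two and the orbit of the box bounds a tube. *)
Lemma wandering_contradiction : False.
Proof.
have r10 : 0 < r / 2 by have := r0; lra.
have [[r1 [r1p r1r noker]]|ker] := pselect (exists r1, [/\ 0 < r1, 2 * r1 <= r &
    forall h : Z3, h.1.1 != 0 -> `|bshift omega h| < r1 -> height rho kappa h != 0]).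
  exact: (denjoy_contradiction irr TBV r0 r4 w0 w2 wandering height_ge0 r1p r1r noker).
have small e : 0 < e -> exists h : Z3,
    [/\ h.1.1 != 0, `|bshift omega h| < e & height rho kappa h = 0].
  move=> e0; apply: contrapT => no; apply: ker; exists (Num.min e (r / 2)).
  split; first by rewrite lt_min e0.
    have : Num.min e (r / 2) <= r / 2 by rewrite ge_min lexx orbT.
    lra.
  move=> h h0; rewrite lt_min => /andP[he _]; apply/eqP => v0.
  by apply: no; exists h.
have [g [g0 sg vg]] := small _ r10.
(* The bound on the shift is the one under which [minor_neq0] gives independence of [g]. *)
have [g' [g'0 sg' vg']] : exists g' : Z3, [/\ g'.1.1 != 0,
    `|bshift omega g'| < `|bshift omega g| / `|g.1.1%:~R| & height rho kappa g' = 0].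
  by apply: small; rewrite divr_gt0// normr_gt0 ?bshift_neq0// intr_eq0.
have S0 : S !=set0.
  by exists (a0, x0 + 1); split=> /=; rewrite ?subrr ?normr0// ltrDl.
have upS t x y : S (t, x) -> x <= y -> S (t, y).
  by move=> [/= ta xx] xy; split=> //=; exact: lt_le_trans xy.
have main (g1 g2 : Z3) : height rho kappa g1 = 0 -> height rho kappa g2 = 0 ->
    0 < minor g1 g2 -> False.
  move=> v1 v2 m0; apply: (no_bounded_kernel m0 oS S0 upS) => t0.
  have [e [B [e0 hB]]] := lower_bound t0; exists e, B; split=> // h z ph.
  apply: hB; have m0' : 0 < (minor g1 g2)%:~R :> R by rewrite ltr0z.
  rewrite -(pmulr_rge0 _ m0').
  suff -> : (minor g1 g2)%:~R * height rho kappa h =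
     (psi (g1.1.2 * g2.2 - g1.2 * g2.1.2) (g1.2 * g2.1.1 - g1.1.1 * g2.2)
        (minor g1 g2) h)%:~R by rewrite ler0z.
  move: v1 v2; rewrite /psi /height /minor !(intrD, intrM, mulrNz) => v1 v2.
  have w1 : g1.2%:~R = - (g1.1.1%:~R * rho + g1.1.2%:~R * kappa) by lra.
  have w2' : g2.2%:~R = - (g2.1.1%:~R * rho + g2.1.2%:~R * kappa) by lra.
  by rewrite w1 w2'; ring.
have := minor_neq0 g0 g'0 sg'; case: (ltrgtP (minor g g') 0) => // mg _.
  have mN : minor g' g = - minor g g' by rewrite /minor; ring.
  by apply: (main g' g) => //; rewrite mN oppr_gt0.
exact: (main g g').
Qed.

End Wandering.

Theorem box_return (a0 r x0 w : R) : 0 < r -> 0 < w ->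
  exists (h : Z3) t x, [/\ h.1.1 != 0, `|t - a0| < r, `|x - x0| < w,
    `|t + bshift omega h - a0| < r & `|A h t x - x0| < w].
Proof.
move=> r0 w0; apply: contrapT => no.
pose r' := Num.min r (1 / 4); pose w' := Num.min w (1 / 2).
have r'0 : 0 < r' by rewrite lt_min r0; lra.
have w'0 : 0 < w' by rewrite lt_min w0; lra.
have r'r : r' <= r by rewrite ge_min lexx.
have w'w : w' <= w by rewrite ge_min lexx.
have r'4 : 4 * r' <= 1.
  have : r' <= 1 / 4 by rewrite ge_min lexx orbT.
  lra.
have w'2 : 2 * w' <= 1.
  have : w' <= 1 / 2 by rewrite ge_min lexx orbT.
  lra.
have wandering (h : Z3) t x : h.1.1 != 0 ->
  `|t - a0| < r' -> `|x - x0| < w' -> `|t + bshift omega h - a0| < r' ->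
  `|A h t x - x0| < w' -> False.
  by move=> h0 h1 h2 h3 h4; apply: no; exists h, t, x; split=> //; lra.
have [rho [kappa P]] := local_functional irr zA r'0 r'4 w'0 wandering.
exact: (wandering_contradiction r'0 r'4 w'0 w'2 wandering P).
Qed.

End BoxReturn.

(** * Chains of graphs in the complement of a component *)

Section EuclideanOpen.
Variable R : realType.
Implicit Types U V : set (R * R).

Lemma eopenI U V : eopen U -> eopen V -> eopen (U `&` V).
Proof.
move=> oU oV z [/oU[e e0 he] /oV[d d0 hd]].
exists (Num.min e d); first by rewrite lt_min e0.
by move=> w; rewrite !lt_min => /andP[? ?] /andP[? ?]; split; [exact: he|exact: hd].
Qed.

Lemma eopenU U V : eopen U -> eopen V -> eopen (U `|` V).
Proof.
move=> oU oV z [/oU|/oV] [e e0 he]; exists e => // w w1 w2;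
  by [left; exact: he|right; exact: he].
Qed.

Lemma eopen_exists (I : Type) (U : I -> set (R * R)) :
  (forall i, eopen (U i)) -> eopen [set z | exists i, U i z].
Proof.
move=> oU z [i /oU[e e0 he]]; exists e => // w w1 w2; exists i; exact: he.
Qed.

Lemma eopen_forall (n : nat) (U : nat -> set (R * R)) :
  (forall l, (l <= n)%N -> eopen (U l)) ->
  eopen [set z | forall l, (l <= n)%N -> U l z].
Proof.
elim: n => [|n IH] oU z Uz.
  have [e e0 he] := oU 0%N (leqnn _) z (Uz 0%N (leqnn _)).
  by exists e => // w w1 w2 l; rewrite leqn0 => /eqP ->; exact: he.
have [e e0 he] := oU n.+1 (leqnn _) z (Uz _ (leqnn _)).
have oU' l : (l <= n)%N -> eopen (U l) by move=> ln; apply: oU; exact: leqW.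
have Uz' l : (l <= n)%N -> U l z by move=> ln; apply: Uz; exact: leqW.
have [d d0 hd] := IH oU' z Uz'.
exists (Num.min e d); first by rewrite lt_min e0.
move=> w; rewrite !lt_min => /andP[w1 w1'] /andP[w2 w2'] l.
rewrite leq_eqVlt => /orP[/eqP ->|]; first exact: he.
by rewrite ltnS; exact: hd.
Qed.

Lemma eopen_translate U (a b : R) : eopen U -> eopen [set z | U (z.1 + a, z.2 + b)].
Proof.
move=> oU z /oU[e e0 he]; exists e => // w w1 w2; apply: he => /=.
  by rewrite opprD addrACA subrr addr0.
by rewrite opprD addrACA subrr addr0.
Qed.

Lemma eopen_base_lt (c : R) : eopen [set z | z.1 < c].
Proof.
move=> z zc; exists (c - z.1); first by rewrite subr_gt0.
by move=> w; rewrite ltr_norml /= => *; lra.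
Qed.

Lemma eopen_base_gt (c : R) : eopen [set z | c < z.1].
Proof.
move=> z zc; exists (z.1 - c); first by rewrite subr_gt0.
by move=> w; rewrite ltr_norml /= => *; lra.
Qed.

Lemma eopen_above (f : R -> R) : cont1 f -> eopen [set z | f z.1 < z.2].
Proof.
move=> cf z /= fz; have e0 : 0 < (z.2 - f z.1) / 2 by lra.
have [d d0 hd] := cf z.1 _ e0.
exists (Num.min d ((z.2 - f z.1) / 2)); first by rewrite lt_min d0.
move=> w; rewrite !lt_min => /andP[/hd + _] /andP[_ +].
by rewrite !ltr_norml /=; lra.
Qed.

Lemma eopen_below (f : R -> R) : cont1 f -> eopen [set z | z.2 < f z.1].
Proof.
move=> cf z /= fz; have e0 : 0 < (f z.1 - z.2) / 2 by lra.
have [d d0 hd] := cf z.1 _ e0.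
exists (Num.min d ((f z.1 - z.2) / 2)); first by rewrite lt_min d0.
move=> w; rewrite !lt_min => /andP[/hd + _] /andP[_ +].
by rewrite !ltr_norml /=; lra.
Qed.

Definition between (a b x : R) := Num.min a b <= x <= Num.max a b.

Lemma between_split a b c x : between a c x -> between a b x \/ between b c x.
Proof.
rewrite /between !ge_min !le_max.
by case: (ltrgtP a x); case: (ltrgtP b x); case: (ltrgtP c x) => //= *;
  (left; exact: isT) || (right; exact: isT).
Qed.

Lemma between_near (a b x y e : R) : `|a - y| < e -> `|b - y| < e ->
  between a b x -> `|x - y| < e.
Proof. by rewrite /between; case: (leP a b) => _; rewrite !ltr_norml; lra. Qed.

Section GraphChain.
Variables (M C : set (R * R)) (z1 z2 : R * R) (t2 e : R) (j : int).
Variables (N : nat) (f : nat -> R -> R) (c1 c2 : nat -> R).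
Let t1 := z1.1.
Hypotheses (CM : C `<=` M) (conC : tconnected C) (Cz1 : C z1) (Cz2 : C z2).
Hypotheses (z2E : z2.1 + j%:~R = t2) (t12 : t1 < t2 < t1 + 1) (e0 : 0 < e).
Hypothesis M_deck : forall z (k m : int), M z -> M (z.1 + k%:~R, z.2 + m%:~R).
Hypothesis cf : forall i, cont1 (f i).
Hypothesis fM : forall i t, ~ M (t, f i t).
Hypothesis c1P : forall i, (i < N)%N -> t1 + e <= c1 i < t2 /\
  forall x, between (f i (c1 i)) (f i.+1 (c1 i)) x -> ~ M (c1 i, x).
Hypothesis c2P : forall i, (i < N)%N -> t2 < c2 i <= t1 + 1 - e /\
  forall x, between (f i (c2 i)) (f i.+1 (c2 i)) x -> ~ M (c2 i, x).
Hypothesis climb : forall t, f 0%N t + 1 <= f N t.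

(** The graphs of the chain may cross, so the layer of a point is determined by the first graph
    above it. This makes the label unique. *)
Let first i := [set z : R * R | [/\ (forall l, (l <= i)%N -> f l z.1 < z.2),
  z.2 < f i.+1 z.1, z.2 < f 0%N z.1 + 1 & t1 < z.1 < t1 + 1]].

Let first_open i : eopen (first i).
Proof.
have -> : first i = [set z | forall l, (l <= i)%N -> f l z.1 < z.2] `&`
   ([set z | z.2 < f i.+1 z.1] `&` ([set z | z.2 < f 0%N z.1 + 1] `&`
   ([set z | t1 < z.1] `&` [set z | z.1 < t1 + 1]))).
  apply/seteqP; split=> z /=.
    by move=> [? ? ? /andP[? ?]].
  by move=> [? [? [? [? ?]]]]; split=> //; apply/andP.
apply: eopenI; first by apply: eopen_forall => l _; exact: eopen_above.
apply: eopenI; first exact: eopen_below.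
apply: eopenI.
  apply: (@eopen_below (fun t => f 0%N t + 1)) => t d d0.
  have [b b0 hb] := cf 0%N t d0; exists b => // y /hb.
  by rewrite opprD addrACA subrr addr0.
by apply: eopenI; [exact: eopen_base_gt|exact: eopen_base_lt].
Qed.

Let first_uniq i i' z : first i z -> first i' z -> i = i'.
Proof.
have key a b : first a z -> first b z -> (a < b)%N -> False.
  move=> [_ za _ _] [zb _ _ _] /zb; move: za; lra.
by move=> h h'; case: (ltngtP i i') => // lt; [case: (key i i')|case: (key i' i)].
Qed.

Let first_exists z : M z -> t1 < z.1 < t1 + 1 -> f 0%N z.1 < z.2 < f 0%N z.1 + 1 ->
  exists2 i, (i < N)%N & first i z.
Proof.
move=> Mz zt /andP[z0 z0'].
have exl : exists l, z.2 < f l z.1 by exists N; exact: lt_le_trans z0' (climb _).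
case: (ex_minnP exl) => l zl lmin.
have l0 : (0 < l)%N by case: l zl {lmin} => // zl; move: z0 zl; lra.
have lN : (l <= N)%N by apply: lmin; exact: lt_le_trans z0' (climb _).
exists l.-1; first by rewrite prednK.
split=> //; last by rewrite prednK.
move=> i il; have il' : (i < l)%N by rewrite -(prednK l0) ltnS.
rewrite ltNge; apply/negP; rewrite le_eqVlt => /orP[/eqP ez|/lmin].
  by apply: (@fM i z.1); rewrite -ez -surjective_pairing.
by rewrite leqNgt il'.
Qed.

(** In each layer, the part between its two touching fibres; [t2] lies between them for every
    layer. *)
Let In := [set w : R * R | exists k m : int, exists i, first i (w.1 + k%:~R, w.2 + m%:~R) /\
  ((i < N)%N /\ c1 i < w.1 + k%:~R < c2 i)].

(** The strip around [t1] joins the two ends of the fundamental domain, which the layers omit. The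
    margins [e] in [c1P] and [c2P] keep it away from [In]. *)
Let Out := [set w : R * R | (exists k m : int, exists i,
  first i (w.1 + k%:~R, w.2 + m%:~R) /\
  ((i < N)%N /\ (w.1 + k%:~R < c1 i \/ c2 i < w.1 + k%:~R))) \/
  exists k : int, t1 - e < w.1 + k%:~R < t1 + e].

Let In_open : topen In.
Proof.
apply: eopen_topen.
  apply: eopen_exists => k; apply: eopen_exists => m; apply: eopen_exists => i.
  apply: (@eopen_translate [set z | first i z /\ ((i < N)%N /\ c1 i < z.1 < c2 i)]).
  move=> z [/first_open [d d0 hd] [iN /andP[zc1 zc2]]].
  have [b b0 hb] := eopenI (@eopen_base_gt (c1 i)) (@eopen_base_lt (c2 i))
    (conj zc1 zc2).
  exists (Num.min d b); first by rewrite lt_min d0.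
  move=> w; rewrite !lt_min => /andP[w1 w1'] /andP[w2 w2'].
  split; first exact: hd.
  by split=> //; have [/= -> ->] := hb w w1' w2'.
move=> z k m [k' [m' [i hi]]]; exists (k' - k), (m' - m), i => /=.
by rewrite !intrB addrACA subrr addr0 [_ + (_ - _)]addrACA subrr addr0.
Qed.

Let Out_open : topen Out.
Proof.
apply: eopen_topen.
  apply: eopenU; last first.
    apply: eopen_exists => k.
    have := @eopen_translate _ k%:~R 0
      (eopenI (@eopen_base_gt (t1 - e)) (@eopen_base_lt (t1 + e))).
    by move=> h z /andP[h1 h2]; have [d d0 hd] := h z (conj h1 h2);
       exists d => // w w1 w2; have [/= -> ->] := hd w w1 w2.
  apply: eopen_exists => k; apply: eopen_exists => m; apply: eopen_exists => i.
  apply: (@eopen_translate [set z | first i z /\ ((i < N)%N /\ (z.1 < c1 i \/ c2 i < z.1))]).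
  move=> z [/first_open [d d0 hd] [iN zc]].
  have [b b0 hb] := eopenU (@eopen_base_lt (c1 i)) (@eopen_base_gt (c2 i)) zc.
  exists (Num.min d b); first by rewrite lt_min d0.
  move=> w; rewrite !lt_min => /andP[w1 w1'] /andP[w2 w2'].
  split; first exact: hd.
  by split=> //; exact: hb w w1' w2'.
move=> z k m [[k' [m' [i hi]]]|[k' hk]]; [left|right].
  exists (k' - k), (m' - m), i => /=.
  by rewrite !intrB addrACA subrr addr0 [_ + (_ - _)]addrACA subrr addr0.
by exists (k' - k) => /=; rewrite !intrB addrACA subrr addr0.
Qed.

Let normalise (t x : R) : exists m : int, f 0%N t <= x + m%:~R < f 0%N t + 1.
Proof.
exists (- Num.floor (x - f 0%N t)); rewrite mulrNz.
have := floor_le (x - f 0%N t); have := floorD1_gt (x - f 0%N t).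
by rewrite intrD; lra.
Qed.

Let cover : M `<=` In `|` Out.
Proof.
move=> w Mw.
pose k := - Num.floor (w.1 - t1).
have k1 : t1 <= w.1 + k%:~R < t1 + 1.
  rewrite /k mulrNz; have := floor_le (w.1 - t1); have := floorD1_gt (w.1 - t1).
  by rewrite intrD; lra.
have [ek|nk] := eqVneq (w.1 + k%:~R) t1.
  by right; right; exists k; rewrite ek; have := e0; lra.
have kt : t1 < w.1 + k%:~R < t1 + 1.
  by move: k1; rewrite le_eqVlt eq_sym (negbTE nk).
have [m hm] := normalise (w.1 + k%:~R) w.2.
have Mz := M_deck k m Mw; set z := (_, _) in Mz.
have z0 : f 0%N z.1 < z.2 < f 0%N z.1 + 1.
  move: hm => /andP[]; rewrite le_eqVlt => /orP[/eqP fe|-> -> //] _.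
  by case: (@fM 0%N z.1); rewrite fe.
have [i iN fi] := first_exists Mz kt z0.
have [fl fi1 _ _] := fi.
(* Over a touching fibre, a point of layer [i] would lie on the arc between the two graphs, which
   avoids [M]. *)
have nc c : (forall x, between (f i c) (f i.+1 c) x -> ~ M (c, x)) -> z.1 <> c.
  move=> hc zc; apply: (hc z.2); last by rewrite -zc -surjective_pairing.
  rewrite /between -zc; have := fl i (leqnn _) => h1.
  by rewrite ge_min le_max (ltW h1) (ltW fi1) orbT.
have n1 := nc _ (c1P iN).2; have n2 := nc _ (c2P iN).2.
case: (ltrgtP z.1 (c1 i)) => // h1.
  by right; left; exists k, m, i; split=> //; split=> //; left.
case: (ltrgtP z.1 (c2 i)) => // h2.
  by left; exists k, m, i; split=> //; split=> //; rewrite h1.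
by right; left; exists k, m, i; split=> //; split=> //; right.
Qed.

Let disjoint w : In w -> Out w -> False.
Proof.
move=> [k [m [i [fi [iN ci]]]]] [[k' [m' [i' [fi' [_ ci']]]]]|[k' hk']].
  have kk : k = k'.
    have [_ _ _ /= h] := fi; have [_ _ _ /= h'] := fi'.
    have : `|(k - k')%:~R| < 1%:~R :> R by rewrite intrB mulr1z ltr_norml; lra.
    by rewrite -intr_norm ltr_int => /int_norm_lt1 /eqP; rewrite subr_eq0 => /eqP.
  subst k'.
  have mm : m = m'.
    have [/= h0 _ h1 _] := fi; have [/= h0' _ h1' _] := fi'.
    have := h0 0%N isT; have := h0' 0%N isT => g g'.
    have : `|(m - m')%:~R| < 1%:~R :> R by rewrite intrB mulr1z ltr_norml; lra.
    by rewrite -intr_norm ltr_int => /int_norm_lt1 /eqP; rewrite subr_eq0 => /eqP.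
  subst m'; have ii := first_uniq fi fi'; subst i'.
  by case: ci' => h; move: ci; lra.
have [h1 _] := c1P iN; have [h2 _] := c2P iN.
have : `|(k - k')%:~R| < 1%:~R :> R.
  by rewrite intrB mulr1z ltr_norml; lra.
rewrite -intr_norm ltr_int => /int_norm_lt1 /eqP; rewrite subr_eq0 => /eqP kk.
by subst k'; lra.
Qed.

(* The points of M lying between consecutive graphs of the chain are labelled
   according to the side of the touching fibres; the labels separate C. *)
Lemma graph_chain_separates : False.
Proof.
have dis : C `&` In `&` Out = set0.
  by apply/seteqP; split=> // w [[_ Iw] Ow]; exact: (disjoint Iw Ow).
have CIO : C `<=` In `|` Out by move=> w /CM /cover.
have Oz1 : Out z1.
  by right; exists 0; rewrite mulr0z addr0 -/t1; have := e0; lra.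
have Iz2 : In z2.
  have [m hm] := normalise t2 z2.2.
  have Mz := M_deck j m (CM Cz2); rewrite z2E in Mz.
  have z0 : f 0%N t2 < z2.2 + m%:~R < f 0%N t2 + 1.
    move: hm => /andP[]; rewrite le_eqVlt => /orP[/eqP fe|-> -> //] _.
    by case: (@fM 0%N t2); rewrite fe.
  have [i iN fi] := first_exists Mz t12 z0.
  exists j, m, i; rewrite z2E; split=> //; split=> //.
  have [/andP[_ h1] _] := c1P iN; have [/andP[h2 _] _] := c2P iN.
  by rewrite h1.
case: (conC In_open Out_open CIO dis) => h.
  by have : (C `&` In) z2 by []; rewrite h.
by have : (C `&` Out) z1 by []; rewrite h.
Qed.

End GraphChain.

End EuclideanOpen.

(** * Graphs invariant under one element of Z^3 *)

Section InvariantGraph.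
Variables (R : realType) (omega : R) (A : Z3 -> R -> R -> R).
Hypothesis zA : zaction omega A.
Variables (g : Z3) (tau p : R).
Let s := bshift omega g.
Hypothesis s0 : 0 < s.

(* Linear interpolation between a point and its image, continued equivariantly. *)
Definition segment t := p + (t - tau) / s * (A g tau p - p).

Definition patch_graph (l : int) t := A (g *~ l) (t - l%:~R * s) (segment (t - l%:~R * s)).

Definition invariant_graph t := patch_graph (Num.floor ((t - tau) / s)) t.

Lemma bshiftMz (h : Z3) (l : int) : bshift omega (h *~ l) = l%:~R * bshift omega h.
Proof.
elim/int_rect: l => [|l IH|l IH]; first by rewrite mulr0z bshift0 mul0r.
  by rewrite -addn1 PoszD mulrzDr bshiftD IH intrD mulr1z mulrDl mul1r.
by rewrite -addn1 PoszD opprD mulrzDr bshiftD IH intrD !mulrNz !mulr1z bshiftN mulrDl mulN1r.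
Qed.

Lemma cont1_segment : cont1 segment.
Proof.
move=> t e e0; set q := A g tau p - p.
pose K := `|q| / s + 1.
have K0 : 0 < K by rewrite ltr_wpDl ?divr_ge0// ltW.
exists (e / K); first by rewrite divr_gt0.
move=> y; rewrite ltr_pdivlMr// => yt.
have -> : segment y - segment t = (y - t) * (q / s).
  by rewrite /segment -/q; ring.
rewrite normrM; apply: le_lt_trans yt; rewrite ler_wpM2l//.
by rewrite normrM normfV (gtr0_norm s0) /K lerDl.
Qed.

Lemma cont1_act (h : Z3) (f : R -> R) (c : R) : cont1 f ->
  cont1 (fun t => A h (t - c) (f (t - c))).
Proof.
move=> cf t e e0; have [d d0 hd] := zact_cont zA h (t - c) (f (t - c)) e0.
have [b b0 hb] := cf (t - c) d d0.
exists (Num.min d b); first by rewrite lt_min d0.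
have e1 y : y - c - (t - c) = y - t by ring.
move=> y; rewrite lt_min => /andP[y1 y2]; apply: hd; first by rewrite e1.
by apply: hb; rewrite e1.
Qed.

Lemma segment_end : segment (tau + s) = A g tau (segment tau).
Proof.
rewrite /segment [tau + s]addrC addrK subrr mul0r mul0r addr0 divff ?gt_eqF//.
by rewrite mul1r addrC subrK.
Qed.

Lemma patch_graphS (l : int) t : patch_graph (l + 1) (t + s) = A g t (patch_graph l t).
Proof.
rewrite /patch_graph intrD mulrDl mul1r.
have -> : t + s - (l%:~R * s + s) = t - l%:~R * s by ring.
rewrite mulrzDr mulr1z addrC (zactD zA); congr (A g _ _).
by rewrite bshiftMz -/s subrK.
Qed.

Lemma patch_graph_glue (l : int) : patch_graph l (tau + (l + 1)%:~R * s) =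
  patch_graph (l + 1) (tau + (l + 1)%:~R * s).
Proof.
rewrite /patch_graph addrK.
have -> : tau + (l + 1)%:~R * s - l%:~R * s = tau + s by rewrite intrD; ring.
by rewrite segment_end mulrzDr mulr1z (zactD zA).
Qed.

(** Both end points are included since consecutive patches agree there; this gives continuity at the
    joints. *)
Lemma invariant_graphE (l : int) t : tau + l%:~R * s <= t <= tau + (l + 1)%:~R * s ->
  invariant_graph t = patch_graph l t.
Proof.
move=> /andP[t1]; rewrite le_eqVlt => /orP[/eqP ->|t2].
  rewrite patch_graph_glue /invariant_graph.
  by rewrite [tau + _]addrC addrK mulfK ?gt_eqF// intrKfloor.
rewrite /invariant_graph; congr patch_graph.
apply: floor_def; rewrite ler_pdivlMr// ltr_pdivrMr//.
by apply/andP; split; lra.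
Qed.

Lemma floor_range t : exists l : int,
  tau + l%:~R * s <= t < tau + (l + 1)%:~R * s.
Proof.
exists (Num.floor ((t - tau) / s)).
have e : t - tau = (t - tau) / s * s by rewrite divfK ?gt_eqF.
have h1 : (Num.floor ((t - tau) / s))%:~R * s <= t - tau.
  by rewrite {2}e ler_pM2r// floor_le.
have h2 : t - tau < (Num.floor ((t - tau) / s) + 1)%:~R * s.
  by rewrite {1}e ltr_pM2r// floorD1_gt.
by apply/andP; split; lra.
Qed.

Lemma cont1_invariant_graph : cont1 invariant_graph.
Proof.
have cp l : cont1 (patch_graph l) := cont1_act (g *~ l) (l%:~R * s) cont1_segment.
move=> t e e0; have [l /andP[t1 t2]] := floor_range t.
have [d d0 hd] := cp l t e e0.
have s0' := s0; rewrite intrD in t2.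
have e1 : invariant_graph t = patch_graph l t.
  by apply: invariant_graphE; rewrite t1 intrD ltW.
have right y : t <= y -> `|y - t| < d -> y < tau + (l%:~R + 1) * s ->
    `|invariant_graph y - invariant_graph t| < e.
  move=> ty yd y2; rewrite e1 (@invariant_graphE l); first exact: hd.
  by rewrite intrD (le_trans t1 ty) ltW.
have [lt|] := ltP (tau + l%:~R * s) t.
  exists (Num.min d (Num.min (t - (tau + l%:~R * s)) (tau + (l%:~R + 1) * s - t))).
    by rewrite !lt_min d0 !subr_gt0 lt.
  move=> y; rewrite !lt_min => /andP[y1 /andP[y2 y3]].
  rewrite e1 (@invariant_graphE l); first exact: hd.
  by rewrite intrD; move: y2 y3; rewrite !ltr_norml => ? ?; apply/andP; split; lra.
move=> tl; have te : t = tau + (l - 1 + 1)%:~R * s by rewrite subrK; lra.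
have e2 : invariant_graph t = patch_graph (l - 1) t.
  by rewrite e1 {2}te patch_graph_glue -te subrK.
have [b b0 hb] := cp (l - 1) t e e0.
exists (Num.min d (Num.min b s)); first by rewrite !lt_min d0 b0.
move=> y; rewrite !lt_min => /andP[y1 /andP[y2 y3]].
have [ty|yt] := leP t y.
  by apply: right => //; move: y3; rewrite ltr_norml; lra.
rewrite e2 (@invariant_graphE (l - 1)); first exact: hb.
rewrite -te (ltW yt) andbT intrB.
by move: y3; rewrite ltr_norml; lra.
Qed.

Lemma invariant_graphS t : invariant_graph (t + s) = A g t (invariant_graph t).
Proof.
have [l /andP[t1 t2]] := floor_range t.
rewrite (@invariant_graphE l t) ?t1 ?ltW// (@invariant_graphE (l + 1)).
  exact: patch_graphS.
by rewrite !intrD; rewrite intrD in t2; apply/andP; split; lra.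
Qed.

Lemma invariant_graph_segment t : tau <= t <= tau + s ->
  invariant_graph t = segment t.
Proof.
move=> tt; rewrite (@invariant_graphE 0) ?mul0r ?addr0 ?mul1r//.
by rewrite /patch_graph mulr0z mul0r subr0 (zact0 zA).
Qed.

(** The graph consists of images of the segment, so it avoids an invariant set as soon as the
    segment does. *)
Lemma invariant_graph_orbit t : exists (l : int) u, tau <= u <= tau + s /\
  (t, invariant_graph t) = act omega A (g *~ l) (u, segment u).
Proof.
have [l /andP[t1 t2]] := floor_range t; exists l, (t - l%:~R * s); split.
  by rewrite intrD in t2; apply/andP; split; lra.
rewrite (@invariant_graphE l) ?t1 ?ltW//.
by rewrite /act /= bshiftMz -/s subrK.
Qed.

Lemma segment_near (x0 w t : R) : `|p - x0| < w -> `|A g tau p - x0| < w ->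
  tau <= t <= tau + s -> `|segment t - x0| < w.
Proof.
move=> h1 h2 tt; set c := (t - tau) / s.
have c0 : 0 <= c by rewrite divr_ge0 ?(ltW s0)//; lra.
have c1 : c <= 1 by rewrite ler_pdivrMr// mul1r; lra.
have -> : segment t - x0 = (1 - c) * (p - x0) + c * (A g tau p - x0).
  by rewrite /segment -/c; ring.
have convex a b : 0 < a -> 0 < b -> 0 < (1 - c) * a + c * b.
  move=> a0 b0; have [c2|c2] := ltP c 1.
    by apply: ltr_wpDr; [exact/mulr_ge0/ltW|rewrite mulr_gt0// subr_gt0].
  by rewrite (_ : c = 1); [rewrite subrr mul0r add0r mul1r|lra].
move: h1 h2; rewrite !ltr_norml => /andP[a1 a2] /andP[b1 b2].
have := convex (p - x0 + w) (A g tau p - x0 + w) ltac:(lra) ltac:(lra).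
have := convex (w - (p - x0)) (w - (A g tau p - x0)) ltac:(lra) ltac:(lra).
lra.
Qed.

End InvariantGraph.

(** * Touching translates of an invariant graph *)

Section GraphTranslates.
Variables (R : realType) (omega : R) (A : Z3 -> R -> R -> R).
Hypothesis zA : zaction omega A.
Variables (M : set (R * R)) (g : Z3) (gamma : R -> R).
Hypothesis M_act : forall h z, M z <-> M (act omega A h z).
Hypothesis cgamma : cont1 gamma.
Hypothesis gammaM : forall t, ~ M (t, gamma t).
Hypothesis s0 : 0 < bshift omega g.
Hypothesis gammaS : forall t, gamma (t + bshift omega g) = A g t (gamma t).

Definition tgraph h t := A h (t - bshift omega h) (gamma (t - bshift omega h)).

Lemma tgraph0 t : tgraph 0 t = gamma t.
Proof. by rewrite /tgraph bshift0 subr0 (zact0 zA). Qed.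

Lemma cont1_tgraph h : cont1 (tgraph h).
Proof. exact: (cont1_act zA). Qed.

Lemma tgraphM h t : ~ M (t, tgraph h t).
Proof.
move=> Mh; apply: (@gammaM (t - bshift omega h)); apply/(M_act h).
by rewrite /act /= subrK.
Qed.

Lemma tgraphD h h' t : tgraph (h + h') t = A h (t - bshift omega h) (tgraph h' (t - bshift omega h)).
Proof.
by rewrite /tgraph bshiftD opprD addrA (zactD zA) subrK.
Qed.

Lemma tgraph_act h h' t : tgraph (h + h') (t + bshift omega h) = A h t (tgraph h' t).
Proof. by rewrite tgraphD addrK. Qed.

Lemma tgraph_deck h (m : int) t : tgraph (h + (0, 0, m)) t = tgraph h t + m%:~R.
Proof.
rewrite addrC tgraphD (zact_deck zA) bshiftE /= mul0r addr0 subr0.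
by [].
Qed.

Lemma tgraphDg h t : tgraph (h + g) t = tgraph h t.
Proof.
rewrite tgraphD /tgraph; congr (A h _ _).
set u := t - bshift omega h.
by rewrite -gammaS subrK.
Qed.

Lemma tgraphDgz h (l : int) t : tgraph (h + g *~ l) t = tgraph h t.
Proof.
elim/int_rect: l => [|l IH|l IH]; first by rewrite mulr0z addr0.
  by rewrite -addn1 PoszD mulrzDr mulr1z addrA tgraphDg IH.
by rewrite -IH -addn1 PoszD opprD mulrzDr !mulrNz mulr1z addrA -(tgraphDg (_ - g)) subrK.
Qed.

(** The graphs need not meet: it suffices that in one fibre no point of [M] lies between them. *)
Definition touch h h' := exists t, forall x, between (tgraph h t) (tgraph h' t) x -> ~ M (t, x).

Lemma touch_shift k h h' (t : R) :
  (forall x, between (tgraph h t) (tgraph h' t) x -> ~ M (t, x)) ->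
  forall x, between (tgraph (k + h) (t + bshift omega k)) (tgraph (k + h') (t + bshift omega k)) x ->
    ~ M (t + bshift omega k, x).
Proof.
move=> tch x; rewrite !tgraph_act => xb Mx.
pose y := A (- k) (t + bshift omega k) x.
have xy : x = A k t y.
  rewrite /y -[t in A k t]( addrK (bshift omega k)) -bshiftN -(zactD zA).
  by rewrite subrr (zact0 zA).
apply: (tch y); last by apply/(M_act k); rewrite /act /= -xy.
move: xb; rewrite /between xy !ge_min !le_max !(zact_le zA).
by [].
Qed.

Lemma touchD k h h' : touch h h' -> touch (k + h) (k + h').
Proof. by move=> [t tch]; exists (t + bshift omega k); exact: touch_shift. Qed.

Lemma touch_sym h h' : touch h h' -> touch h' h.
Proof.
move=> [t tch]; exists t => x; rewrite /between minC maxC; exact: tch.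
Qed.

Lemma touch_eq h h' t : tgraph h t = tgraph h' t -> touch h h'.
Proof.
move=> e; exists t => x; rewrite /between -e minxx maxxx => xe.
by have -> : x = tgraph h t by [lra]; exact: tgraphM.
Qed.

(** All translates are invariant under [g], so a touching fibre can be moved by multiples of the
    shift of [g]. *)
Lemma touch_window h h' (c : R) : touch h h' -> exists t,
  c <= t < c + bshift omega g /\
  forall x, between (tgraph h t) (tgraph h' t) x -> ~ M (t, x).
Proof.
move=> [t tch]; pose l := - Num.floor ((t - c) / bshift omega g).
exists (t + l%:~R * bshift omega g); split.
  have e : t - c = (t - c) / bshift omega g * bshift omega g.
    by rewrite divfK ?gt_eqF.
  have h1 : (Num.floor ((t - c) / bshift omega g))%:~R * bshift omega g <= t - c.
    by rewrite {2}e ler_pM2r// floor_le.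
  have h2 : t - c < (Num.floor ((t - c) / bshift omega g) + 1)%:~R * bshift omega g.
    by rewrite {1}e ltr_pM2r// floorD1_gt.
  rewrite /l mulrNz; rewrite intrD in h2; apply/andP; split; lra.
have := touch_shift (k := g *~ l) tch; rewrite bshiftMz => H x.
by have := H x; rewrite ![g *~ l + _]addrC !tgraphDgz.
Qed.

Variables (C : set (R * R)) (z1 z2 : R * R) (t2 e : R) (j : int).
Hypotheses (CM : C `<=` M) (conC : tconnected C) (Cz1 : C z1) (Cz2 : C z2).
Hypotheses (z2E : z2.1 + j%:~R = t2) (e0 : 0 < e).
Hypotheses (t12 : z1.1 + 3 * e <= t2) (t21 : t2 + 3 * e <= z1.1 + 1).
Hypothesis se : bshift omega g <= e.

Lemma no_chain (N : nat) (hs : nat -> Z3) :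
  (forall i, (i < N)%N -> touch (hs i) (hs i.+1)) ->
  ~ (forall t, tgraph (hs 0%N) t + 1 <= tgraph (hs N) t).
Proof.
move=> tch climb.
have e0' := e0; have t12' := t12; have t21' := t21; have se' := se.
have win c : exists cc : nat -> R, forall i, (i < N)%N ->
    c <= cc i < c + bshift omega g /\
    forall x, between (tgraph (hs i) (cc i)) (tgraph (hs i.+1) (cc i)) x -> ~ M (cc i, x).
  have : forall i : nat, exists t, (i < N)%N -> c <= t < c + bshift omega g /\
      forall x, between (tgraph (hs i) t) (tgraph (hs i.+1) t) x -> ~ M (t, x).
    move=> i; case: (ltnP i N) => iN; last by exists 0.
    by have [t ht] := touch_window c (tch i iN); exists t.
  by move=> /choice[cc hcc]; exists cc.
(* Each window has length at most [e], so the gaps of [3 * e] leave the margins that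
   [graph_chain_separates] requires. *)
have [c1 c1P] := win (z1.1 + e); have [c2 c2P] := win (t2 + e).
apply: (@graph_chain_separates R M C z1 z2 t2 e j N (fun i => tgraph (hs i)) c1 c2) => //.
- by apply/andP; split; lra.
- by move=> z k m Mz; rewrite -(act_deck zA); exact: (M_act _ _).1 Mz.
- by move=> i; exact: cont1_tgraph.
- by move=> i t; exact: tgraphM.
- by move=> i iN; have [h1 h2] := c1P i iN; split=> //; apply/andP; split; lra.
- by move=> i iN; have [h1 h2] := c2P i iN; split=> //; apply/andP; split; lra.
Qed.

Lemma multiples_chain k (i : nat) : touch 0 k -> touch (k *+ i) (k *+ i.+1).
Proof.
by move=> tch; have := touchD (k *+ i) tch; rewrite addr0 -mulrSr.
Qed.

(** If the translate were at least [gamma + 1] everywhere, the multiples of [k] would form a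
    climbing chain. If it met [gamma + 1], the chain could be prolonged there by [(0, 0, 1)]. *)
Lemma multiples_lt k (l : nat) t : touch 0 k -> tgraph (k *+ l) t < gamma t + 1.
Proof.
move=> tch; rewrite ltNge; apply/negP => le.
have [[t' lt']|no] := pselect (exists t', tgraph (k *+ l) t' < gamma t' + 1); last first.
  apply: (@no_chain l (fun i => k *+ i)).
    by move=> i _; exact: multiples_chain.
  move=> t'; rewrite mulr0n tgraph0 leNgt; apply/negP => lt'.
  by apply: no; exists t'.
have [t'' e''] : exists t'', tgraph (k *+ l) t'' = tgraph (0, 0, 1) t''.
  pose f t := tgraph (k *+ l) t - tgraph (0, 0, 1) t.
  have gam1 u : tgraph (0, 0, 1) u = gamma u + 1.
    by have := tgraph_deck 0 1 u; rewrite add0r tgraph0 mulr1z.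
  have cf : cont1 f.
    move=> u d d0; have d2 : 0 < d / 2 by lra.
    have [b b0 hb] := cont1_tgraph (k *+ l) u d2.
    have [b' b'0 hb'] := cont1_tgraph (0, 0, 1) u d2.
    exists (Num.min b b'); first by rewrite lt_min b0.
    move=> y; rewrite lt_min => /andP[/hb h1 /hb' h2].
    by move: h1 h2; rewrite /f !ltr_norml; lra.
  move: le; rewrite le_eqVlt => /orP[/eqP et|lt].
    by exists t; rewrite gam1.
  have [||u _ fu] := cont1_zero2 (a := t') (b := t) cf; rewrite ?/f ?gam1; [lra|lra|].
  by exists u; apply/eqP; rewrite -subr_eq0; apply/eqP.
apply: (@no_chain l.+1 (fun i => if (i <= l)%N then k *+ i else (0, 0, 1))).
  move=> i; rewrite ltnS => il; rewrite il; case: (ltnP i l) => il'.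
    exact: multiples_chain.
  have -> : i = l by apply/eqP; rewrite eqn_leq il.
  exact: touch_eq e''.
move=> u; rewrite ltnn /= mulr0n tgraph0.
by have := tgraph_deck 0 1 u; rewrite add0r tgraph0 mulr1z => ->.
Qed.

Lemma multiples_gt k (l : nat) t : touch 0 k -> gamma t - 1 < tgraph (- k *+ l) t.
Proof.
move=> tch; have h u := multiples_lt l u tch.
have : tgraph (- k *+ l + k *+ l) t < tgraph (- k *+ l) t + 1.
  rewrite tgraphD; set u := t - _.
  apply: lt_le_trans (zact_incr zA _ _ (h u)) _.
  by have := zact_vertical zA (- k *+ l) 1 u (gamma u); rewrite mulr1z => ->.
by rewrite -mulrnDl addNr mul0rn tgraph0; lra.
Qed.

Variable k : Z3.
Hypothesis touch_k : touch 0 k.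
Hypothesis D0 : 0 < minor g k.

Let touch_Nk : touch 0 (- k).
Proof. by have := touchD (- k) touch_k; rewrite addr0 addNr => /touch_sym. Qed.

Lemma powers_gt (v : int) t : gamma t - 1 < tgraph (k *~ v) t.
Proof.
case: v => n; last by rewrite NegzE mulrNz -mulNrn; exact: multiples_gt.
by have := multiples_gt n t touch_Nk; rewrite opprK.
Qed.

Let psik := psi (g.1.2 * k.2 - g.2 * k.1.2) (g.2 * k.1.1 - g.1.1 * k.2) (minor g k).

(** Cramer's rule for the first two coordinates of [h] in terms of [g] and [k]; [psik h] is the
    vertical remainder. *)
Lemma cramer h : h *~ minor g k = g *~ minor h k + k *~ minor g h + (0, 0, psik h).
Proof.
have mz (a : Z3) (c : int) : a *~ c = (a.1.1 * c, a.1.2 * c, a.2 * c).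
  elim/int_rect: c => [|c IH|c IH]; first by rewrite mulr0z !mulr0.
    by rewrite -addn1 PoszD mulrzDr mulr1z IH !mulrDr !mulr1; case: a {IH} => [[? ?] ?].
  rewrite -addn1 PoszD opprD mulrzDr !mulrNz mulr1z -mulrNz IH !mulrDr !mulrN1.
  by case: a {IH} => [[? ?] ?].
rewrite !mz; apply/eqP; rewrite -subr_eq0; apply/eqP.
by congr (_, _, _); rewrite /psik /psi /minor /=; ring.
Qed.

Let Dn := absz (minor g k).

Lemma tgraph_cramer h (l : nat) t :
  tgraph (h *+ (Dn * l)) t = tgraph (k *~ (minor g h * l%:Z)) t + (psik h * l%:Z)%:~R.
Proof.
have -> : h *+ (Dn * l) = g *~ (minor h k * l%:Z) + k *~ (minor g h * l%:Z) + (0, 0, psik h * l%:Z).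
  have -> : h *+ (Dn * l) = h *~ minor g k *+ l.
    by rewrite mulrnA; congr (_ *+ l); rewrite pmulrn gtz0_abs.
  rewrite cramer !mulrnDl ![_ *~ _ *+ l]pmulrn -!mulrzA; congr (_ + _ + _).
  elim: (l) => [|n IH]; first by rewrite mulr0n mulr0.
  by rewrite mulrSr IH -addn1 PoszD mulrDr mulr1.
by rewrite tgraph_deck [g *~ _ + _]addrC tgraphDgz.
Qed.

(** Suppose it fails at [t]. If the translate by [h] is below [gamma - 1] everywhere, iteration
    pushes that by [h *+ Dn] to [gamma - Dn] or lower, although [cramer] and [powers_gt] keep it
    above [gamma - 1]. Otherwise the translate by [h + (0, 0, 1)] meets [gamma], and the multiples
    of this element form a climbing chain. *)
Lemma tgraph_ge h t : 0 <= psik h -> gamma t - 1 <= tgraph h t.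
Proof.
move=> ph; rewrite leNgt; apply/negP => lt.
have Dn0 : (0 < Dn)%N by rewrite absz_gt0 gt_eqF.
(* The multiple [Dn * 2] rises by [2 * psik h' >= 2]: [powers_gt] may lose one unit, and a full turn
   remains. *)
have step (h' : Z3) : touch 0 h' -> psik h' = psik h + minor g k -> False.
  move=> tch ph'; apply: (@no_chain (Dn * 2) (fun i => h' *+ i)).
    by move=> i _; exact: multiples_chain.
  move=> u; rewrite mulr0n tgraph0 tgraph_cramer.
  have := powers_gt (minor g h' * 2) u.
  have : 1%:~R <= (minor g k)%:~R :> R by rewrite ler_int -gtz0_ge1.
  have : 0 <= (psik h)%:~R :> R by rewrite ler0z.
  by rewrite ph' !intrM intrD mulr1z; lra.
have [[t' le']|no] := pselect (exists t', gamma t' - 1 <= tgraph h t').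
  apply: (step (h + (0, 0, 1))); last by rewrite /psik psiD psi_deck mulr1.
  suff [u eu] : exists u, tgraph 0 u = tgraph (h + (0, 0, 1)) u by exact: touch_eq eu.
  pose f u := tgraph (h + (0, 0, 1)) u - gamma u.
  have fE u : f u = tgraph h u + 1 - gamma u by rewrite /f tgraph_deck mulr1z.
  have cf : cont1 f.
    move=> u d d0; have d2 : 0 < d / 2 by lra.
    have [b b0 hb] := cont1_tgraph (h + (0, 0, 1)) u d2.
    have [b' b'0 hb'] := cgamma u d2.
    exists (Num.min b b'); first by rewrite lt_min b0.
    move=> y; rewrite lt_min => /andP[/hb h1 /hb' h2].
    by move: h1 h2; rewrite /f !ltr_norml; lra.
  suff [u fu] : exists u, f u = 0.
    by exists u; rewrite tgraph0; move: fu; rewrite /f; lra.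
  move: le'; rewrite le_eqVlt => /orP[/eqP e'|lt'].
    by exists t'; rewrite fE -e'; ring.
  have [||u _ fu] := cont1_zero2 (a := t) (b := t') cf; rewrite ?fE; [lra|lra|].
  by exists u.
have below u : tgraph h u <= gamma u - 1.
  by rewrite leNgt; apply/negP => lu; apply: no; exists u; exact: ltW.
have iter (i : nat) u : tgraph (h *+ i) u <= gamma u - i%:R.
  elim: i u => [|i IH] u; first by rewrite mulr0n tgraph0 subr0.
  rewrite mulrS tgraphD; set v := u - _.
  have := IH v; rewrite -(zact_le zA h v).
  have -> : A h v (gamma v - i%:R) = tgraph h u - i%:R.
    have := zact_vertical zA h (- i%:Z) v (gamma v).
    by rewrite mulrNz -pmulrn => ->; rewrite /tgraph.
  by have := below u; rewrite -natr1; lra.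
have := iter (Dn * 1)%N t; rewrite tgraph_cramer muln1.
have := powers_gt (minor g h * 1) t.
have : 0 <= (psik h)%:~R :> R by rewrite ler0z.
have : 1 <= Dn%:R :> R by rewrite ler1n.
by rewrite !intrM mulr1; lra.
Qed.

End GraphTranslates.

(** * Components meeting several fibres *)

Section Spread.
Variables (R : realType) (omega : R) (F : R -> R -> R).
Hypothesis irr : @irrational R omega.
Hypothesis TBV : in_T_BV F.
Hypothesis no_tube : no_regular_invariant_graph (skewT omega F).
Let A := skew_action omega F.
Let zA : zaction omega A := skew_zaction omega TBV.
Variable M : set (R * R).
Hypothesis M_act : forall h z, M z <-> M (act omega A h z).

Lemma forward_return (a0 r x0 w : R) : 0 < r -> 0 < w ->
  exists (h : Z3) t x, [/\ h.1.1 != 0 /\ 0 < bshift omega h, `|t - a0| < r,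
    `|x - x0| < w, `|t + bshift omega h - a0| < r & `|A h t x - x0| < w].
Proof.
move=> r0 w0; have [h [t [x [h0 h1 h2 h3 h4]]]] := box_return irr TBV no_tube a0 x0 r0 w0.
have := bshift_neq0 irr h0; case: (ltrgtP (bshift omega h) 0) => // hs _; last first.
  by exists h, t, x.
exists (- h), (t + bshift omega h), (A h t x); split=> //.
- by rewrite /= oppr_eq0 h0 bshiftN oppr_gt0.
- by rewrite bshiftN addrK.
- by have := zactD zA (- h) h t x; rewrite addNr (zact0 zA) => <-.
Qed.

Variables (C : set (R * R)) (z1 z2 : R * R) (t2 e : R) (j : int).
Hypotheses (CM : C `<=` M) (conC : tconnected C) (Cz1 : C z1) (Cz2 : C z2).
Hypotheses (z2E : z2.1 + j%:~R = t2) (e0 : 0 < e).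
Hypotheses (t12 : z1.1 + 3 * e <= t2) (t21 : t2 + 3 * e <= z1.1 + 1).

Lemma spread_component_full : eopen (~` M) -> forall z, M z.
Proof.
move=> oM z0; apply: contrapT => Mz0.
have [eps eps0 box] := oM z0 Mz0.
(* A return to an arc of radius [e / 2] has shift at most [e], as [no_chain] requires. *)
have e0' := e0; pose r := Num.min eps (e / 2).
have r0 : 0 < r by rewrite lt_min eps0; lra.
have reps : r <= eps by rewrite ge_min lexx.
have re : r <= e / 2 by rewrite ge_min lexx orbT.
have boxM t x : `|t - z0.1| < r -> `|x - z0.2| < eps -> ~ M (t, x).
  by move=> h1 h2; apply: box => //=; exact: lt_le_trans reps.
have [g [tau [p [[g0 s0] h1 h2 h3 h4]]]] := forward_return z0.1 z0.2 r0 eps0.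
pose gamma := invariant_graph omega A g tau p.
have base_near u : tau <= u <= tau + bshift omega g -> `|u - z0.1| < r.
  by move: h1 h3; rewrite !ltr_norml; lra.
have seg_near u (uu : tau <= u <= tau + bshift omega g) := segment_near s0 h2 h4 uu.
have cgamma : cont1 gamma by exact: cont1_invariant_graph.
have gammaM t : ~ M (t, gamma t).
  have [l [u [uu ->]]] := invariant_graph_orbit zA tau p s0 t.
  by move=> /(M_act _ _).2; apply: boxM; [exact: base_near|exact: seg_near].
have gammaS t : gamma (t + bshift omega g) = A g t (gamma t) by exact: invariant_graphS.
have se : bshift omega g <= e by move: h1 h3; rewrite !ltr_norml; lra.
have n0 : 0 < `|g.1.1%:~R| :> R by rewrite normr_gt0 intr_eq0.
(* The second box is centred over the middle of the segment. The first bound in [r'] keeps it over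
   the segment, the second makes [g'] independent of [g] by [minor_neq0]. *)
pose a' := tau + bshift omega g / 2.
pose r' := Num.min (bshift omega g / 2) (bshift omega g / `|g.1.1%:~R| / 2).
have r'0 : 0 < r' by rewrite lt_min !divr_gt0.
have r's : r' <= bshift omega g / 2 by rewrite ge_min lexx.
have r'n : r' <= bshift omega g / `|g.1.1%:~R| / 2 by rewrite ge_min lexx orbT.
have [g' [t' [x' [g'0 k1 k2 k3 k4]]]] := box_return irr TBV no_tube a' z0.2 r'0 eps0.
have inseg u : `|u - a'| < r' -> tau <= u <= tau + bshift omega g.
  by rewrite /a' ltr_norml; lra.
have near_gamma u : `|u - a'| < r' -> `|gamma u - z0.2| < eps.
  move=> /inseg uu; rewrite /gamma invariant_graph_segment//; exact: seg_near.
have touch_g' : touch omega A M gamma 0 g'.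
  (* The return point splits the arc between the graphs: one part lies in the box, the other is the
     image under [g'] of an arc in the box. *)
  exists (t' + bshift omega g') => x.
  rewrite (tgraph0 zA) -[g' in tgraph _ _ _ g']addr0 (tgraph_act zA) (tgraph0 zA) => xb.
  have [xg|xg] : between (gamma (t' + bshift omega g')) (A g' t' x') x \/
      between (A g' t' x') (A g' t' (gamma t')) x.
    exact: between_split.
    apply: boxM; first exact/base_near/inseg.
    by apply: between_near xg => //; exact: near_gamma.
  move=> Mx; pose y := A (- g') (t' + bshift omega g') x.
  have xy : x = A g' t' y.
    have := zactD zA g' (- g') (t' + bshift omega g') x.
    by rewrite subrr (zact0 zA) bshiftN addrK.
  apply: (@boxM t' y); first exact/base_near/inseg.
    apply: (@between_near _ x' (gamma t')) => //; first exact: near_gamma.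
    by move: xg; rewrite /between xy !ge_min !le_max !(zact_le zA).
  by apply/(M_act g'); rewrite /act /= -xy.
have m0 : minor g g' != 0.
  apply: (minor_neq0 irr g0 g'0); rewrite (gtr0_norm s0).
  by move: k1 k3 r'n; rewrite !ltr_norml; lra.
have main (k : Z3) : touch omega A M gamma 0 k -> 0 < minor g k -> False.
  move=> tk mk.
  have S0 : [set z | gamma z.1 < z.2] !=set0.
    by exists (0, gamma 0 + 1) => /=; rewrite ltrDl.
  have upS t x y : [set z | gamma z.1 < z.2] (t, x) -> x <= y ->
      [set z | gamma z.1 < z.2] (t, y).
    by move=> /= tx xy; exact: lt_le_trans xy.
  apply: (no_bounded_kernel irr TBV no_tube mk (eopen_above cgamma) S0 upS).
  move=> t0; have [d d0 hd] := cgamma t0 _ (@ltr01 R).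
  (* One unit is lost in [tgraph_ge], the other to the variation of [gamma] near [t0]. *)
  exists d, (gamma t0 - 2); split=> // h z ph /= gz zt.
  have := zact_incr zA h z.1 gz.
  have := tgraph_ge zA M_act cgamma gammaM s0 gammaS CM conC Cz1 Cz2 z2E e0 t12 t21 se tk mk
    (z.1 + bshift omega h) ph.
  rewrite /tgraph addrK; have := hd _ zt; rewrite /= -/A ltr_norml; lra.
case: (ltrgtP (minor g g') 0) m0 => // mg _; last exact: (main g').
apply: (main (- g')).
  by have := touchD zA M_act (- g') touch_g'; rewrite addr0 addNr => /touch_sym.
by have -> : minor g (- g') = - minor g g' by [rewrite /minor /=; ring]; rewrite oppr_gt0.
Qed.

End Spread.

Theorem mainTheorem10 (R : realType) (omega : R) (F : R -> R -> R) :
  (0 <= omega < 1)%R -> (@irrational R omega) ->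
  in_T_BV F ->
  no_regular_invariant_graph (skewT omega F) ->
  ~ minimal_map (skewT omega F) ->
  forall M : set (R * R), minimal_set (skewT omega F) M ->
  forall z, M z -> tcomponent M z `<=` tfibre z.1.
Proof.
move=> _ irr TBV no_tube not_minimal M minM z Mz w [C [conC CM Cz Cw]].
have [_ clM invM _] := minM.
have M_deck v (k m : int) : M v -> M (v.1 + k%:~R, v.2 + m%:~R).
  move=> Mv; apply: contrapT => nM.
  have := topen_shift (- k) (- m) clM nM; rewrite /= !mulrNz !addrK.
  by apply; rewrite -surjective_pairing.
pose A := skew_action omega F; have zA : zaction omega A := skew_zaction omega TBV.
have M_iter p v : M v <-> M (iter p (skewT omega F) v).
  by elim: p => //= p ->; exact: invM.
have M_act h v : M v <-> M (act omega A h v).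
  have pos_act (n : nat) k m u : M u <-> M (act omega A (n%:Z, k, m) u).
    have e : (n%:Z, k, m) = (0, k, m) + (n%:Z, 0, 0) :> Z3.
      by rewrite -[RHS]/(0 + n%:Z, k + 0, m + 0) !addr0 add0r.
    rewrite e (actD zA) -iter_skewT// (act_deck zA); split.
      by move=> /(M_iter n _).1 /M_deck.
    move=> /(M_deck _ (- k) (- m)); rewrite /= !mulrNz !addrK -surjective_pairing.
    exact: (M_iter n _).2.
  case: h => [[[n|n] k] m]; first exact: pos_act.
  rewrite -[in X in X <-> _](actK zA (Negz n, k, m) v).
  have -> : - (Negz n, k, m) = (n.+1%:Z, - k, - m) :> Z3 by rewrite NegzE -[LHS]/(- - n.+1%:Z, - k, - m) opprK.
  exact: iff_sym (pos_act _ _ _ _).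
apply: contrapT => nw.
(* A deck translation brings [w] over the unit interval that starts at [z.1]; it lies in the
   interior because [w] is in another fibre. *)
pose j := - Num.floor (w.1 - z.1); pose t2 := w.1 + j%:~R.
have t2z : z.1 < t2 < z.1 + 1.
  rewrite /t2 /j mulrNz; have f1 := floor_le (w.1 - z.1).
  have := floorD1_gt (w.1 - z.1); rewrite intrD => f2; apply/andP; split; last by lra.
  rewrite lt_neqAle; apply/andP; split; last by lra.
  apply/eqP => e; apply: nw; exists (Num.floor (w.1 - z.1)); lra.
pose e := Num.min (t2 - z.1) (z.1 + 1 - t2) / 3.
have e0 : 0 < e by rewrite divr_gt0// lt_min; lra.
have e1 : 3 * e <= t2 - z.1 by rewrite /e mulrC divfK// ge_min lexx.
have e2 : 3 * e <= z.1 + 1 - t2 by rewrite /e mulrC divfK// ge_min lexx orbT.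
have full : forall v, M v.
  apply: (@spread_component_full R omega F irr TBV no_tube M M_act C z w t2 e j) => //.
  - by lra.
  - by lra.
  - exact: topen_eopen.
apply: not_minimal; rewrite /minimal_map.
by have -> : setT = M by apply/seteqP; split.
Qed.
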